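(* For $\tau$ in the upper half-plane let $$F_1(\tau)=\theta_2(\tau)\theta_3(\tau)^8\theta_4(\tau),\qquad F_2(\tau)=\theta_2(\tau)\theta_3(\tau)\theta_4(\tau)^8,\qquad F_3(\tau)=\theta_2(\tau)^8\theta_3(\tau)\theta_4(\tau),$$ and for $j=1,2,3$ let $$R_j(X):=\int_0^{i\infty}F_j(\tau)(\tau-X)^3\,d\tau .$$ Then the period polynomials $R_2$ and $R_3$ satisfy $$R_2(0)=\frac{2\sqrt{2}}{3}R_1(0),$$ and $$R_2(X)=R_2(0)\left(1+\frac{3i}{4}X-\frac{1}{4}X^2\right)-iR_3(0)X^3,$$ $$R_3(X)=R_3(0)+R_2(0)\left(\frac{i}{4}X-\frac{3}{4}X^2-iX^3\right).$$
   Context: For $\tau$ in the upper half-plane $\mathbb{H}$ put $\mathfrak q=e^{\pi i\tau}$. The theta constants are $$\theta_2(\tau)=\sum_{n\in\mathbb Z}\mathfrak q^{(n+1/2)^2},\qquad \theta_3(\tau)=\sum_{n\in\mathbb Z}\mathfrak q^{n^2},\qquad \theta_4(\tau)=\sum_{n\in\mathbb Z}(-1)^n\mathfrak q^{n^2},$$ where $\mathfrak q^{(n+1/2)^2}$ means $e^{\pi i\tau(n+1/2)^2}$. The integrals from $0$ to $i\infty$ are taken along the positive imaginary axis; each $R_j(X)$ is a polynomial in $X$ with complex coefficients. *)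

(* Defs.v *)
From Stdlib Require Import Reals ZArith.
From Coquelicot Require Import Coquelicot.
Local Open Scope R_scope.

Definition Cexp (z : C) : C :=
  (exp (Re z) * cos (Im z), exp (Re z) * sin (Im z)).

Definition CSeries (a : nat -> C) : C :=
  (Series (fun n => Re (a n)), Series (fun n => Im (a n))).

(** The sum of [a n] over all integers [n], as the sum over [n >= 0] plus the
    sum over [n <= -1]. *)
Definition CSeriesZ (a : Z -> C) : C :=
  Cplus (CSeries (fun n => a (Z.of_nat n)))
        (CSeries (fun n => a (- Z.of_nat (S n))%Z)).

(** [nome_pow tau r] is [q^r] with [q = e^(pi i tau)], where for every real [r]
    the power means [e^(pi i tau r)]. *)
Definition nome_pow (tau : C) (r : R) : C :=
  Cexp (PI * Ci * tau * r)%C.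

(** The theta constants are meant for [Im tau > 0]; elsewhere the series do not
    converge and the values carry no meaning. *)
Definition theta2 (tau : C) : C :=
  CSeriesZ (fun n => nome_pow tau ((IZR n + 1 / 2) ^ 2)).

Definition theta3 (tau : C) : C :=
  CSeriesZ (fun n => nome_pow tau (IZR n ^ 2)).

Definition theta4 (tau : C) : C :=
  CSeriesZ (fun n => Cmult (powerRZ (-1) n) (nome_pow tau (IZR n ^ 2))).

Definition F1 (tau : C) : C := (theta2 tau * theta3 tau ^ 8 * theta4 tau)%C.
Definition F2 (tau : C) : C := (theta2 tau * theta3 tau * theta4 tau ^ 8)%C.
Definition F3 (tau : C) : C := (theta2 tau ^ 8 * theta3 tau * theta4 tau)%C.

(** The integral of [f(tau) dtau] from [0] to [i oo] along the positive
    imaginary axis: [tau = i t], [dtau = i dt], improper at both ends. *)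
Definition int_0_ioo (f : C -> C) : C :=
  RInt_gen (V := C_R_CompleteNormedModule)
    (fun t : R => (f (Ci * t) * Ci)%C) (at_right 0) (Rbar_locally p_infty).

Definition period_poly (F : C -> C) (X : C) : C :=
  int_0_ioo (fun tau => (F tau * (tau - X) ^ 3)%C).

(* Main.v *)
Require Import Defs.
From Stdlib Require Import Reals Lra Lia ZArith Psatz.
From Coquelicot Require Import Coquelicot.
Local Open Scope R_scope.
Local Open Scope C_scope.

(** Two transformation laws and a decay estimate carry the proof.  The translation [tau + 1] fixes
    [F3] and exchanges [F1] and [F2] up to the factor [zeta = exp (i pi / 4)]
    ([F_T]).  The inversion [- 1 / tau] acts with weight 5: it fixes [F1] and
    exchanges [F2] and [F3] ([F_inversion]).  Each product decays exponentially
    at infinity, because it contains [theta2] ([exp_decay_F]).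

    By the decay, each [F z ^ k] with [k <= 3] has a primitive [P F k] in the
    upper half-plane that vanishes at infinity ([moment_primitives_exist]).
    If [Fs] is the image of [F] under the inversion, the substitution
    [z = - 1 / u] shows that

      [P F k tau + i (-1)^k P Fs (3 - k) (- 1 / tau)]

    does not depend on [tau] ([period_coeff_const]).  Letting [tau] tend to 0 on
    the imaginary axis identifies this constant with minus the [k]-th moment of
    [F], and the moments are the coefficients of the period polynomials
    ([period_poly_coeff]).  Now compare its values at [rho = exp (i pi / 3)] and
    at [rho - 1 = - 1 / rho].  These two points are exchanged by the inversion,
    and the translation expresses the values of the primitives at [rho] by those
    at [rho - 1].  The result is a system of linear equations between the twelve
    values at [rho - 1], and all the claimed relations follow from it
    ([moment_relations], [period_coeff_dual]).

    The analytic input is the inversion formula of the theta constants, for all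
    [tau] in the upper half-plane and not only on the imaginary axis.  It is
    Poisson summation ([theta_inversion_fourier]): the sum over [n] of
    [exp (pi i sg (n + x)^2)] is periodic in [x], and its Fourier coefficients
    satisfy a differential equation in the frequency, which makes them a constant
    times a Gaussian of modulus [tau = - 1 / sg] ([gauss_transform_eq]).  A
    differential equation in [sg] shows that the square of the constant is
    [i / sg] ([gauss_transform_sqr]), and a continuous periodic function is
    determined by its Fourier coefficients ([fourier_unique]).  The termwise
    differentiation of all series comes from a single quadratic remainder
    estimate ([theta_sum_remainder]). *)

(** * Calculus for complex functions of a real variable *)

(** The complex plane is regarded as a real normed plane; the parameter of a
    derivative is real. *)
Definition is_derC (f : R -> C) (x : R) (l : C) : Prop :=
  is_derive (K := R_AbsRing) (V := C_R_NormedModule) f x l.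

Definition is_RIntC (f : R -> C) (a b : R) (l : C) : Prop := is_RInt (V := C_R_NormedModule) f a
  b l.

Definition RIntC (f : R -> C) (a b : R) : C := RInt (V := C_R_CompleteNormedModule) f a b.

Lemma Cmod_norm_R (x : C) : norm (x : C_R_NormedModule) = Cmod x.
Proof.
unfold norm; simpl; unfold prod_norm, Cmod, norm; simpl; unfold abs; simpl.
f_equal. rewrite !Rmult_1_r. rewrite <- !Rabs_mult.
rewrite !Rabs_pos_eq; try reflexivity; apply Rle_0_sqr.
Qed.

Lemma is_derive_C (f : R -> C) (x : R) (l : C) :
  is_derive (fun t => Re (f t)) x (Re l) -> is_derive (fun t => Im (f t)) x (Im l) ->
  is_derC f x l.
Proof.
intros H1 H2.
apply (is_derive_ext (V := C_R_NormedModule) (fun t => (Re (f t), Im (f t)))).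
  intro t; now destruct (f t).
assert (K : filterdiff (K:=R_AbsRing) (V := C_R_NormedModule) (fun t => ((fun a b => (a, b))
  (Re (f t)) (Im (f t)))) (locally x) (fun y => ((scal y (Re l)), (scal y (Im l))))).
{ apply (filterdiff_comp'_2 (W := C_R_NormedModule) (fun t => Re (f t)) (fun t => Im (f t))
    (fun a b : R => (a, b)) x _ _ (fun a b => (a, b))); auto.
  apply (filterdiff_ext_lin _ (fun t => t)).
  apply (filterdiff_ext (fun t => t)). now intros [a b]. apply filterdiff_id.
  now intros [a b]. }
unfold is_derive. eapply filterdiff_ext_lin. exact K.
intro y; simpl. destruct l; reflexivity.
Qed.

Lemma is_derive_Re (f : R -> C) x l : is_derC f x l -> is_derive (fun t => Re (f t)) x (Re l).
Proof.
intro H.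
assert (K := filterdiff_comp' (U := R_NormedModule) (V := C_R_NormedModule) (W :=
  R_NormedModule) f Re x _ Re H).
apply (filterdiff_ext_lin _ _ _ (K (filterdiff_linear _ (is_linear_fst (U:=R_NormedModule)
  (V:=R_NormedModule))))).
intro y. destruct l; reflexivity.
Qed.

Lemma is_derive_Im (f : R -> C) x l : is_derC f x l -> is_derive (fun t => Im (f t)) x (Im l).
Proof.
intro H.
assert (K := filterdiff_comp' (U := R_NormedModule) (V := C_R_NormedModule) (W :=
  R_NormedModule) f Im x _ Im H).
apply (filterdiff_ext_lin _ _ _ (K (filterdiff_linear _ (is_linear_snd (U:=R_NormedModule)
  (V:=R_NormedModule))))).
intro y. destruct l; reflexivity.
Qed.

Lemma is_derive_Ceq (f : R -> C) x l l' : is_derC f x l -> l = l' -> is_derC f x l'.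
Proof. now intros H <-. Qed.

Lemma is_derive_Cplus (f g : R -> C) x df dg :
  is_derC f x df -> is_derC g x dg -> is_derC (fun t => f t + g t) x (df + dg).
Proof. apply (is_derive_plus (V := C_R_NormedModule)). Qed.

Lemma is_derive_Cminus (f g : R -> C) x df dg :
  is_derC f x df -> is_derC g x dg -> is_derC (fun t => f t - g t) x (df - dg).
Proof. apply (is_derive_minus (V := C_R_NormedModule)). Qed.

Lemma is_derive_Cconst (c : C) x : is_derC (fun _ => c) x 0.
Proof. apply (is_derive_const (V := C_R_NormedModule)). Qed.

Ltac rring := match goal with |- ?a = ?b => change (@eq R a b) end; unfold scal, opp, plus,
  mult, Re, Im; simpl; unfold opp, plus, mult; simpl; ring.

Lemma is_derive_Rcompose4 (u v p q : R -> R) x du dv dp dq :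
  is_derive u x du -> is_derive v x dv -> is_derive p x dp -> is_derive q x dq ->
  is_derive (fun t => u t * p t - v t * q t)%R x (du * p x + u x * dp - (dv * q x + v x * dq))%R.
Proof.
intros Hu Hv Hp Hq.
exact (is_derive_minus _ _ _ _ _ (is_derive_mult u p x du dp Hu Hp Rmult_comm) (is_derive_mult v
  q x dv dq Hv Hq Rmult_comm)).
Qed.

Lemma is_derive_eq (f : R -> R) x l l' : is_derive f x l -> l = l' -> is_derive f x l'.
Proof. now intros H <-. Qed.

Lemma is_derive_Cmult (f g : R -> C) x df dg :
  is_derC f x df -> is_derC g x dg -> is_derC (fun t => f t * g t) x (df * g x + f x * dg).
Proof.
intros Hf Hg.
assert (A1 := is_derive_Re _ _ _ Hf). assert (A2 := is_derive_Im _ _ _ Hf).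
assert (B1 := is_derive_Re _ _ _ Hg). assert (B2 := is_derive_Im _ _ _ Hg).
apply is_derive_C; simpl.
- eapply is_derive_eq. apply (is_derive_Rcompose4 _ _ _ _ _ _ _ _ _ A1 A2 B1 B2).
  rring.
- eapply is_derive_eq.
  eapply is_derive_ext. 2: apply (is_derive_Rcompose4 _ _ _ _ _ _ _ _ _ A1 (is_derive_opp _ _ _
    A2) B2 B1).
  intro t; rring. rring.
Qed.

Lemma is_derive_Cexp (f : R -> C) x df :
  is_derC f x df -> is_derC (fun t => Cexp (f t)) x (Cexp (f x) * df).
Proof.
intros Hf.
assert (A1 := is_derive_Re _ _ _ Hf). assert (A2 := is_derive_Im _ _ _ Hf).
assert (E : is_derC (fun t => RtoC (exp (Re (f t)))) x (RtoC (Re df * exp (Re (f x)))%R)).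
{ apply is_derive_C; simpl; [|apply (is_derive_const (V:=R_NormedModule))].
  eapply is_derive_eq. apply (is_derive_comp exp (fun t => Re (f t)));
    [apply is_derive_exp|exact A1]. reflexivity. }
assert (E' : is_derC (fun t => (cos (Im (f t)), sin (Im (f t))))
  x ((- Im df * sin (Im (f x)))%R, (Im df * cos (Im (f x)))%R)).
{ apply is_derive_C; simpl.
  eapply is_derive_eq. apply (is_derive_comp cos (fun t => Im (f t)));
    [apply is_derive_cos|exact A2]. rring.
  eapply is_derive_eq. apply (is_derive_comp sin (fun t => Im (f t)));
    [apply is_derive_sin|exact A2]. rring. }
assert (K := is_derive_Cmult _ _ _ _ _ E E').
eapply is_derive_Ceq. eapply (is_derive_ext (V := C_R_NormedModule)). 2: exact K.
intro t; apply injective_projections; simpl; rring.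
apply injective_projections; simpl; rring.
Qed.

Lemma is_derive_Copp (f : R -> C) x df :
  is_derC f x df -> is_derC (fun t => - f t) x (- df).
Proof. apply (is_derive_opp (V := C_R_NormedModule)). Qed.

Lemma is_derive_RtoC (f : R -> R) x df :
  is_derive f x df -> is_derC (fun t => RtoC (f t)) x (RtoC df).
Proof. intro H; apply is_derive_C; simpl; auto. apply (is_derive_const (V:=R_NormedModule)). Qed.

Lemma is_derive_Cinv (f : R -> C) x df :
  is_derC f x df -> f x <> 0 -> is_derC (fun t => / f t) x (- df / (f x * f x)).
Proof.
intros Hf Hn.
assert (A1 := is_derive_Re _ _ _ Hf). assert (A2 := is_derive_Im _ _ _ Hf).
assert (N : (Re (f x) * Re (f x) + Im (f x) * Im (f x))%R <> 0%R).
{ intro E. apply Hn. destruct (f x) as [a b]; simpl in *. apply injective_projections; simpl;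
    nra. }
assert (D : is_derive (fun t => / (Re (f t) * Re (f t) + Im (f t) * Im (f t)))%R x
  (- (2 * (Re df * Re (f x) + Im df * Im (f x))) / (Re (f x) * Re (f x) + Im (f x) * Im (f x))
    ^ 2)%R).
{ apply (is_derive_inv (fun t => Re (f t) * Re (f t) + Im (f t) * Im (f t))%R x (2 * (Re df * Re
    (f x) + Im df * Im (f x)))%R); auto.
  eapply is_derive_eq. eapply is_derive_ext. 2: apply (is_derive_Rcompose4 _ _ _ _ _ _ _ _ _ A1
    (is_derive_opp _ _ _ A2) A1 A2).
  intro t; rring. rring. }
assert (K := is_derive_Cmult _ _ _ _ _ (is_derive_RtoC _ _ _ D)
  (is_derive_C (fun t => (Re (f t), (- Im (f t))%R)) x (Re df,
    (- Im df)%R) A1 (is_derive_opp _ _ _ A2))).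
eapply is_derive_Ceq. eapply (is_derive_ext (V := C_R_NormedModule)). 2: exact K.
- intro t. unfold Cinv. destruct (f t) as [a b]. apply injective_projections; simpl;
    unfold Rdiv; rewrite ?Rmult_1_r; ring.
- destruct (f x) as [a b] eqn:E, df as [c d]; simpl in *. rewrite E.
  apply injective_projections; simpl; match goal with |- ?a = ?b => change (@eq R a b) end;
    field; repeat split; auto;
    match goal with |- ?u <> 0%R => replace u with ((a * a + b * b) * (a * a + b * b))%R by ring;
      apply Rmult_integral_contrapositive; auto end.
Qed.

Lemma continuous_C {U : UniformSpace} (f : U -> C) x :
  continuous (fun t => Re (f t)) x -> continuous (fun t => Im (f t)) x -> continuous f x.
Proof.
intros H1 H2.
apply (continuous_ext (fun t => (Re (f t), Im (f t)))). intro t; now destruct (f t).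
apply (continuous_comp_2 (fun t => Re (f t)) (fun t => Im (f t)) (fun a b : R => (a, b) : C));
  auto.
apply (continuous_ext (fun t => t)). now intros [a b]. apply continuous_id.
Qed.

Lemma continuous_Re {U : UniformSpace} (f : U -> C) x : continuous f x ->
  continuous (fun t => Re (f t)) x.
Proof. intro H. apply (continuous_comp f Re); auto. apply (continuous_fst (U:=R_UniformSpace)
  (V:=R_UniformSpace)). Qed.

Lemma continuous_Im {U : UniformSpace} (f : U -> C) x : continuous f x ->
  continuous (fun t => Im (f t)) x.
Proof. intro H. apply (continuous_comp f Im); auto. apply (continuous_snd (U:=R_UniformSpace)
  (V:=R_UniformSpace)). Qed.

Lemma continuous_Cplus {U : UniformSpace} (f g : U -> C) x : continuous f x -> continuous g x ->
  continuous (fun t => f t + g t) x.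
Proof. apply (continuous_plus (V := C_R_NormedModule)). Qed.

Lemma continuous_Copp {U : UniformSpace} (f : U -> C) x : continuous f x ->
  continuous (fun t => - f t) x.
Proof. apply (continuous_opp (V := C_R_NormedModule)). Qed.

Lemma continuous_Cminus {U : UniformSpace} (f g : U -> C) x : continuous f x ->
  continuous g x -> continuous (fun t => f t - g t) x.
Proof. apply (continuous_minus (V := C_R_NormedModule)). Qed.

Lemma continuous_Cmult {U : UniformSpace} (f g : U -> C) x : continuous f x -> continuous g x ->
  continuous (fun t => f t * g t) x.
Proof.
intros Hf Hg.
assert (A1 := continuous_Re _ _ Hf). assert (A2 := continuous_Im _ _ Hf).
assert (B1 := continuous_Re _ _ Hg). assert (B2 := continuous_Im _ _ Hg).
apply continuous_C.
- apply (continuous_minus (V := R_NormedModule) (fun t => (Re (f t) * Re (g t))%R) (fun t => (Im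
    (f t) * Im (g t))%R));
  now apply (continuous_mult (K := R_AbsRing)).
- apply (continuous_plus (V := R_NormedModule) (fun t => (Re (f t) * Im (g t))%R) (fun t => (Im
    (f t) * Re (g t))%R));
  now apply (continuous_mult (K := R_AbsRing)).
Qed.

Lemma continuous_Cexp {U : UniformSpace} (f : U -> C) x : continuous f x ->
  continuous (fun t => Cexp (f t)) x.
Proof.
intros Hf.
assert (A1 := continuous_Re _ _ Hf). assert (A2 := continuous_Im _ _ Hf).
apply continuous_C.
- apply (continuous_mult (K := R_AbsRing) (fun t => exp (Re (f t))) (fun t => cos (Im (f t)))).
  apply (continuous_comp _ exp); auto. apply continuous_exp.
  apply (continuous_comp _ cos); auto. apply continuous_cos.
- apply (continuous_mult (K := R_AbsRing) (fun t => exp (Re (f t))) (fun t => sin (Im (f t)))).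
  apply (continuous_comp _ exp); auto. apply continuous_exp.
  apply (continuous_comp _ sin); auto. apply continuous_sin.
Qed.

Lemma continuous_RtoC {U : UniformSpace} (f : U -> R) x : continuous f x ->
  continuous (fun t => RtoC (f t)) x.
Proof. intro H. apply continuous_C; auto. apply continuous_const. Qed.

Lemma continuous_Cinv {U : UniformSpace} (f : U -> C) x : continuous f x -> f x <> 0 ->
  continuous (fun t => / f t) x.
Proof.
intros Hf Hn.
assert (A1 := continuous_Re _ _ Hf). assert (A2 := continuous_Im _ _ Hf).
assert (N : (Re (f x) * Re (f x) + Im (f x) * Im (f x))%R <> 0%R).
{ intro E. apply Hn. destruct (f x) as [a b]; simpl in *. apply injective_projections; simpl;
    nra. }
assert (D : continuous (fun t => / (Re (f t) * Re (f t) + Im (f t) * Im (f t)))%R x).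
{ apply (continuous_comp (fun t => (Re (f t) * Re (f t) + Im (f t) * Im (f t))%R) Rinv).
  apply (continuous_plus (V := R_NormedModule) (fun t => (Re (f t) * Re (f t))%R) (fun t => (Im
    (f t) * Im (f t))%R));
  now apply (continuous_mult (K := R_AbsRing)).
  now apply continuous_Rinv. }
apply continuous_C.
- apply (continuous_ext (fun t => (Re (f t) * / (Re (f t) * Re (f t) + Im (f t) * Im (f t)))%R)).
  intro t; unfold Cinv; simpl. unfold Rdiv. f_equal. f_equal. unfold Re, Im; ring.
  now apply (continuous_mult (K := R_AbsRing)).
- apply (continuous_ext (fun t => (- Im (f t) * / (Re (f t) * Re (f t) + Im (f t) * Im (f
    t)))%R)).
  intro t; unfold Cinv; simpl. unfold Rdiv. f_equal. f_equal. unfold Re, Im; ring.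
  apply (continuous_mult (K := R_AbsRing)); auto. now apply (continuous_opp (V :=
    R_NormedModule)).
Qed.

Lemma continuous_Cpow {U : UniformSpace} (f : U -> C) n x : continuous f x ->
  continuous (fun t => (f t) ^ n) x.
Proof.
intro H; induction n as [|n IH]; simpl. apply continuous_const. now apply continuous_Cmult.
Qed.

Lemma is_derC_continuous (f : R -> C) x l : is_derC f x l -> continuous f x.
Proof. intro H. apply (ex_derive_continuous (V := C_R_NormedModule)). now exists l. Qed.

(** * The complex exponential *)

Lemma Cexp_plus a b : Cexp (a + b) = Cexp a * Cexp b.
Proof.
unfold Cexp; destruct a as [a1 a2], b as [b1 b2]; simpl.
rewrite exp_plus, cos_plus, sin_plus. unfold Cmult; simpl. f_equal; ring.
Qed.

Lemma Cexp_0 : Cexp 0 = 1.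
Proof. unfold Cexp; simpl. rewrite exp_0, cos_0, sin_0. unfold RtoC; f_equal; ring. Qed.

Lemma Cmod_Cexp z : Cmod (Cexp z) = exp (Re z).
Proof.
unfold Cmod, Cexp; simpl.
replace (_ + _)%R with (exp (Re z) * exp (Re z) * ((sin (Im z))² + (cos (Im z))²))%R by
  (unfold Rsqr; ring).
rewrite sin2_cos2, Rmult_1_r. apply sqrt_square. left; apply exp_pos.
Qed.

Lemma Cexp_neq_0 z : Cexp z <> 0.
Proof. apply Cmod_gt_0. rewrite Cmod_Cexp. apply exp_pos. Qed.

Lemma Cexp_opp z : Cexp (- z) = / Cexp z.
Proof.
assert (H := Cexp_neq_0 z).
assert (K : Cexp z * Cexp (-z) = 1). rewrite <- Cexp_plus, <- Cexp_0. f_equal; ring.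
replace (Cexp (-z)) with (/ Cexp z * (Cexp z * Cexp (-z))) by (field; auto). rewrite K. ring.
Qed.

Lemma Cexp_pow z n : Cexp z ^ n = Cexp (INR n * z).
Proof.
induction n as [|n IH]. simpl. rewrite <- Cexp_0 at 1. f_equal; ring.
rewrite S_INR, RtoC_plus. simpl Cpow. rewrite IH, <- Cexp_plus. f_equal; ring.
Qed.

Lemma im_le_Cmod (c : C) : (Rabs (Im c) <= Cmod c)%R.
Proof. apply Rle_trans with (2 := Rmax_Cmod c). apply Rmax_r. Qed.

Lemma Cmod_le_Re_Im (c : C) : (Cmod c <= Rabs (Re c) + Rabs (Im c))%R.
Proof.
destruct c as [a b]. replace ((a, b) : C) with (RtoC a + Ci * RtoC b) by
  (apply injective_projections; simpl; ring).
eapply Rle_trans. apply Cmod_triangle. rewrite Cmod_mult, Cmod_Ci, !Cmod_R. simpl.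
replace (a + (0 * b - 1 * 0))%R with a by ring. replace (0 + (0 * 0 + 1 * b))%R with b by ring.
  lra.
Qed.

Local Open Scope R_scope.

Lemma exp_rem1 a : Rabs (exp a - 1) <= Rabs a * exp (Rabs a).
Proof.
assert (H := exp_ineq1_le a). assert (H' := exp_ineq1_le (-a)).
assert (E : exp a * exp (-a) = 1) by (rewrite <- exp_plus, Rplus_opp_r; apply exp_0).
assert (P := exp_pos a).
destruct (Rle_dec 0 a).
- rewrite (Rabs_pos_eq a) by auto. rewrite Rabs_pos_eq by lra. nra.
- rewrite (Rabs_left a) by lra. rewrite Rabs_left1. assert (Q:= exp_ineq1_le (-a)). nra.
  assert (exp a <= exp 0). apply Rlt_le, exp_increasing; lra. rewrite exp_0 in *; lra.
Qed.

Lemma exp_rem2 a : Rabs (exp a - 1 - a) <= a * a * exp (Rabs a).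
Proof.
assert (H := exp_ineq1_le a). assert (H' := exp_ineq1_le (-a)).
rewrite Rabs_pos_eq by lra.
assert (K := exp_rem1 a).
assert (E : exp a * exp (-a) = 1) by (rewrite <- exp_plus, Rplus_opp_r; apply exp_0).
assert (P := exp_pos a).
destruct (Rle_dec 0 a).
- rewrite (Rabs_pos_eq a) by auto.
  assert (X : exp a - 1 <= a * exp a) by nra.
  assert (Y : a * (exp a - 1) <= a * (a * exp a)) by now apply Rmult_le_compat_l. lra.
- rewrite (Rabs_left a) by lra.
  assert (X : exp a <= 1 + a * exp a) by nra.
  assert (Y : a * exp a <= a * (1 + a)) by nra.
  assert (Z : a * a * 1 <= a * a * exp (- a)) by (apply Rmult_le_compat_l; nra). lra.
Qed.

Lemma sin_rem1 b : Rabs (sin b) <= Rabs b.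
Proof.
destruct (Rtotal_order b 0) as [H|[->|H]].
- rewrite <- (Ropp_involutive b), sin_neg, !Rabs_Ropp. assert (sin (-b) < -b) by
    (apply sin_lt_x; lra).
  rewrite (Rabs_left b) by lra. apply Rabs_le. split; [|lra].
  destruct (Rle_dec (-b) PI). assert (0 <= sin (-b)) by (apply sin_ge_0; lra). lra.
  assert (A := SIN_bound (-b)). assert (B := PI2_3_2). lra.
- rewrite sin_0; lra.
- assert (sin b < b) by (apply sin_lt_x; lra).
  rewrite (Rabs_pos_eq b) by lra. apply Rabs_le. split; [|lra].
  destruct (Rle_dec b PI). assert (0 <= sin b) by (apply sin_ge_0; lra). lra.
  assert (A := SIN_bound b). assert (B := PI2_3_2). lra.
Qed.

Lemma cos_rem2 b : 0 <= 1 - cos b <= b * b.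
Proof.
split. assert (H := COS_bound b); lra.
replace b with (2 * (b/2)) at 1 by field. rewrite cos_2a_sin.
assert (H := sin_rem1 (b/2)). assert (K : sin (b/2) * sin (b/2) <= (b/2)*(b/2)).
{ rewrite <- (Rabs_pos_eq (sin _ * _)) by apply Rle_0_sqr. rewrite <- (Rabs_pos_eq (b/2 * _)) by
    apply Rle_0_sqr.
  rewrite !Rabs_mult. apply Rmult_le_compat; auto using Rabs_pos. }
nra.
Qed.

Lemma sin_rem2 b : Rabs (sin b - b) <= 2 * (b * b).
Proof.
destruct (MVT_gen (fun t => sin t - t) 0 b (fun t => cos t - 1)) as [c [Hc E]].
- intros t _. auto_derive; auto. ring.
- intros t _. apply continuity_pt_minus. apply continuity_pt_filterlim, continuous_sin.
    apply continuity_pt_id.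
- rewrite sin_0 in E. replace (sin b - b) with ((cos c - 1) * b) by lra.
  rewrite Rabs_mult. assert (A := cos_rem2 c). assert (COS := COS_bound c).
  rewrite Rabs_minus_sym, Rabs_pos_eq by lra.
  assert (P := Rabs_pos b).
  assert (Q : Rabs b * Rabs b = b * b). { rewrite <- Rabs_mult. apply Rabs_pos_eq, Rle_0_sqr. }
  assert (c * c <= b * b).
  { assert (Rabs c <= Rabs b). { unfold Rmin, Rmax in Hc; destruct (Rle_dec 0 b); unfold Rabs;
      repeat destruct Rcase_abs; lra. }
    rewrite <- Q, <- (Rabs_pos_eq (c*c)) by apply Rle_0_sqr. rewrite Rabs_mult.
      apply Rmult_le_compat; auto using Rabs_pos. }
  destruct (Rle_dec (Rabs b) 1); nra.
Qed.

(** This one estimate gives the termwise differentiability of all the Gaussian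
    sums below: the bound depends on [z] through its modulus only, and it is
    quadratic. *)
Lemma Cexp_rem2 (z : C) : Cmod (Cexp z - 1 - z) <= 5 * (Cmod z * Cmod z * exp (Cmod z)).
Proof.
destruct z as [a b].
assert (Ha := re_le_Cmod (a, b)). assert (Hb := im_le_Cmod (a, b)). simpl in Ha, Hb.
assert (P := Cmod_ge_0 (a, b)). set (r := Cmod (a, b)) in *. clearbody r.
eapply Rle_trans. apply Cmod_le_Re_Im. simpl.
assert (E1 := exp_rem1 a). assert (E2 := exp_rem2 a).
assert (E3 := cos_rem2 b). assert (E4 := sin_rem1 b). assert (E5 := sin_rem2 b).
assert (Xa : exp (Rabs a) <= exp r). { destruct Ha as [Ha| ->]; [left;
  now apply exp_increasing|right; congruence]. }
assert (Xb : exp a <= exp r). { apply Rle_trans with (2 := Xa). destruct (Rle_abs a) as [H| <-];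
  [left; now apply exp_increasing|right; congruence]. }
assert (A2 : Rabs a * Rabs a = a * a). { rewrite <- Rabs_mult. apply Rabs_pos_eq, Rle_0_sqr. }
assert (B2 : Rabs b * Rabs b = b * b). { rewrite <- Rabs_mult. apply Rabs_pos_eq, Rle_0_sqr. }
assert (Pa := Rabs_pos a). assert (Pb := Rabs_pos b). assert (R1 : 1 <= exp r) by
  (assert (H := exp_ineq1_le r); lra).
assert (Xp := exp_pos a). assert (aa : a * a <= r * r) by nra. assert (bb : b * b <= r * r) by
  nra.
assert (Rr : r * r <= r * r * exp r) by nra.
replace (exp a * cos b + -(1) + - a) with ((exp a - 1 - a) - exp a * (1 - cos b)) by ring.
replace (exp a * sin b + - 0 + - b) with ((exp a - 1) * sin b + (sin b - b)) by ring.
assert (Rabs ((exp a - 1 - a) - exp a * (1 - cos b)) <= 2 * (r * r * exp r)).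
{ eapply Rle_trans. apply Rabs_triang. rewrite Rabs_Ropp, Rabs_mult, (Rabs_pos_eq (exp a)),
    (Rabs_pos_eq (1 - _)) by lra.
  assert (a * a * exp (Rabs a) <= r * r * exp r) by (apply Rmult_le_compat; try nra; left;
    apply exp_pos).
  assert (exp a * (1 - cos b) <= exp r * (r * r)) by (apply Rmult_le_compat; nra). lra. }
assert (Rabs ((exp a - 1) * sin b + (sin b - b)) <= 3 * (r * r * exp r)).
{ eapply Rle_trans. apply Rabs_triang. rewrite Rabs_mult.
  assert (Rabs (exp a - 1) * Rabs (sin b) <= (r * exp r) * r).
  { apply Rmult_le_compat; try apply Rabs_pos; try lra. apply Rle_trans with (1 := E1).
      apply Rmult_le_compat; lra || (left; apply exp_pos). }
  lra. }
lra.
Qed.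

(** * Absolutely convergent series over the integers *)

Definition abs_summable (a : nat -> C) : Prop := ex_series (fun n => Cmod (a n)).

Lemma ex_series_le_pos (a b : nat -> R) :
  (forall n, 0 <= a n <= b n) -> ex_series b -> ex_series a.
Proof.
intros H. apply (ex_series_le (V := R_CompleteNormedModule)). intro n.
change (Rabs (a n) <= b n). rewrite Rabs_pos_eq; apply H.
Qed.

Lemma abs_summable_le (a : nat -> C) (M : nat -> R) :
  (forall n, Cmod (a n) <= M n) -> ex_series M -> abs_summable a.
Proof.
intros H E. apply (ex_series_le (V := R_CompleteNormedModule) _ M); auto.
intro n. simpl. unfold norm; simpl; unfold abs; simpl. rewrite Rabs_pos_eq; auto. apply Cmod_ge_0.
Qed.

Lemma ex_series_Re (a : nat -> C) : abs_summable a -> ex_series (fun n => Re (a n)).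
Proof.
intro H. apply (ex_series_le (V := R_CompleteNormedModule) _ _ (fun n => re_le_Cmod (a n)) H).
Qed.

Lemma ex_series_Im (a : nat -> C) : abs_summable a -> ex_series (fun n => Im (a n)).
Proof.
intro H. apply (ex_series_le (V := R_CompleteNormedModule) _ _ (fun n => im_le_Cmod (a n)) H).
Qed.

Lemma CSeries_ext (a b : nat -> C) : (forall n, a n = b n) -> CSeries a = CSeries b.
Proof. intro H. unfold CSeries. f_equal; apply Series_ext; intro n; now rewrite H. Qed.

Lemma CSeries_plus (a b : nat -> C) : abs_summable a -> abs_summable b ->
  CSeries (fun n => a n + b n)%C = (CSeries a + CSeries b)%C.
Proof.
intros Ha Hb. unfold CSeries, Cplus; simpl. f_equal.
- apply (Series_plus (fun n => Re (a n)) (fun n => Re (b n))); now apply ex_series_Re.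
- apply (Series_plus (fun n => Im (a n)) (fun n => Im (b n))); now apply ex_series_Im.
Qed.

Lemma ex_series_Rscal (c : R) (f : nat -> R) : ex_series f -> ex_series (fun n => c * f n).
Proof. apply (ex_series_scal (V := R_NormedModule) c f). Qed.

Lemma CSeries_scal (c : C) (a : nat -> C) : abs_summable a ->
  CSeries (fun n => c * a n)%C = (c * CSeries a)%C.
Proof.
intros Ha. assert (H1 := ex_series_Re _ Ha). assert (H2 := ex_series_Im _ Ha).
unfold CSeries, Cmult; simpl. f_equal.
- rewrite <- !Series_scal_l, <- Series_minus. reflexivity.
  now apply ex_series_Rscal. now apply ex_series_Rscal.
- rewrite <- !Series_scal_l, <- Series_plus. reflexivity.
  now apply ex_series_Rscal. now apply ex_series_Rscal.
Qed.

Lemma CSeries_bound (a : nat -> C) (M : nat -> R) :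
  (forall n, Cmod (a n) <= M n) -> ex_series M -> Cmod (CSeries a) <= 2 * Series M.
Proof.
intros H E. eapply Rle_trans. apply Cmod_le_Re_Im. simpl.
assert (K : forall f : nat -> R, (forall n, Rabs (f n) <= M n) -> Rabs (Series f) <= Series M).
{ intros f Hf. eapply Rle_trans. apply Series_Rabs.
  apply (ex_series_le (V := R_CompleteNormedModule) _ M); auto. intro n. simpl. unfold norm;
    simpl; unfold abs; simpl. now rewrite Rabs_Rabsolu.
  apply Series_le; auto. intro n; split; auto. apply Rabs_pos. }
assert (K1 := K (fun n => Re (a n)) (fun n => Rle_trans _ _ _ (re_le_Cmod _) (H n))).
assert (K2 := K (fun n => Im (a n)) (fun n => Rle_trans _ _ _ (im_le_Cmod _) (H n))).
lra.
Qed.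

Lemma CSeries_incr_1 (a : nat -> C) : abs_summable a ->
  CSeries a = (a 0%nat + CSeries (fun n => a (S n)))%C.
Proof.
intro H. unfold CSeries, Cplus; simpl. f_equal.
apply Series_incr_1. now apply ex_series_Re. apply Series_incr_1. now apply ex_series_Im.
Qed.

Definition summableZ (M : Z -> R) : Prop :=
  ex_series (fun n => M (Z.of_nat n)) /\ ex_series (fun n => M (- Z.of_nat (S n))%Z).

Definition abs_summableZ (a : Z -> C) : Prop := summableZ (fun n => Cmod (a n)).

Definition SeriesZ (M : Z -> R) : R :=
  Series (fun n => M (Z.of_nat n)) + Series (fun n => M (- Z.of_nat (S n))%Z).

Lemma abs_summableZ_le (a : Z -> C) M : (forall n, Cmod (a n) <= M n) -> summableZ M ->
  abs_summableZ a.
Proof.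
intros H [E1 E2]; split.
apply (abs_summable_le (fun n => a (Z.of_nat n)) _ (fun n => H _) E1).
apply (abs_summable_le (fun n => a (- Z.of_nat (S n))%Z) _ (fun n => H _) E2).
Qed.

Lemma CSeriesZ_ext (a b : Z -> C) : (forall n, a n = b n) -> CSeriesZ a = CSeriesZ b.
Proof. intro H. unfold CSeriesZ. f_equal; apply CSeries_ext; intro; apply H. Qed.

Lemma CSeriesZ_plus (a b : Z -> C) : abs_summableZ a -> abs_summableZ b ->
  CSeriesZ (fun n => a n + b n)%C = (CSeriesZ a + CSeriesZ b)%C.
Proof.
intros [A1 A2] [B1 B2]. unfold CSeriesZ.
rewrite (CSeries_plus (fun n => a (Z.of_nat n)) (fun n => b (Z.of_nat n))) by assumption.
rewrite (CSeries_plus (fun n => a (-Z.of_nat (S n))%Z) (fun n => b (-Z.of_nat (S n))%Z)) by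
  assumption.
ring.
Qed.

Lemma CSeriesZ_scal (c : C) (a : Z -> C) : abs_summableZ a ->
  CSeriesZ (fun n => c * a n)%C = (c * CSeriesZ a)%C.
Proof.
intros [A1 A2]. unfold CSeriesZ.
rewrite (CSeries_scal c (fun n => a (Z.of_nat n))) by assumption.
rewrite (CSeries_scal c (fun n => a (-Z.of_nat (S n))%Z)) by assumption.
ring.
Qed.

Lemma abs_summableZ_scal c (u : Z -> C) : abs_summableZ u -> abs_summableZ (fun n => c * u n)%C.
Proof.
intros [A1 A2]. apply (abs_summableZ_le _ (fun n => Cmod c * Cmod (u n))).
intro n; rewrite Cmod_mult; lra. split; now apply (ex_series_Rscal (Cmod c)).
Qed.

Lemma abs_summableZ_plus (u v : Z -> C) : abs_summableZ u -> abs_summableZ v ->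
  abs_summableZ (fun n => u n + v n)%C.
Proof.
intros [U1 U2] [V1 V2]. apply (abs_summableZ_le _ (fun n => Cmod (u n) + Cmod (v n))).
intro n; apply Cmod_triangle. split; [apply (ex_series_plus (V := R_NormedModule) _ _ U1 V1) |
  apply (ex_series_plus (V := R_NormedModule) _ _ U2 V2)].
Qed.

Lemma CSeriesZ_bound (a : Z -> C) M : (forall n, Cmod (a n) <= M n) -> summableZ M ->
  Cmod (CSeriesZ a) <= 2 * SeriesZ M.
Proof.
intros H [E1 E2]. unfold CSeriesZ, SeriesZ. eapply Rle_trans. apply Cmod_triangle.
rewrite Rmult_plus_distr_l. apply Rplus_le_compat; now apply CSeries_bound.
Qed.

Lemma CSeriesZ_shift (a : Z -> C) : abs_summableZ a -> CSeriesZ (fun n => a (n + 1)%Z) =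
  CSeriesZ a.
Proof.
intros [A1 A2]. unfold CSeriesZ.
rewrite (CSeries_incr_1 (fun n => a (Z.of_nat n))) by assumption.
rewrite (CSeries_incr_1 (fun n => a (- Z.of_nat (S n) + 1)%Z)).
2:{ red. apply ex_series_incr_1. eapply ex_series_ext. 2: exact A2. intro n. cbv beta.
  replace (- Z.of_nat (S (S n)) + 1)%Z with (- Z.of_nat (S n))%Z by lia. reflexivity. }
rewrite (CSeries_ext (fun n => a (Z.of_nat n + 1)%Z) (fun n => a (Z.of_nat (S n)))).
2:{ intro n. f_equal. lia. }
rewrite (CSeries_ext (fun n => a (- Z.of_nat (S (S n)) + 1)%Z) (fun n => a (- Z.of_nat (S n))%Z)).
2:{ intro n. f_equal. lia. }
change (a (- Z.of_nat 1 + 1)%Z) with (a (Z.of_nat 0)). ring.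
Qed.

Lemma SeriesZ_pos M : (forall n, 0 <= M n) -> summableZ M -> 0 <= SeriesZ M.
Proof.
intros H [E1 E2]. unfold SeriesZ.
assert (K : forall f : nat -> R, (forall n, 0 <= f n) -> ex_series f -> 0 <= Series f).
{ intros f Hf Ef. rewrite <- (Rmult_0_l (Series f)), <- Series_scal_l. apply Series_le; auto.
    intro n; rewrite Rmult_0_l; split; auto; lra. }
apply Rplus_le_le_0_compat; apply K; auto.
Qed.

(** By induction, splitting [exp x] as the square of [exp (x / 2)]. *)
Lemma pow_le_exp k : exists K, 0 < K /\ forall x, 0 <= x -> x ^ k <= K * exp x.
Proof.
induction k as [|k [K [HK IH]]].
- exists 1. split; [lra|]. intros x Hx. simpl. assert (H := exp_ineq1_le x). lra.
- exists (2 ^ (S k) * K). split. apply Rmult_lt_0_compat; auto. apply pow_lt; lra.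
  intros x Hx. replace x with (2 * (x / 2)) at 1 by field. rewrite Rpow_mult_distr.
  rewrite Rmult_assoc. apply Rmult_le_compat_l. apply pow_le; lra.
  replace (exp x) with (exp (x/2) * exp (x/2)) by (rewrite <- exp_plus; f_equal; field).
  simpl. assert (A := IH (x/2) ltac:(lra)). assert (B := exp_ineq1_le (x/2)).
  rewrite <- Rmult_assoc, (Rmult_comm (x / 2)).
  apply Rmult_le_compat; try lra. apply pow_le; lra.
Qed.

Lemma exp_INR_pow n x : exp (INR n * x) = exp x ^ n.
Proof.
induction n as [|n IH]. simpl. rewrite Rmult_0_l; apply exp_0.
rewrite S_INR, Rmult_plus_distr_r, exp_plus, IH, Rmult_1_l. simpl; ring.
Qed.

(** Terms of Gaussian sums, and of their derivatives in the parameters, are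
    bounded by such majorants. *)
Definition gauss_maj (k : nat) (d b : R) (n : Z) : R := Rabs (IZR n) ^ k * exp (- d * IZR n ^ 2
  + b * Rabs (IZR n)).

(** Completing the square absorbs the linear term of the exponent and leaves a
    geometric series. *)
Lemma gauss_maj_summable k d b : 0 < d -> 0 <= b -> summableZ (gauss_maj k d b).
Proof.
intros Hd Hb. destruct (pow_le_exp k) as [K [HK HP]].
assert (E : ex_series (fun n => K * exp ((b + 2)^2 / (4 * d)) * (exp (-1)) ^ n)).
{ apply ex_series_Rscal, ex_series_geom.
  rewrite Rabs_pos_eq by (left; apply exp_pos). rewrite <- exp_0. apply exp_increasing. lra. }
assert (M : forall n : nat, forall m : Z, INR n <= Rabs (IZR m) ->
  0 <= gauss_maj k d b m <= K * exp ((b + 2)^2 / (4 * d)) * (exp (-1)) ^ n).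
{ intros n m Hm. unfold gauss_maj. set (x := Rabs (IZR m)) in *.
  assert (Hx : 0 <= x) by apply Rabs_pos.
  replace (IZR m ^ 2) with (x ^ 2) by (unfold x; rewrite RPow_abs, Rabs_pos_eq; auto;
    apply pow2_ge_0).
  split. apply Rmult_le_pos. now apply pow_le. left; apply exp_pos.
  replace (exp (-1) ^ n) with (exp (-1 * INR n)) by (rewrite Rmult_comm, exp_INR_pow;
    reflexivity).
  apply Rle_trans with (K * exp x * exp (- d * x ^ 2 + b * x)).
  apply Rmult_le_compat_r; auto. left; apply exp_pos.
  rewrite !Rmult_assoc. apply Rmult_le_compat_l. lra. rewrite <- !exp_plus.
  assert (Q : x + (- d * x ^ 2 + b * x) <= (b + 2) ^ 2 / (4 * d) + -1 * INR n).
  { assert (R : 0 <= (b + 2) ^ 2 / (4 * d) - ((b + 2) * x - d * x ^ 2)).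
    { replace ((b + 2) ^ 2 / (4 * d) - ((b + 2) * x - d * x ^ 2))
        with (((b + 2) - 2 * d * x) ^ 2 / (4 * d)) by (field; lra).
      apply Rmult_le_pos. apply pow2_ge_0. left; apply Rinv_0_lt_compat; lra. }
    lra. }
  replace (INR n * -1) with (-1 * INR n) by ring.
  destruct Q as [Q|Q]; [left; now apply exp_increasing| rewrite Q; lra]. }
split; apply ex_series_le_pos with (2 := E); intro n; apply M.
- rewrite <- INR_IZR_INZ. apply Rle_abs.
- rewrite opp_IZR, Rabs_Ropp, <- INR_IZR_INZ, S_INR.
  rewrite Rabs_pos_eq; assert (P := pos_INR n); lra.
Qed.

(** * Gaussian sums over the integers *)

(** The factor [n ^ k] is there because differentiation in [al] or [be] raises
    [k] by 2 or 1; the theta constants come from [k = 0]. *)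
Definition theta_term (k : nat) (al be : C) (n : Z) : C :=
  (RtoC (IZR n ^ k) * Cexp (al * RtoC (IZR n ^ 2) + be * RtoC (IZR n)))%C.

Definition theta_sum (k : nat) (al be : C) : C := CSeriesZ (theta_term k al be).

Lemma exp_le a b : a <= b -> exp a <= exp b.
Proof. intros [H| ->]; [left; now apply exp_increasing | right; reflexivity]. Qed.

Lemma theta_term_le k al be n : Cmod (theta_term k al be n) <= gauss_maj k (- Re al) (Cmod be) n.
Proof.
unfold theta_term, gauss_maj. rewrite Cmod_mult, Cmod_R, Cmod_Cexp, <- RPow_abs.
apply Rmult_le_compat_l. apply pow_le, Rabs_pos.
apply exp_le.
assert (E : Re (al * RtoC (IZR n ^ 2) + be * RtoC (IZR n))%C = Re al * IZR n ^ 2 + Re be * IZR n).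
{ unfold Re, RtoC; simpl. ring. }
rewrite E, Ropp_involutive. apply Rplus_le_compat_l.
eapply Rle_trans. apply Rle_abs. rewrite Rabs_mult. apply Rmult_le_compat_r. apply Rabs_pos.
  apply re_le_Cmod.
Qed.

Lemma theta_term_summable k al be : Re al < 0 -> abs_summableZ (theta_term k al be).
Proof.
intro H. eapply abs_summableZ_le. apply theta_term_le. apply gauss_maj_summable. lra.
  apply Cmod_ge_0.
Qed.

Lemma IZR_abs_le_sqr n : Rabs (IZR n) <= IZR n ^ 2.
Proof. rewrite <- abs_IZR, pow_IZR. apply IZR_le. simpl. nia. Qed.

(** Termwise this is the remainder of the exponential at [w = a n^2 + b n]. As
    [n] is an integer, [|n| <= n^2] and so [|w| <= (|a| + |b|) n^2]: half of
    the decay rate [- Re al] pays for the factor [exp |w|]. *)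
Lemma theta_sum_remainder k al be : Re al < 0 -> exists K, 0 <= K /\ forall a b : C,
  Cmod a + Cmod b <= - Re al / 2 ->
  Cmod (theta_sum k (al + a) (be + b) - theta_sum k al be - (a * theta_sum (k + 2) al be + b *
    theta_sum (k + 1) al be)) <= K * (Cmod a + Cmod b) ^ 2.
Proof.
intro H. set (d := - Re al / 2). assert (Hd : 0 < d) by (unfold d; lra).
set (M := gauss_maj (k + 4) d (Cmod be)).
assert (SM : summableZ M) by (apply gauss_maj_summable; auto; apply Cmod_ge_0).
assert (PM : forall n, 0 <= M n). { intro n. apply Rmult_le_pos. apply pow_le, Rabs_pos. left;
  apply exp_pos. }
exists (2 * 5 * SeriesZ M). split. { assert (0 <= SeriesZ M) by now apply SeriesZ_pos. lra. }
intros a b Hab. set (s := Cmod a + Cmod b) in *.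
assert (Pa := Cmod_ge_0 a). assert (Pb := Cmod_ge_0 b).
assert (Hs : 0 <= s) by (unfold s; lra).
assert (Sa : Re (al + a)%C < 0).
{ assert (R := re_le_Cmod a). assert (R' := Rle_abs (Re a)). change (Re al + Re a < 0).
    unfold s, d in *; lra. }
set (r := fun n => (theta_term k (al + a) (be + b) n + ((- (1))
  * theta_term k al be n + ((- a) * theta_term (k + 2) al be n + (- b) * theta_term (k + 1) al
  be n)))%C).
assert (E : (theta_sum k (al + a) (be + b) - theta_sum k al be - (a * theta_sum (k + 2) al be +
  b * theta_sum (k + 1) al be))%C = CSeriesZ r).
{ unfold r. rewrite !CSeriesZ_plus by auto using theta_term_summable, abs_summableZ_scal,
    abs_summableZ_plus.
  rewrite !CSeriesZ_scal by auto using theta_term_summable. unfold theta_sum.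
  repeat match goal with |- context [CSeriesZ (fun n => theta_term ?k ?x ?y n)] =>
    change (CSeriesZ (fun n => theta_term k x y n)) with (CSeriesZ (theta_term k x y)) end.
  ring. }
rewrite E.
assert (B : forall n, Cmod (r n) <= 5 * s ^ 2 * M n).
{ intro n. set (w := (a * RtoC (IZR n ^ 2) + b * RtoC (IZR n))%C).
  replace (r n) with (theta_term k al be n * (Cexp w - 1 - w))%C.
  2:{ unfold r, theta_term.
      replace ((al + a) * RtoC (IZR n ^ 2) + (be + b) * RtoC (IZR n))%C with ((al * RtoC (IZR n
        ^ 2) + be * RtoC (IZR n)) + w)%C by (unfold w; ring).
      rewrite (Cexp_plus _ w), !pow_add, !RtoC_mult. generalize (Cexp w). unfold w.
        rewrite pow_1. intro e. ring. }
  assert (Hw : Cmod w <= s * IZR n ^ 2).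
  { unfold w. eapply Rle_trans. apply Cmod_triangle. rewrite !Cmod_mult, !Cmod_R.
    rewrite (Rabs_pos_eq (_ ^ 2)) by apply pow2_ge_0. assert (N := IZR_abs_le_sqr n). unfold s.
      nra. }
  rewrite Cmod_mult.
  assert (R := Cexp_rem2 w). assert (Pw := Cmod_ge_0 w).
  assert (P2 : 0 <= IZR n ^ 2) by apply pow2_ge_0.
  assert (X : Cmod w * Cmod w * exp (Cmod w) <= (s * IZR n ^ 2) * (s * IZR n ^ 2) * exp (d * IZR
    n ^ 2)).
  { apply Rmult_le_compat; try nra. left; apply exp_pos. apply exp_le.
      apply Rle_trans with (1 := Hw).
    apply Rmult_le_compat_r; auto. }
  apply Rle_trans with (gauss_maj k (- Re al) (Cmod be) n * (5 * ((s * IZR n ^ 2) * (s * IZR n ^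
    2) * exp (d * IZR n ^ 2)))).
  apply Rmult_le_compat; try apply Cmod_ge_0. apply theta_term_le. lra.
  right. unfold M, gauss_maj. rewrite pow_add.
  replace (Rabs (IZR n) ^ 4) with ((IZR n ^ 2) * (IZR n ^ 2)).
  2:{ replace (Rabs (IZR n) ^ 4) with ((Rabs (IZR n) ^ 2) * (Rabs (IZR n) ^ 2)) by ring.
    rewrite RPow_abs, Rabs_pos_eq; auto. }
  replace (- d * IZR n ^ 2 + Cmod be * Rabs (IZR n)) with ((- - Re al * IZR n ^ 2 + Cmod be *
    Rabs (IZR n)) + d * IZR n ^ 2) by (unfold d; field).
  rewrite (exp_plus _ (d * IZR n ^ 2)). ring. }
replace (2 * 5 * SeriesZ M * s ^ 2) with (2 * SeriesZ (fun n => 5 * s ^ 2 * M n)).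
2:{ unfold SeriesZ. rewrite !Series_scal_l. ring. }
apply CSeriesZ_bound; auto. destruct SM. split; now apply (ex_series_Rscal (5 * s ^ 2)).
Qed.

Definition CxC := prod_NormedModule R_AbsRing C_R_NormedModule C_R_NormedModule.

Lemma Cmod_fst_norm (h : CxC) : Cmod (fst h) <= norm h.
Proof.
rewrite <- Cmod_norm_R. unfold norm at 2; simpl. unfold prod_norm.
apply Rle_trans with (sqrt (norm (fst h : C_R_NormedModule) ^ 2)).
rewrite sqrt_pow2. apply Rle_refl. apply norm_ge_0. apply sqrt_le_1_alt.
assert (H := pow2_ge_0 (norm (snd h : C_R_NormedModule))). lra.
Qed.

Lemma Cmod_snd_norm (h : CxC) : Cmod (snd h) <= norm h.
Proof.
rewrite <- Cmod_norm_R. unfold norm at 2; simpl. unfold prod_norm.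
apply Rle_trans with (sqrt (norm (snd h : C_R_NormedModule) ^ 2)).
rewrite sqrt_pow2. apply Rle_refl. apply norm_ge_0. apply sqrt_le_1_alt.
assert (H := pow2_ge_0 (norm (fst h : C_R_NormedModule))). lra.
Qed.

Lemma is_linear_CxC (p q : C) : is_linear (K := R_AbsRing) (U := CxC) (V := C_R_NormedModule)
  (fun h : CxC => (fst h * p + snd h * q)%C).
Proof.
split.
- intros [x1 x2] [y1 y2]. apply injective_projections; simpl; rring.
- intros k [x1 x2]. apply injective_projections; simpl; rring.
- exists (Cmod p + Cmod q + 1). split. assert (H := Cmod_ge_0 p). assert (H' := Cmod_ge_0 q). lra.
  intro h. rewrite Cmod_norm_R. eapply Rle_trans. apply Cmod_triangle. rewrite !Cmod_mult.
  assert (H := Cmod_ge_0 p). assert (H' := Cmod_ge_0 q). assert (A1 := Cmod_fst_norm h).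
    assert (A2 := Cmod_snd_norm h).
  assert (N := norm_ge_0 h). assert (X1 := Cmod_ge_0 (fst h)). assert (X2 := Cmod_ge_0 (snd h)).
  assert (Cmod (fst h) * Cmod p <= norm h * Cmod p) by now apply Rmult_le_compat_r.
  assert (Cmod (snd h) * Cmod q <= norm h * Cmod q) by now apply Rmult_le_compat_r.
  lra.
Qed.

Lemma filterdiff_theta_sum k (al be : C) : Re al < 0 ->
  filterdiff (K := R_AbsRing) (U := CxC) (V := C_R_NormedModule) (fun p : CxC => theta_sum k
    (fst p) (snd p)) (locally ((al, be) : CxC))
    (fun h : CxC => (fst h * theta_sum (k + 2) al be + snd h * theta_sum (k + 1) al be)%C).
Proof.
intro H. split. apply is_linear_CxC.
intros x Hx. apply (is_filter_lim_locally_unique (K := R_AbsRing) (V := CxC)) in Hx. subst x.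
destruct (theta_sum_remainder k al be H) as [K [PK HK]].
intro eps.
assert (Pd : 0 < Rmin (- Re al / 4) (eps / (4 * (K + 1)))).
{ apply Rmin_glb_lt. lra. apply Rdiv_lt_0_compat. apply cond_pos. lra. }
set (d := mkposreal _ Pd).
apply (locally_le_locally_norm (K := R_AbsRing) (V := CxC)).
exists d. intros [x y] Hxy. unfold ball_norm in Hxy.
set (h := minus ((x, y) : CxC) ((al, be) : CxC)) in *.
rewrite Cmod_norm_R.
assert (A1 := Cmod_fst_norm h). assert (A2 := Cmod_snd_norm h).
assert (Ex : x = (al + fst h)%C). { unfold h. apply injective_projections; unfold minus; simpl;
  rring. }
assert (Ey : y = (be + snd h)%C). { unfold h. apply injective_projections; unfold minus; simpl;
  rring. }
clearbody h. simpl fst at 1. simpl snd at 1. rewrite Ex, Ey.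
assert (D1 : norm h < - Re al / 4) by (eapply Rlt_le_trans; [exact Hxy|apply Rmin_l]).
assert (D2 : norm h < eps / (4 * (K + 1))) by (eapply Rlt_le_trans; [exact Hxy|apply Rmin_r]).
assert (N := norm_ge_0 h).
eapply Rle_trans. apply (HK (fst h) (snd h)). lra.
assert (P1 := Cmod_ge_0 (fst h)). assert (P2 := Cmod_ge_0 (snd h)).
apply Rle_trans with (K * (4 * norm h * norm h)). apply Rmult_le_compat_l; auto. nra.
assert (D3 : norm h * (4 * (K + 1)) <= eps).
{ apply Rlt_le in D2. apply (Rmult_le_compat_r (4 * (K + 1))) in D2; [|lra].
  replace (eps / (4 * (K + 1)) * (4 * (K + 1))) with (pos eps) in D2 by (field; lra). exact D2. }
apply Rle_trans with (norm h * (4 * (K+1)) * norm h). nra. now apply Rmult_le_compat_r.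
Qed.

Lemma continuous_theta_sum {U : UniformSpace} k (al be : U -> C) (x : U) :
  continuous al x -> continuous be x -> Re (al x) < 0 ->
    continuous (fun t => theta_sum k (al t) (be t)) x.
Proof.
intros Ha Hb H.
apply (continuous_comp_2 (W := C_UniformSpace) (V := C_UniformSpace) (X := C_UniformSpace) al be
  (theta_sum k)); auto.
apply (filterdiff_continuous (K := R_AbsRing) (U := CxC) (V := C_R_NormedModule) (fun p : CxC =>
  theta_sum k (fst p) (snd p))).
eexists. now apply filterdiff_theta_sum.
Qed.

Lemma is_derive_theta_sum k (al be : R -> C) x da db :
  is_derC al x da -> is_derC be x db -> Re (al x) < 0 ->
  is_derC (fun t => theta_sum k (al t) (be t)) x (da * theta_sum (k + 2) (al x) (be x) + db *
    theta_sum (k + 1) (al x) (be x))%C.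
Proof.
intros Ha Hb H.
assert (K := filterdiff_comp'_2 (K := R_AbsRing) (T := R_NormedModule) (U := C_R_NormedModule)
  (V := C_R_NormedModule) (W := C_R_NormedModule)
  al be (theta_sum k) x _ _ (fun u v => (u * theta_sum (k + 2) (al x) (be x) + v * theta_sum (k
    + 1) (al x) (be x))%C) Ha Hb (filterdiff_theta_sum k (al x) (be x) H)).
eapply filterdiff_ext_lin. exact K.
intro y. apply injective_projections; simpl; rring.
Qed.

(** Replacing [n] by [n + 1] in [al n^2 + be n] changes [be] into [be + 2 al]:
    this is the quasi-periodicity of theta functions. *)
Lemma theta_term_shift k al be n :
  theta_term k al (be + 2 * al) n = (Cexp (- (al + be))
    * (RtoC (IZR n ^ k) * theta_term 0 al be (n + 1)))%C.
Proof.
unfold theta_term. rewrite plus_IZR.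
replace (al * RtoC (IZR n ^ 2) + (be + 2 * al) * IZR n)%C with (- (al + be) + (al * RtoC ((IZR n
  + 1) ^ 2)%R + be * RtoC (IZR n + 1)%R))%C.
2:{ rewrite RtoC_pow, RtoC_plus, RtoC_pow. ring. }
rewrite (Cexp_plus (- (al + be))). simpl (_ ^ 0)%R. ring.
Qed.

Lemma theta_sum_shift0 al be : Re al < 0 -> theta_sum 0 al (be + 2 * al) = (Cexp (- (al + be))
  * theta_sum 0 al be)%C.
Proof.
intro H. assert (S0 := theta_term_summable 0 al be H).
unfold theta_sum. rewrite <- CSeriesZ_scal by assumption.
rewrite <- (CSeriesZ_shift (fun n => _ * _)%C) by now apply abs_summableZ_scal.
apply CSeriesZ_ext. intro n. rewrite theta_term_shift. simpl (_ ^ 0)%R. ring.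
Qed.

Lemma theta_sum_shift1 al be : Re al < 0 ->
  theta_sum 1 al (be + 2 * al) = (Cexp (- (al + be)) * (theta_sum 1 al be - theta_sum 0 al be))%C.
Proof.
intro H. assert (S0 := theta_term_summable 0 al be H). assert (S1 := theta_term_summable 1 al be
  H).
unfold theta_sum.
replace (CSeriesZ (theta_term 1 al be) - CSeriesZ (theta_term 0 al be))%C
  with (CSeriesZ (theta_term 1 al be) + (- (1)) * CSeriesZ (theta_term 0 al be))%C by ring.
rewrite <- (CSeriesZ_scal (- (1))) by assumption.
assert (S2 := abs_summableZ_scal (- (1))%C _ S0).
rewrite <- CSeriesZ_plus by assumption.
assert (S3 := abs_summableZ_plus _ _ S1 S2).
rewrite <- CSeriesZ_scal by assumption.
rewrite <- (CSeriesZ_shift (fun n => _ * _)%C) by now apply abs_summableZ_scal.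
apply CSeriesZ_ext. intro n. rewrite theta_term_shift. unfold theta_term.
rewrite !pow_1, plus_IZR, RtoC_plus. simpl (_ ^ 0)%R. ring.
Qed.

Lemma Cexp_2PI_nat (n : nat) : Cexp (2 * PI * Ci * RtoC (INR n)) = 1%C.
Proof.
replace (2 * PI * Ci * RtoC (INR n))%C with (INR n * (2 * PI * Ci))%C by ring.
rewrite <- Cexp_pow.
replace (Cexp (2 * PI * Ci)) with (RtoC 1).
- clear. induction n as [|n IH]; simpl; auto. rewrite IH. ring.
- unfold Cexp. simpl. replace (_ - _)%R with 0%R by ring. replace (_ + _)%R with (2 * PI)%R by
    ring.
  rewrite exp_0, cos_2PI, sin_2PI. unfold RtoC. f_equal; ring.
Qed.

Lemma Cexp_2PI_Z (n : Z) : Cexp (2 * PI * Ci * RtoC (IZR n)) = 1%C.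
Proof.
destruct (Z_le_gt_dec 0 n) as [H|H].
- rewrite <- (Z2Nat.id n) by assumption. rewrite <- INR_IZR_INZ. apply Cexp_2PI_nat.
- replace (2 * PI * Ci * RtoC (IZR n))%C with (- (2 * PI * Ci * RtoC (INR (Z.to_nat (- n)))))%C.
  rewrite Cexp_opp, Cexp_2PI_nat. field.
  rewrite INR_IZR_INZ, Z2Nat.id, opp_IZR, RtoC_opp by lia. ring.
Qed.

(** The integers [n] and [n^2] have the same parity. *)
Lemma Cexp_PI_sqr (n : Z) : Cexp (PI * Ci * RtoC (IZR n ^ 2)) = Cexp (PI * Ci * RtoC (IZR n)).
Proof.
assert (E : exists k, (n * n = n + 2 * k)%Z).
{ destruct (Z.Even_or_Odd n) as [[m Hm]|[m Hm]]; subst n.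
  exists (2 * m * m - m)%Z; ring. exists (2 * m * m + m)%Z; ring. }
destruct E as [k Hk].
replace (IZR n ^ 2) with (IZR n + 2 * IZR k) by (rewrite <- mult_IZR, <- plus_IZR, <- Hk,
  mult_IZR; ring).
replace (PI * Ci * RtoC (IZR n + 2 * IZR k))%C with (PI * Ci * RtoC (IZR n) + 2 * PI * Ci * RtoC
  (IZR k))%C by (rewrite RtoC_plus, RtoC_mult; ring).
rewrite Cexp_plus, Cexp_2PI_Z. ring.
Qed.

Lemma Cexp_PI_sign (n : Z) : Cexp (PI * Ci * RtoC (IZR n)) = RtoC (powerRZ (-1) n).
Proof.
assert (N : forall n : nat, Cexp (PI * Ci * RtoC (INR n)) = RtoC ((-1) ^ n)).
{ clear. intro n. replace (PI * Ci * RtoC (INR n))%C with (INR n * (PI * Ci))%C by ring.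
  rewrite <- Cexp_pow, RtoC_pow. f_equal. unfold Cexp; simpl.
  replace (_ - _)%R with 0%R by ring. replace (_ + _)%R with PI by ring.
  rewrite exp_0, cos_PI, sin_PI. unfold RtoC. f_equal; ring. }
destruct n as [|p|p]; simpl powerRZ.
- rewrite Cmult_0_r. apply Cexp_0.
- rewrite <- N. now rewrite INR_IZR_INZ, positive_nat_Z.
- rewrite RtoC_inv, <- N, <- Cexp_opp. f_equal.
  change (Z.neg p) with (- Z.pos p)%Z. rewrite opp_IZR, RtoC_opp, INR_IZR_INZ, positive_nat_Z.
    ring.
  apply pow_nonzero; lra.
Qed.

Lemma theta_sum_period k al be (m : Z) : theta_sum k al (be + 2 * PI * Ci * RtoC (IZR m))
  = theta_sum k al be.
Proof.
apply CSeriesZ_ext. intro n. unfold theta_term. f_equal.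
replace (al * RtoC (IZR n ^ 2) + (be + 2 * PI * Ci * RtoC (IZR m)) * RtoC (IZR n))%C
  with ((al * RtoC (IZR n ^ 2) + be * RtoC (IZR n)) + 2 * PI * Ci * RtoC (IZR (m * n)))%C by
    (rewrite mult_IZR, RtoC_mult; ring).
rewrite (Cexp_plus _ (2 * PI * Ci * _)), Cexp_2PI_Z. ring.
Qed.

Lemma theta_sum_half_shift k al be : theta_sum k (al + PI * Ci) be = theta_sum k al (be + PI *
  Ci).
Proof.
apply CSeriesZ_ext. intro n. unfold theta_term. f_equal.
replace ((al + PI * Ci) * RtoC (IZR n ^ 2) + be * RtoC (IZR n))%C
  with ((al * RtoC (IZR n ^ 2) + be * RtoC (IZR n)) + PI * Ci * RtoC (IZR n ^ 2))%C by ring.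
rewrite (Cexp_plus _ (PI * Ci * _)), Cexp_PI_sqr, <- Cexp_plus. f_equal. ring.
Qed.

Lemma Re_PiI (tau : C) : Re (PI * Ci * tau) = - PI * Im tau.
Proof. unfold Re, Im; simpl. ring. Qed.

Lemma Re_PiI_neg (tau : C) : 0 < Im tau -> Re (PI * Ci * tau) < 0.
Proof. intro H. rewrite Re_PiI. assert (P := PI_RGT_0). nra. Qed.

(** * The theta constants as Gaussian sums *)

Lemma theta3_theta_sum tau : theta3 tau = theta_sum 0 (PI * Ci * tau) 0.
Proof.
apply CSeriesZ_ext. intro n. unfold nome_pow, theta_term.
replace (PI * Ci * tau * RtoC (IZR n ^ 2) + 0 * RtoC (IZR n))%C with (PI * Ci * tau * RtoC (IZR
  n ^ 2))%C by ring.
simpl (_ ^ 0)%R. ring.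
Qed.

Lemma theta4_theta_sum tau : theta4 tau = theta_sum 0 (PI * Ci * tau) (PI * Ci).
Proof.
apply CSeriesZ_ext. intro n. unfold nome_pow, theta_term.
rewrite (Cexp_plus (PI * Ci * tau * _)), Cexp_PI_sign.
simpl (_ ^ 0)%R. ring.
Qed.

Lemma theta2_theta_sum tau : 0 < Im tau -> theta2 tau = (Cexp (PI * Ci * tau / 4) * theta_sum 0
  (PI * Ci * tau) (PI * Ci * tau))%C.
Proof.
intro H. unfold theta_sum. rewrite <- CSeriesZ_scal by now apply theta_term_summable, Re_PiI_neg.
apply CSeriesZ_ext. intro n. unfold nome_pow, theta_term.
simpl (_ ^ 0)%R. rewrite Cmult_1_l, <- Cexp_plus. f_equal.
replace ((IZR n + 1 / 2) ^ 2) with (IZR n ^ 2 + IZR n + / 4) by field.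
rewrite !RtoC_plus, RtoC_inv by lra. field.
Qed.

(** * Integrals of complex functions of a real variable *)

Lemma is_RIntC_ext (f g : R -> C) a b l : (forall x, f x = g x) -> is_RIntC f a b l ->
  is_RIntC g a b l.
Proof. intros H. apply is_RInt_ext. intros; apply H. Qed.

Lemma is_RIntC_plus (f g : R -> C) a b (lf lg : C) : is_RIntC f a b lf -> is_RIntC g a b lg ->
  is_RIntC (fun x => f x + g x)%C a b (lf + lg)%C.
Proof. apply (is_RInt_plus (V := C_R_NormedModule)). Qed.

Lemma is_RIntC_minus (f g : R -> C) a b (lf lg : C) : is_RIntC f a b lf -> is_RIntC g a b lg ->
  is_RIntC (fun x => f x - g x)%C a b (lf - lg)%C.
Proof. apply (is_RInt_minus (V := C_R_NormedModule)). Qed.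

Lemma is_RIntC_pair (f : R -> C) a b l : is_RInt (fun x => Re (f x)) a b (Re l) ->
  is_RInt (fun x => Im (f x)) a b (Im l) ->
  is_RIntC f a b l.
Proof.
intros H1 H2. destruct l as [l1 l2].
exact (is_RInt_fct_extend_pair (U := R_NormedModule) (V := R_NormedModule) f a b l1 l2 H1 H2).
Qed.

Lemma is_RIntC_Re (f : R -> C) a b l : is_RIntC f a b l -> is_RInt (fun x => Re (f x)) a b (Re l).
Proof. apply (is_RInt_fct_extend_fst (U := R_NormedModule) (V := R_NormedModule)). Qed.

Lemma is_RIntC_Im (f : R -> C) a b l : is_RIntC f a b l -> is_RInt (fun x => Im (f x)) a b (Im l).
Proof. apply (is_RInt_fct_extend_snd (U := R_NormedModule) (V := R_NormedModule)). Qed.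

Lemma is_RIntC_scal (c : C) (f : R -> C) a b l : is_RIntC f a b l ->
  is_RIntC (fun x => c * f x)%C a b (c * l)%C.
Proof.
intro H. assert (H1 := is_RIntC_Re _ _ _ _ H). assert (H2 := is_RIntC_Im _ _ _ _ H).
apply is_RIntC_pair.
- exact (is_RInt_minus _ _ _ _ _ _ (is_RInt_scal _ _ _ (Re c) _ H1) (is_RInt_scal _ _ _ (Im c) _
    H2)).
- exact (is_RInt_plus _ _ _ _ _ _ (is_RInt_scal _ _ _ (Re c) _ H2) (is_RInt_scal _ _ _ (Im c) _
    H1)).
Qed.

Lemma is_RIntC_RtoC (f : R -> R) a b l : is_RInt f a b l -> is_RIntC (fun x => RtoC (f x))
  a b (RtoC l).
Proof.
intro H. apply is_RIntC_pair; simpl; auto.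
assert (K := is_RInt_const (V := R_NormedModule) a b (0 : R)).
  rewrite (scal_zero_r (V := R_NormedModule)) in K. exact K.
Qed.

Lemma ex_RIntC_cont (f : R -> C) a b : (forall x, continuous f x) -> is_RIntC f a b (RIntC f a b).
Proof. intro H. apply (RInt_correct (V := C_R_CompleteNormedModule)).
  apply (ex_RInt_continuous (V := C_R_CompleteNormedModule)). auto. Qed.

Lemma RIntC_unique (f : R -> C) a b l : is_RIntC f a b l -> RIntC f a b = l.
Proof. apply (is_RInt_unique (V := C_R_CompleteNormedModule)). Qed.

Lemma is_RIntC_bound (f : R -> C) g a b l lg : a <= b -> (forall x, a <= x <= b ->
  Cmod (f x) <= g x) ->
  is_RIntC f a b l -> is_RInt g a b lg -> Cmod l <= lg.
Proof.
intros Hab H H1 H2. rewrite <- Cmod_norm_R. apply (norm_RInt_le (V := C_R_NormedModule) f g a b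
  l lg); auto.
intros x Hx. rewrite Cmod_norm_R. auto.
Qed.

Lemma is_RIntC_derive (f df : R -> C) a b : a <= b ->
  (forall x, a <= x <= b -> is_derC f x (df x)) -> (forall x, a <= x <= b -> continuous df x) ->
  is_RIntC df a b (f b - f a)%C.
Proof.
intros Hab H1 H2. apply (is_RInt_derive (V := C_R_CompleteNormedModule) f df);
  rewrite Rmin_left, Rmax_right; auto.
Qed.

Lemma is_derC_zero_eq (f : R -> C) a b : a <= b -> (forall x, a <= x <= b -> is_derC f x 0) ->
  f a = f b.
Proof.
intros [Hab| ->] H; auto. apply (eq_is_derive (V := C_R_NormedModule) f a b); auto.
Qed.

Lemma is_derive_RInt_param_R (f f' : R -> R -> R) a b x : a <= b ->
  locally x (fun s => forall t, a <= t <= b -> is_derive (fun u => f u t) s (f' s t)) ->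
  (forall t, a <= t <= b -> locally (x, t) (fun p : R * R => is_derive (fun u => f u (snd p))
    (fst p) (f' (fst p) (snd p)))) ->
  (forall t, a <= t <= b -> continuous (fun p : R * R => f' (fst p) (snd p)) (x, t)) ->
  locally x (fun s => forall t, a <= t <= b -> continuous (f s) t) ->
  is_derive (fun s => RInt (f s) a b) x (RInt (f' x) a b).
Proof.
intros Hab H1 H2 H3 H4.
assert (E : RInt (f' x) a b = RInt (fun t => Derive (fun u => f u t) x) a b).
{ apply RInt_ext. rewrite Rmin_left, Rmax_right by auto. intros t Ht. symmetry.
    apply is_derive_unique.
  apply (locally_singleton _ _ H1). lra. }
rewrite E. apply is_derive_RInt_param; rewrite ?Rmin_left, ?Rmax_right by auto.
- apply filter_imp with (2 := H1). intros s Hs t Ht. eexists. now apply Hs.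
- intros t Ht. apply (continuity_2d_pt_ext_loc f').
  + apply locally_2d_locally. apply filter_imp with (2 := H2 t Ht). intros [u v] Huv.
      simpl in *. symmetry. now apply is_derive_unique.
  + apply continuity_2d_pt_filterlim. apply (H3 t Ht).
- apply filter_imp with (2 := H4). intros s Hs. apply (ex_RInt_continuous (V :=
    R_CompleteNormedModule)).
  rewrite ?Rmin_left, ?Rmax_right by auto. exact Hs.
Qed.

(** Differentiation under the integral sign; the second hypothesis is needed
    in a two-dimensional neighbourhood of each point because the derivative
    has to be continuous in both variables jointly. *)
Lemma is_derive_RInt_param_C (f f' : R -> R -> C) a b x : a <= b ->
  locally x (fun s => forall t, a <= t <= b -> is_derC (fun u => f u t) s (f' s t)) ->
  (forall t, a <= t <= b -> locally (x, t) (fun p : R * R => is_derC (fun u => f u (snd p))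
    (fst p) (f' (fst p) (snd p)))) ->
  (forall t, a <= t <= b -> continuous (fun p : R * R => f' (fst p) (snd p)) (x, t)) ->
  locally x (fun s => forall t, a <= t <= b -> continuous (f s) t) ->
  is_derC (fun s => RIntC (f s) a b) x (RIntC (f' x) a b).
Proof.
intros Hab H1 H2 H3 H4.
assert (X : forall g : R -> C, (forall t, a <= t <= b -> continuous g t) ->
  Re (RIntC g a b) = RInt (fun t => Re (g t)) a b /\ Im (RIntC g a b) = RInt (fun t => Im (g t))
    a b).
{ intros g Hg. assert (I : is_RIntC g a b (RIntC g a b)).
  { apply (RInt_correct (V := C_R_CompleteNormedModule)),
      (ex_RInt_continuous (V := C_R_CompleteNormedModule)).
    rewrite Rmin_left, Rmax_right; auto. }
  split; symmetry; apply is_RInt_unique. now apply is_RIntC_Re. now apply is_RIntC_Im. }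
assert (C' : forall t, a <= t <= b -> continuous (f' x) t).
{ intros t Ht. apply (continuous_comp (fun v : R => (x, v))
    (fun p : R * R => f' (fst p) (snd p))); auto.
  apply (continuous_comp_2 (fun _ : R => x) (fun v : R => v) (fun a b : R => (a, b))).
  apply continuous_const. apply continuous_id.
  apply (continuous_ext (fun p : R * R => p)). now intros []. apply continuous_id. }
destruct (X _ C') as [X1 X2].
apply is_derive_C.
- rewrite X1. apply (is_derive_ext_loc (fun s => RInt (fun t => Re (f s t)) a b)).
  apply filter_imp with (2 := H4). intros s Hs. symmetry. now apply X.
  apply (is_derive_RInt_param_R (fun s t => Re (f s t)) (fun s t => Re (f' s t))); auto.
  + apply filter_imp with (2 := H1). intros s Hs t Ht. now apply is_derive_Re, Hs.
  + intros t Ht. apply filter_imp with (2 := H2 t Ht). intros p Hp. now apply is_derive_Re.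
  + intros t Ht. now apply (continuous_Re (fun p : R * R => f' (fst p) (snd p))), H3.
  + apply filter_imp with (2 := H4). intros s Hs t Ht. now apply continuous_Re, Hs.
- rewrite X2. apply (is_derive_ext_loc (fun s => RInt (fun t => Im (f s t)) a b)).
  apply filter_imp with (2 := H4). intros s Hs. symmetry. now apply X.
  apply (is_derive_RInt_param_R (fun s t => Im (f s t)) (fun s t => Im (f' s t))); auto.
  + apply filter_imp with (2 := H1). intros s Hs t Ht. now apply is_derive_Im, Hs.
  + intros t Ht. apply filter_imp with (2 := H2 t Ht). intros p Hp. now apply is_derive_Im.
  + intros t Ht. now apply (continuous_Im (fun p : R * R => f' (fst p) (snd p))), H3.
  + apply filter_imp with (2 := H4). intros s Hs t Ht. now apply continuous_Im, Hs.
Qed.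

(** * Uniqueness of Fourier coefficients *)

Definition fourier_char (m : Z) (x : R) : C := Cexp (2 * PI * Ci * RtoC (IZR m) * RtoC x).

(** This is the square of [cos (PI (x - x0))], written so that it is visibly a
    trigonometric polynomial. Its powers concentrate at [x0] modulo 1. *)
Definition cos2_ker (x0 x : R) : R := (1 + cos (2 * PI * (x - x0))) / 2.

Lemma fourier_char_plus m n x : fourier_char (m + n) x = (fourier_char m x * fourier_char n x)%C.
Proof. unfold fourier_char. rewrite <- Cexp_plus, plus_IZR, RtoC_plus. f_equal. ring. Qed.

Lemma cos2_ker_fourier x0 x : RtoC (cos2_ker x0 x) = (/ 2 + / 4 * fourier_char (-1) x0 *
  fourier_char 1 x + / 4 * fourier_char 1 x0 * fourier_char (-1) x)%C.
Proof.
unfold cos2_ker. replace (2 * PI * (x - x0)) with (2 * PI * x - 2 * PI * x0) by ring.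
  rewrite cos_minus.
assert (E1 : forall y, fourier_char 1 y = (cos (2 * PI * y), sin (2 * PI * y))).
{ intro y. unfold fourier_char, Cexp.
  replace (2 * PI * Ci * 1 * y)%C with ((0, 2 * PI * y) : C) by (apply injective_projections;
    simpl; ring).
  simpl. rewrite exp_0. f_equal; ring. }
assert (E2 : forall y, fourier_char (-1) y = (cos (2 * PI * y), - sin (2 * PI * y))).
{ intro y. unfold fourier_char, Cexp.
  replace (2 * PI * Ci * RtoC (-1) * y)%C with ((0, - (2 * PI * y)) : C) by
    (apply injective_projections; simpl; ring).
  simpl. rewrite exp_0, cos_neg, sin_neg. f_equal; ring. }
rewrite !E1, !E2. apply injective_projections; simpl; field.
Qed.

Lemma cos2_ker_bounds x0 x : 0 <= cos2_ker x0 x <= 1.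
Proof. unfold cos2_ker. assert (H := COS_bound (2 * PI * (x - x0))). lra. Qed.

Lemma continuous_cos2_ker x0 x : continuous (cos2_ker x0) x.
Proof.
apply (ex_derive_continuous (V := R_NormedModule)). unfold cos2_ker. auto_derive. auto.
Qed.

Lemma continuous_Rpow (f : R -> R) n x : continuous f x -> continuous (fun t => f t ^ n) x.
Proof.
intro H. induction n as [|n IH]; simpl. apply continuous_const.
  now apply (continuous_mult (K := R_AbsRing)).
Qed.

Definition cos2_mass x0 M : R := RInt (fun x => cos2_ker x0 x ^ M) 0 1.

Lemma is_RInt_cos2_ker x0 M : is_RInt (fun x => cos2_ker x0 x ^ M) 0 1 (cos2_mass x0 M).
Proof.
apply (RInt_correct (V := R_CompleteNormedModule)), (ex_RInt_continuous (V :=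
  R_CompleteNormedModule)).
intros x _. apply continuous_Rpow, continuous_cos2_ker.
Qed.

(** Integrating the derivative of [sin (2 PI (x - x0)) * cos2_ker x0 x ^ M]
    over a period gives the exact share [1 / (2 M + 2)] of the mass of the
    [M]-th power that the weight [1 - cos2_ker] sees. *)
Lemma cos2_mass_rec x0 M : cos2_mass x0 M = (2 * INR M + 2) * (cos2_mass x0 M - cos2_mass x0 (S
  M)).
Proof.
set (S1 := fun x => sin (2 * PI * (x - x0)) * cos2_ker x0 x ^ M).
set (dS := fun x => 2 * PI * (cos2_ker x0 x ^ M - (2 * INR M + 2) * (cos2_ker x0 x ^ M -
  cos2_ker x0 x ^ S M))).
assert (D : forall x, is_derive S1 x (dS x)).
{ intro x. unfold S1, cos2_ker. auto_derive; auto.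
  assert (E : (sin (2 * PI * (x + - x0)))² = 1 - (cos (2 * PI * (x + - x0)))²).
  { assert (H := sin2_cos2 (2 * PI * (x + - x0))). lra. }
  unfold dS, cos2_ker. change (x - x0) with (x + - x0). unfold Rsqr in E. set (c := cos _) in *.
    set (s := sin _) in *.
  destruct M as [|M]. simpl. ring_simplify. field.
  rewrite <- tech_pow_Rmult.
  replace (pred (S M)) with M by reflexivity. rewrite <- !tech_pow_Rmult. unfold Rdiv.
  set (r := ((1 + c) * / 2) ^ M).
  transitivity (2 * PI * c * ((1 + c) * / 2 * r) - (s * s) * PI * INR (S M) * r). field.
    rewrite E. field. }
assert (I : is_RInt dS 0 1 (S1 1 - S1 0)).
{ apply (is_RInt_derive (V := R_CompleteNormedModule) S1 dS). intros; apply D.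
  intros x _. apply (ex_derive_continuous (V := R_NormedModule)). unfold dS, cos2_ker.
    auto_derive. auto. }
assert (Z : S1 1 - S1 0 = 0).
{ unfold S1, cos2_ker. replace (2 * PI * (1 - x0)) with (2 * PI * (0 - x0) + 2 * PI) by ring.
  rewrite sin_plus, cos_plus, sin_2PI, cos_2PI.
  replace (sin (2 * PI * (0 - x0)) * 1 + cos (2 * PI * (0 - x0))
    * 0) with (sin (2 * PI * (0 - x0))) by ring.
  replace (cos (2 * PI * (0 - x0)) * 1 - sin (2 * PI * (0 - x0))
    * 0) with (cos (2 * PI * (0 - x0))) by ring. ring. }
rewrite Z in I.
assert (J : is_RInt dS 0 1 (2 * PI * (cos2_mass x0 M - (2 * INR M + 2) * (cos2_mass x0 M -
  cos2_mass x0 (S M))))).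
{ apply (is_RInt_scal (V := R_NormedModule)). apply (is_RInt_minus (V := R_NormedModule)).
    apply is_RInt_cos2_ker.
  apply (is_RInt_scal (V := R_NormedModule)). apply (is_RInt_minus (V := R_NormedModule));
    apply is_RInt_cos2_ker. }
assert (K := is_RInt_unique _ _ _ _ I). rewrite (is_RInt_unique _ _ _ _ J) in K.
assert (P := PI_RGT_0). apply Rmult_integral in K. destruct K; lra.
Qed.

Lemma cos2_mass_pos x0 M : 0 < cos2_mass x0 M.
Proof.
induction M as [|M IH].
- assert (H := is_RInt_cos2_ker x0 0). assert (H' : is_RInt (fun x : R => cos2_ker x0 x ^ 0) 0 1
    (scal (1 - 0) 1)).
  { exact (is_RInt_const (V := R_NormedModule) 0 1 (1 : R)). }
  rewrite <- (is_RInt_unique _ _ _ _ H), (is_RInt_unique _ _ _ _ H'). unfold scal; simpl;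
    unfold mult; simpl. lra.
- assert (R := cos2_mass_rec x0 M). assert (P := pos_INR M). nra.
Qed.

Lemma fourier_cos2_ker_zero (h : R -> C) (x0 : R) :
  (forall m, is_RIntC (fun x => h x * fourier_char m x)%C 0 1 0) ->
  forall N m, is_RIntC (fun x => h x * fourier_char m x * RtoC (cos2_ker x0 x ^ N))%C 0 1 0.
Proof.
intro H. induction N as [|N IH]; intro m.
- apply (is_RIntC_ext (fun x => h x * fourier_char m x)%C); auto. intro x. simpl. ring.
- assert (K := is_RIntC_plus _ _ _ _ _ _ (is_RIntC_plus _ _ _ _ _ _ (is_RIntC_scal (/ 2) _ _ _ _
    (IH m))
    (is_RIntC_scal (/ 4 * fourier_char (-1) x0) _ _ _ _ (IH (m + 1)%Z)))
      (is_RIntC_scal (/ 4 * fourier_char 1 x0) _ _ _ _ (IH (m + -1)%Z))).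
  replace (/ 2 * 0 + / 4 * fourier_char (-1) x0 * 0 + / 4 * fourier_char 1 x0 * 0)%C with (RtoC
    0) in K by ring.
  revert K. apply is_RIntC_ext. intro x. rewrite <- tech_pow_Rmult, RtoC_mult, cos2_ker_fourier,
    !fourier_char_plus. ring.
Qed.

Lemma cos_away d u : 0 < d -> d <= 1 / 2 -> d <= Rabs u <= 1 - d ->
  cos (2 * PI * u) <= cos (2 * PI * d).
Proof.
intros H0 H1 H2. assert (P := PI_RGT_0).
assert (E : cos (2 * PI * u) = cos (2 * PI * Rabs u)).
{ unfold Rabs; destruct Rcase_abs; auto. rewrite <- cos_neg. f_equal; ring. }
rewrite E. set (v := Rabs u) in *.
destruct (Rle_dec v (1/2)).
- apply cos_decr_1; nra.
- replace (cos (2 * PI * v)) with (cos (2 * PI * (1 - v))). apply cos_decr_1; nra.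
  replace (2 * PI * (1 - v)) with (- (2 * PI * v) + 2 * PI) by ring. rewrite cos_plus, sin_2PI,
    cos_2PI, cos_neg. ring.
Qed.

Lemma continuous_bounded (h : R -> C) : (forall x, continuous h x) -> exists B, forall x,
  0 <= x <= 1 -> Cmod (h x) <= B.
Proof.
intro H.
assert (K : forall f : R -> R, (forall x, continuous f x) -> exists B, forall x, 0 <= x <= 1 ->
  Rabs (f x) <= B).
{ intros f Hf. destruct (continuity_ab_maj (fun x => Rabs (f x)) 0 1) as [m [Hm _]]. lra.
  intros c _. apply continuity_pt_filterlim. apply (continuous_comp f Rabs). auto.
    apply continuous_Rabs.
  exists (Rabs (f m)). auto. }
destruct (K (fun x => Re (h x))) as [B1 H1]. intro x; now apply continuous_Re.
destruct (K (fun x => Im (h x))) as [B2 H2]. intro x; now apply continuous_Im.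
exists (B1 + B2). intros x Hx. eapply Rle_trans. apply Cmod_le_Re_Im. specialize (H1 x Hx).
  specialize (H2 x Hx). simpl in *. lra.
Qed.

Lemma continuous_eps (h : R -> C) x : continuous h x -> forall eps, 0 < eps ->
  exists d, 0 < d /\ forall y, Rabs (y - x) < d -> Cmod (h y - h x) < eps.
Proof.
intros H eps He.
assert (K := proj1 (filterlim_locally_ball_norm (K := R_AbsRing) (U := C_R_NormedModule) h (h
  x)) H (mkposreal eps He)).
destruct K as [d Hd]. exists d. split. apply cond_pos. intros y Hy. specialize (Hd y Hy).
unfold ball_norm in Hd. rewrite Cmod_norm_R in Hd. exact Hd.
Qed.

(** Close to [x0] modulo 1 the difference is small by continuity; elsewhere [1
    - cos2_ker] is bounded away from 0. *)
Lemma korovkin_bound (h : R -> C) x0 eps : (forall x, continuous h x) -> (forall x,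
  h (x + 1) = h x) -> 0 <= x0 <= 1 -> 0 < eps ->
  exists K, forall x, 0 <= x <= 1 -> Cmod (h x0 - h x) <= eps + K * (1 - cos2_ker x0 x).
Proof.
intros Hc Hp Hx0 He.
destruct (continuous_bounded h Hc) as [B HB].
destruct (continuous_eps h x0 (Hc x0) eps He) as [d0 [Pd0 Hd0]].
set (d := Rmin d0 (1 / 4)). assert (Pd : 0 < d) by (apply Rmin_glb_lt; lra).
assert (Ld : d <= 1 / 4) by apply Rmin_r. assert (Ld' : d <= d0) by apply Rmin_l.
assert (P := PI_RGT_0).
set (g := (1 - cos (2 * PI * d)) / 2).
assert (Pg : 0 < g).
{ assert (cos (2 * PI * d) < cos 0) by (apply cos_decreasing_1; nra). rewrite cos_0 in H.
    unfold g; lra. }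
assert (B0 : 0 <= B) by (eapply Rle_trans; [apply Cmod_ge_0|apply (HB x0 Hx0)]).
exists (2 * B / g). intros x Hx.
assert (Kb := cos2_ker_bounds x0 x).
assert (Kp : 0 <= 2 * B / g * (1 - cos2_ker x0 x)).
{ apply Rmult_le_pos; [|lra]. apply Rmult_le_pos. lra. left; now apply Rinv_0_lt_compat. }
assert (Sw : Cmod (h x0 - h x) = Cmod (h x - h x0)).
{ rewrite <- Cmod_opp. f_equal. ring. }
destruct (Rlt_dec (Rabs (x - x0)) d) as [L|L].
{ rewrite Sw. assert (Y := Hd0 x ltac:(lra)). lra. }
destruct (Rlt_dec (1 - d) (Rabs (x - x0))) as [L'|L'].
{ rewrite Sw. revert L'. unfold Rabs at 1. destruct Rcase_abs; intro L'.
  - rewrite <- (Hp x). assert (Y := Hd0 (x + 1)). rewrite Rabs_pos_eq in Y by lra.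
      specialize (Y ltac:(lra)). lra.
  - replace (h x) with (h (x - 1)) by (rewrite <- (Hp (x - 1)); f_equal; ring).
    assert (Y := Hd0 (x - 1)). rewrite Rabs_left1 in Y by lra. specialize (Y ltac:(lra)). lra. }
assert (CA := cos_away d (x - x0) Pd ltac:(lra) ltac:(lra)).
assert (G : g <= 1 - cos2_ker x0 x) by (unfold g, cos2_ker; lra).
assert (T : Cmod (h x0 - h x) <= 2 * B).
{ eapply Rle_trans. apply Cmod_triangle. rewrite Cmod_opp. assert (A1 := HB x0 Hx0).
    assert (A2 := HB x Hx). lra. }
assert (2 * B <= 2 * B / g * (1 - cos2_ker x0 x)).
{ replace (2 * B) with (2 * B / g * g) at 1 by (field; lra). apply Rmult_le_compat_l; auto.
  apply Rmult_le_pos. lra. left; now apply Rinv_0_lt_compat. }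
lra.
Qed.

(** The mean of [h] against the probability density proportional to [cos2_ker
    x0 ^ M] vanishes, since the density is a trigonometric polynomial. By
    [korovkin_bound] it differs from [h x0] by at most [eps + K / (2 M + 2)]. *)
Lemma fourier_unique (h : R -> C) : (forall x, continuous h x) -> (forall x, h (x + 1) = h x) ->
  (forall m, is_RIntC (fun x => h x * fourier_char m x)%C 0 1 0) -> forall x0, 0 <= x0 <= 1 ->
    h x0 = 0.
Proof.
intros Hc Hp H0 x0 Hx0. apply Cmod_eq_0.
apply Rle_antisym; [|apply Cmod_ge_0]. apply le_epsilon. intros eps He. rewrite Rplus_0_l.
destruct (korovkin_bound h x0 (eps / 2) Hc Hp Hx0 ltac:(lra)) as [K HK].
assert (Q : forall M, Cmod (h x0) <= eps / 2 + K / (2 * INR M + 2)).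
{ intro M. assert (P := cos2_mass_pos x0 M).
  assert (A := is_RIntC_minus _ _ _ _ _ _ (is_RIntC_scal (h x0) _ _ _ _ (is_RIntC_RtoC _ _ _ _
    (is_RInt_cos2_ker x0 M))) (fourier_cos2_ker_zero h x0 H0 M 0)).
  assert (B : is_RInt (fun x => eps / 2 * cos2_ker x0 x ^ M + K * (cos2_ker x0 x ^ M - cos2_ker
    x0 x ^ S M)) 0 1 (eps / 2 * cos2_mass x0 M + K * (cos2_mass x0 M - cos2_mass x0 (S M)))).
  { apply (is_RInt_plus (V := R_NormedModule)); apply (is_RInt_scal (V := R_NormedModule)).
      apply is_RInt_cos2_ker.
    apply (is_RInt_minus (V := R_NormedModule)); apply is_RInt_cos2_ker. }
  assert (Z : Cmod (h x0 * cos2_mass x0 M - 0) <= eps / 2 * cos2_mass x0 M + K * (cos2_mass x0 M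
    - cos2_mass x0 (S M))).
  { apply (is_RIntC_bound _ _ 0 1 _ _ Rle_0_1) with (2 := A) (3 := B). intros x Hx. cbv beta.
    assert (PK : 0 <= cos2_ker x0 x ^ M) by apply pow_le, cos2_ker_bounds.
    replace (h x0 * (cos2_ker x0 x ^ M)%R - h x * fourier_char 0 x * (cos2_ker x0 x ^ M)%R)%C
      with ((h x0 - h x) * RtoC (cos2_ker x0 x ^ M))%C.
    - rewrite Cmod_mult, Cmod_R, Rabs_pos_eq by exact PK.
      apply Rle_trans with ((eps / 2 + K * (1 - cos2_ker x0 x)) * cos2_ker x0 x ^ M).
      apply Rmult_le_compat_r; [exact PK| now apply HK]. right; simpl; ring.
    - unfold fourier_char. replace (2 * PI * Ci * 0 * x)%C with (RtoC 0) by ring.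
        rewrite Cexp_0; ring. }
  replace (h x0 * cos2_mass x0 M - 0)%C with (h x0 * cos2_mass x0 M)%C in Z by ring.
  rewrite Cmod_mult, Cmod_R, (Rabs_pos_eq (cos2_mass x0 M)) in Z by lra.
  assert (R := cos2_mass_rec x0 M). assert (PM := pos_INR M).
  assert (E : cos2_mass x0 M - cos2_mass x0 (S M) = cos2_mass x0 M / (2 * INR M + 2)).
  { apply Rmult_eq_reg_l with (2 * INR M + 2); [|lra]. rewrite <- R. field; lra. }
  rewrite E in Z.
  apply Rmult_le_reg_r with (cos2_mass x0 M); auto. eapply Rle_trans. apply Z. right. field.
    lra. }
destruct (Rle_dec K 0) as [L|L].
- specialize (Q 0%nat). simpl in Q. lra.
- destruct (archimed (K / eps)) as [A1 _]. set (n := Z.to_nat (up (K / eps))).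
  assert (N : K / eps <= INR n).
  { unfold n. rewrite INR_IZR_INZ. destruct (Z_le_gt_dec 0 (up (K / eps))). rewrite Z2Nat.id;
      auto; lra.
    assert (IZR (up (K / eps)) <= 0) by (apply IZR_le; lia).
    assert (0 < K / eps) by (apply Rdiv_lt_0_compat; lra). lra. }
  specialize (Q n). assert (P := pos_INR n).
  assert (K / (2 * INR n + 2) <= eps / 2).
  { apply Rmult_le_reg_r with (2 * INR n + 2). lra. replace (K / (2 * INR n + 2) * (2 * INR n +
      2)) with K by (field; lra).
    replace K with (K / eps * eps) by (field; lra). nra. }
  lra.
Qed.

(** * Termwise integration and Fourier coefficients of Gaussian sums *)

(** The tail of the majorant bounds the tail of the series uniformly, which is
    what makes termwise integration possible. *)
Lemma series_tail_le (f M : nat -> R) N : (forall n, Rabs (f n) <= M n) -> ex_series M ->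
  Rabs (Series f - sum_n f N) <= Series M - sum_n M N.
Proof.
intros H E.
assert (Ef : ex_series f).
{ apply ex_series_Rabs. apply ex_series_le_pos with (2 := E). intro n; split;
    auto using Rabs_pos. }
rewrite (Series_incr_n f (S N)), (Series_incr_n M (S N)) by (auto; lia).
simpl pred. rewrite <- !sum_n_Reals.
replace (sum_n f N + Series (fun k => f (S N + k)%nat) - sum_n f N) with (Series (fun k => f (S
  N + k)%nat)) by ring.
replace (sum_n M N + Series (fun k => M (S N + k)%nat) - sum_n M N) with (Series (fun k => M (S
  N + k)%nat)) by ring.
assert (E' : ex_series (fun k => M (S N + k)%nat)) by now apply ex_series_incr_n with (n := S N)
  in E.
eapply Rle_trans. apply Series_Rabs. apply ex_series_le_pos with (2 := E'). intro n; split;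
  auto using Rabs_pos.
apply Series_le; auto. intro n; split; auto using Rabs_pos.
Qed.

Lemma is_RInt_Series (a : nat -> R -> R) (M J : nat -> R) :
  (forall n x, Rabs (a n x) <= M n) -> ex_series M -> (forall n, is_RInt (a n) 0 1 (J n)) ->
  is_RInt (fun x => Series (fun n => a n x)) 0 1 (Series J).
Proof.
intros H E HI.
assert (HJ : forall n, Rabs (J n) <= M n).
{ intro n. apply (norm_RInt_le (V := R_NormedModule) (a n) (fun _ => M n) 0 1 (J n) (M n)). lra.
    intros; apply H. apply HI.
  assert (K := is_RInt_const (V := R_NormedModule) 0 1 (M n)). unfold scal in K; simpl in K;
    unfold mult in K; simpl in K.
  replace ((1 - 0) * M n) with (M n) in K by ring. exact K. }
assert (EJ : ex_series J).
{ apply ex_series_Rabs. apply ex_series_le_pos with (2 := E). intro n; split;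
    auto using Rabs_pos. }
destruct (filterlim_RInt (V := R_CompleteNormedModule) (fun N x => sum_n (fun n => a n x) N) 0 1
  eventually _ (fun x => Series (fun n => a n x)) (sum_n J)) as [If [L R]].
- intro N. induction N as [|N IH].
  + rewrite sum_O. apply (is_RInt_ext (V := R_NormedModule) (a 0%nat)); auto. intros x _.
      now rewrite sum_O.
  + rewrite sum_Sn. apply (is_RInt_ext (V := R_NormedModule) (fun x => plus (sum_n (fun n => a n
      x) N) (a (S N) x))).
    intros x _. now rewrite sum_Sn. apply (is_RInt_plus (V := R_NormedModule)); auto.
- apply filterlim_locally. intro eps.
  assert (LM := Series_correct M E).
  assert (LM' := proj1 (filterlim_locally (U := R_UniformSpace) (sum_n M) (Series M)) LM eps).
    clear LM. rename LM' into LM.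
  apply filter_imp with (2 := LM). intros N HN t.
  change (Rabs (sum_n M N - Series M) < eps) in HN. change (Rabs (sum_n (fun n => a n t) N -
    Series (fun n => a n t)) < eps).
  rewrite Rabs_minus_sym. eapply Rle_lt_trans. apply (series_tail_le (fun n => a n t) M N (fun n
    => H n t) E).
  eapply Rle_lt_trans. 2: exact HN. rewrite Rabs_minus_sym. apply Rle_abs.
- replace (Series J) with If; auto.
  apply (filterlim_locally_unique (F := eventually) (sum_n J)); auto. apply Series_correct; auto.
Qed.

Lemma is_RIntC_CSeries (a : nat -> R -> C) (M : nat -> R) (J : nat -> C) :
  (forall n x, Cmod (a n x) <= M n) -> ex_series M -> (forall n, is_RIntC (a n) 0 1 (J n)) ->
  is_RIntC (fun x => CSeries (fun n => a n x)) 0 1 (CSeries J).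
Proof.
intros H E HI. apply is_RIntC_pair; simpl.
- apply (is_RInt_Series (fun n x => Re (a n x)) M (fun n => Re (J n))); auto.
  intros n x. eapply Rle_trans. apply re_le_Cmod. auto. intro n; now apply is_RIntC_Re.
- apply (is_RInt_Series (fun n x => Im (a n x)) M (fun n => Im (J n))); auto.
  intros n x. eapply Rle_trans. apply im_le_Cmod. auto. intro n; now apply is_RIntC_Im.
Qed.

Lemma is_RIntC_CSeriesZ (a : Z -> R -> C) (M : Z -> R) (J : Z -> C) :
  (forall n x, Cmod (a n x) <= M n) -> summableZ M -> (forall n, is_RIntC (a n) 0 1 (J n)) ->
  is_RIntC (fun x => CSeriesZ (fun n => a n x)) 0 1 (CSeriesZ J).
Proof.
intros H [E1 E2] HI. unfold CSeriesZ. apply is_RIntC_plus.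
- apply (is_RIntC_CSeries (fun n => a (Z.of_nat n)) (fun n => M (Z.of_nat n))
    (fun n => J (Z.of_nat n))); auto.
- apply (is_RIntC_CSeries (fun n => a (- Z.of_nat (S n))%Z) (fun n => M (- Z.of_nat (S n))%Z)
    (fun n => J (- Z.of_nat (S n))%Z)); auto.
Qed.

Lemma CSeries_delta (J : nat -> C) k : (forall n, n <> k -> J n = 0) -> CSeries J = J k.
Proof.
assert (Z : forall J : nat -> C, (forall n, J n = 0) -> CSeries J = 0).
{ clear. intros J HJ. rewrite (CSeries_ext J (fun n => 0 * 0)%C). rewrite CSeries_scal. ring.
  apply (abs_summable_le _ (fun n => (1/2)^n)). intro n; rewrite Cmod_0. apply pow_le; lra.
  apply ex_series_geom. rewrite Rabs_pos_eq; lra. intro n; rewrite HJ; ring. }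
assert (SumJ : forall k (J : nat -> C), (forall n, n <> k -> J n = 0) -> abs_summable J).
{ clear. induction k as [|k IH]; intros J HJ; red.
  - apply ex_series_incr_1. apply (abs_summable_le (fun n => J (S n)) (fun n => (1/2)^n)).
    intro n. rewrite HJ by lia. rewrite Cmod_0. apply pow_le; lra. apply ex_series_geom.
      rewrite Rabs_pos_eq; lra.
  - apply ex_series_incr_1. apply (IH (fun n => J (S n))). intros n Hn. apply HJ. lia. }
revert J. induction k as [|k IH]; intros J HJ; rewrite CSeries_incr_1 by now apply (SumJ _ _ HJ).
- rewrite Z. ring. intro n; apply HJ; lia.
- rewrite HJ by lia. rewrite (IH (fun n => J (S n))). ring. intros n Hn; apply HJ; lia.
Qed.

Lemma CSeries_zero (J : nat -> C) : (forall n, J n = 0) -> CSeries J = 0.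
Proof. intro H. rewrite (CSeries_delta J 0); auto. Qed.

Lemma CSeriesZ_delta (J : Z -> C) k : (forall n, n <> k -> J n = 0) -> CSeriesZ J = J k.
Proof.
intro H. unfold CSeriesZ. destruct (Z_le_gt_dec 0 k) as [L|L].
- rewrite (CSeries_delta (fun n => J (Z.of_nat n)) (Z.to_nat k)). cbv beta. rewrite Z2Nat.id by
    lia.
  rewrite CSeries_zero. ring. intro n; apply H; lia. intros n Hn; apply H; lia.
- rewrite CSeries_zero. rewrite (CSeries_delta (fun n => J (- Z.of_nat (S n))%Z) (Z.to_nat (- k
    - 1))).
  cbv beta. replace (- Z.of_nat (S (Z.to_nat (- k - 1))))%Z with k by lia. ring.
  intros n Hn; apply H; lia. intro n; apply H; lia.
Qed.

Lemma is_derC_id x : is_derC RtoC x 1.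
Proof. apply (is_derive_RtoC (fun t => t) x 1). apply (is_derive_id (K := R_AbsRing)). Qed.

Lemma is_derC_scal (c : C) f x df : is_derC f x df -> is_derC (fun t => c * f t)%C x (c * df)%C.
Proof.
intro H. eapply is_derive_Ceq. apply is_derive_Cmult. apply is_derive_Cconst. exact H. cbv beta;
  ring.
Qed.

Lemma twoPiI_neq_0 : (2 * PI * Ci)%C <> 0%C.
Proof.
assert (P := PI_RGT_0). intro E. apply (f_equal Im) in E. simpl in E. lra.
Qed.

Lemma is_RIntC_fourier_char m : is_RIntC (fourier_char m) 0 1 (if Z.eq_dec m 0 then 1 else 0)%C.
Proof.
assert (D : forall x, is_derC (fourier_char m) x (2 * PI * Ci * RtoC (IZR m) * fourier_char m
  x)%C).
{ intro x. eapply is_derive_Ceq. apply is_derive_Cexp. apply is_derC_scal. apply is_derC_id.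
    unfold fourier_char. ring. }
destruct Z.eq_dec as [->|N].
- apply (is_RIntC_ext (fun x => RtoC 1)). intro x. unfold fourier_char. rewrite <- Cexp_0.
    f_equal. ring.
  apply (is_RIntC_RtoC (fun _ => 1)). assert (K := is_RInt_const (V := R_NormedModule) 0 1 (1 :
    R)). unfold scal in K; simpl in K; unfold mult in K; simpl in K.
  rewrite Rmult_1_r, Rminus_0_r in K. exact K.
- assert (NR : RtoC (IZR m) <> 0%C). { intro E. apply RtoC_inj in E. now apply eq_IZR in E. }
  assert (P := twoPiI_neq_0).
  assert (K := is_RIntC_derive (fun x => / (2 * PI * Ci * RtoC (IZR m))
    * fourier_char m x)%C (fourier_char m) 0 1 Rle_0_1).
  replace (RtoC 0) with (/ (2 * PI * Ci * RtoC (IZR m))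
    * fourier_char m 1 - / (2 * PI * Ci * RtoC (IZR m)) * fourier_char m 0)%C.
  apply K; intros x _.
  + eapply is_derive_Ceq. apply is_derC_scal. apply D.
    rewrite Cmult_assoc, Cinv_l. ring. now apply Cmult_neq_0.
  + eapply is_derC_continuous. apply D.
  + replace (fourier_char m 1) with (fourier_char m 0). ring. unfold fourier_char.
      rewrite Cmult_1_r, Cexp_2PI_Z. rewrite <- Cexp_0. f_equal; ring.
Qed.

(** Only the term [n = - m] survives the integration over a period. *)
Lemma fourier_theta_sum (al : C) m : Re al < 0 ->
  is_RIntC (fun x => theta_sum 0 al (2 * PI * Ci * RtoC x) * fourier_char m x)%C 0 1 (Cexp (al *
    RtoC (IZR m ^ 2))).
Proof.
intro H.
set (a := fun n x => (Cexp (al * RtoC (IZR n ^ 2)) * fourier_char (n + m) x)%C).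
set (J := fun n => (Cexp (al * RtoC (IZR n ^ 2)) * (if Z.eq_dec (n + m) 0 then 1 else 0))%C).
assert (Mee : forall k x, Cmod (fourier_char k x) = 1).
{ intros k x. unfold fourier_char. rewrite Cmod_Cexp, <- exp_0. f_equal. unfold Re, RtoC, Ci;
    simpl. ring. }
assert (K : is_RIntC (fun x => CSeriesZ (fun n => a n x)) 0 1 (CSeriesZ J)).
{ apply (is_RIntC_CSeriesZ a (gauss_maj 0 (- Re al) 0)).
  - intros n x. unfold a. rewrite Cmod_mult, Mee, Rmult_1_r.
    assert (G := theta_term_le 0 al 0 n). rewrite Cmod_0 in G. unfold theta_term in G.
    replace (RtoC (IZR n ^ 0) * Cexp (al * RtoC (IZR n ^ 2) + 0 * IZR n))%C with (Cexp (al *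
      RtoC (IZR n ^ 2))) in G; auto.
    simpl (_ ^ 0). rewrite Cmult_1_l. f_equal. ring.
  - apply gauss_maj_summable; lra.
  - intro n. unfold a, J. apply is_RIntC_scal. apply is_RIntC_fourier_char. }
rewrite (CSeriesZ_delta J (- m)) in K.
2:{ intros n Hn. unfold J. destruct Z.eq_dec. lia. ring. }
replace (J (- m)%Z) with (Cexp (al * RtoC (IZR m ^ 2))) in K.
2:{ unfold J. destruct Z.eq_dec. 2: lia. rewrite opp_IZR, Cmult_1_r. f_equal. f_equal. f_equal.
  ring. }
revert K. apply is_RIntC_ext. intro x. rewrite Cmult_comm. unfold theta_sum.
  rewrite <- CSeriesZ_scal by now apply theta_term_summable.
apply CSeriesZ_ext. intro n. unfold a, theta_term. rewrite fourier_char_plus.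
replace (fourier_char n x) with (Cexp (2 * PI * Ci * x * IZR n)) by (unfold fourier_char;
  f_equal; ring).
rewrite Cexp_plus. simpl (_ ^ 0). ring.
Qed.

(** * Inversion of the theta constants *)

Ltac cder := lazymatch goal with
 | |- is_derC (fun _ => ?c) _ _ => apply is_derive_Cconst
 | |- is_derC RtoC _ _ => apply is_derC_id
 | |- is_derC (fun t => RtoC t) _ _ => apply is_derC_id
 | |- is_derC (fun t => Cplus (@?f t) (@?g t)) _ _ => apply (is_derive_Cplus f g); cder
 | |- is_derC (fun t => Cminus (@?f t) (@?g t)) _ _ => apply (is_derive_Cminus f g); cder
 | |- is_derC (fun t => Cmult (@?f t) (@?g t)) _ _ => apply (is_derive_Cmult f g); cder
 | |- is_derC (fun t => Copp (@?f t)) _ _ => apply (is_derive_Copp f); cder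
 | |- is_derC (fun t => Cexp (@?f t)) _ _ => apply (is_derive_Cexp f); cder
 | |- is_derC (fun t => theta_sum ?k (@?f t) (@?g t)) _ _ => apply (is_derive_theta_sum k f g);
   [cder | cder | ]
 | |- is_derC (fun t => ?f t) _ _ => eassumption
 | |- is_derC ?f _ _ => eassumption
 | |- _ => idtac
 end.

Ltac ccont := lazymatch goal with
 | |- continuous (fun _ => ?c) _ => apply continuous_const
 | |- continuous (fun t => Cplus (@?f t) (@?g t)) _ => apply (continuous_Cplus f g); ccont
 | |- continuous (fun t => Cminus (@?f t) (@?g t)) _ => apply (continuous_Cminus f g); ccont
 | |- continuous (fun t => Cmult (@?f t) (@?g t)) _ => apply (continuous_Cmult f g); ccont
 | |- continuous (fun t => Copp (@?f t)) _ => apply (continuous_Copp f); ccont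
 | |- continuous (fun t => Cexp (@?f t)) _ => apply (continuous_Cexp f); ccont
 | |- continuous (fun t => theta_sum ?k (@?f t) (@?g t))
   _ => apply (continuous_theta_sum k f g); [ccont | ccont | ]
 | |- continuous (fun t => RtoC (@?f t)) _ => apply (continuous_RtoC f); ccont
 | |- continuous RtoC _ => apply (continuous_RtoC (fun t => t)); ccont
 | |- continuous (fun t => t) _ => apply continuous_id
 | |- continuous (fun t => fst t) _ => apply continuous_fst
 | |- continuous (fun t => snd t) _ => apply continuous_snd
 | |- continuous fst _ => apply continuous_fst
 | |- continuous snd _ => apply continuous_snd
 | |- _ => try assumption
 end.

Lemma Cnz_of_Im (c : C) : 0 < Im c -> c <> 0%C.
Proof. intros H E. rewrite E in H. simpl in H. lra. Qed.

(** Expanding [(n + x)^2] splits [exp (pi i sg (n + x)^2 - 2 pi i y (n + x))]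
    into a factor without [n] and a term of a Gaussian sum. *)
Definition gauss_factor (sg : C) (x y : R) : C := Cexp (PI * Ci * sg * x * x - 2 * PI * Ci * y *
  x)%C.

Definition gauss_theta (k : nat) (sg : C) (x y : R) : C := theta_sum k (PI * Ci * sg) (2 * PI *
  Ci * (sg * x - y)).

(** The sum over [n] of [exp (pi i sg (n + x)^2 - 2 pi i y (n + x))]. It has
    period 1 in [x], and its integral over a period is the Fourier transform
    of [exp (pi i sg x^2)] at [y], without any integral over the whole line. *)
Definition periodized_gauss (sg : C) (x y : R) : C := (gauss_factor sg x y * gauss_theta 0 sg x
  y)%C.

Lemma periodized_gauss_period sg x y : 0 < Im sg -> periodized_gauss sg (x + 1) y =
  periodized_gauss sg x y.
Proof.
intro H. unfold periodized_gauss, gauss_theta, gauss_factor. rewrite RtoC_plus.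
replace (2 * PI * Ci * (sg * (x + 1) - y))%C with (2 * PI * Ci * (sg * x - y) + 2 * (PI * Ci *
  sg))%C by ring.
rewrite theta_sum_shift0 by now apply Re_PiI_neg.
rewrite Cmult_assoc, <- Cexp_plus. f_equal. f_equal. ring.
Qed.

Lemma is_derive_periodized_gauss_x sg x y : 0 < Im sg ->
  is_derC (fun x => periodized_gauss sg x y) x (2 * PI * Ci * (sg * x - y) * periodized_gauss sg
    x y + 2 * PI * Ci * sg * (gauss_factor sg x y * gauss_theta 1 sg x y))%C.
Proof.
intro H. unfold periodized_gauss, gauss_theta, gauss_factor. eapply is_derive_Ceq. cder.
  now apply Re_PiI_neg.
simpl (0 + _)%nat. ring.
Qed.

Lemma is_derive_periodized_gauss_y sg x y : 0 < Im sg ->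
  is_derC (fun y => periodized_gauss sg x y) y (- (2 * PI * Ci * x) * periodized_gauss sg x y -
    2 * PI * Ci * (gauss_factor sg x y * gauss_theta 1 sg x y))%C.
Proof.
intro H. unfold periodized_gauss, gauss_theta, gauss_factor. eapply is_derive_Ceq. cder.
  now apply Re_PiI_neg.
simpl (0 + _)%nat. ring.
Qed.

Definition gauss_transform (sg : C) (y : R) : C := RIntC (fun x => periodized_gauss sg x y) 0 1.

Lemma continuous_periodized_gauss sg x y : 0 < Im sg ->
  continuous (fun x => periodized_gauss sg x y) x.
Proof. intro H. eapply is_derC_continuous. now apply is_derive_periodized_gauss_x. Qed.

Lemma is_RInt_periodized_gauss sg y : 0 < Im sg -> is_RIntC (fun x => periodized_gauss sg x y) 0
  1 (gauss_transform sg y).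
Proof. intro H. apply ex_RIntC_cont. intro x. now apply continuous_periodized_gauss. Qed.

(** The derivative of the integrand in [y] is a multiple of its derivative in
    [x], which integrates to 0 over a period, plus a multiple of the
    integrand. *)
Lemma is_derive_gauss_transform sg y : 0 < Im sg -> is_derC (gauss_transform sg) y (- (2 * PI *
  Ci * y / sg) * gauss_transform sg y)%C.
Proof.
intro H. assert (N := Cnz_of_Im _ H).
set (f' := fun y x => (- (2 * PI * Ci * RtoC x) * periodized_gauss sg x y - 2 * PI * Ci *
  (gauss_factor sg x y * gauss_theta 1 sg x y))%C).
eapply is_derive_Ceq.
- apply (is_derive_RInt_param_C (fun y x => periodized_gauss sg x y) f' 0 1 y Rle_0_1).
  + apply filter_forall. intros s t _. now apply is_derive_periodized_gauss_y.
  + intros t _. apply filter_forall. intros p. now apply is_derive_periodized_gauss_y.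
  + intros t _. unfold f', periodized_gauss, gauss_factor, gauss_theta. ccont;
      now apply Re_PiI_neg.
  + apply filter_forall. intros s t _. now apply continuous_periodized_gauss.
- apply RIntC_unique.
  assert (I1 : is_RIntC (fun x => 2 * PI * Ci * (sg * x - y) * periodized_gauss sg x y + 2 * PI
    * Ci * sg * (gauss_factor sg x y * gauss_theta 1 sg x y))%C 0 1 0%C).
  { replace (RtoC 0) with (periodized_gauss sg 1 y - periodized_gauss sg 0 y)%C.
      2:{ replace 1 with (0 + 1) by ring. rewrite periodized_gauss_period by auto. ring. }
    apply (is_RIntC_derive (fun x => periodized_gauss sg x y)). lra. intros x _;
      now apply is_derive_periodized_gauss_x.
    intros x _. unfold periodized_gauss, gauss_factor, gauss_theta. ccont; now apply Re_PiI_neg. }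
  assert (I2 := is_RIntC_minus _ _ _ _ _ _ (is_RIntC_scal (- / sg) _ _ _ _ I1) (is_RIntC_scal (2
    * PI * Ci * y / sg) _ _ _ _ (is_RInt_periodized_gauss sg y H))).
  replace (- / sg * 0 - 2 * PI * Ci * y / sg * gauss_transform sg y)%C with (- (2 * PI * Ci * y
    / sg) * gauss_transform sg y)%C in I2 by (field; auto).
  revert I2. apply is_RIntC_ext. intro x. unfold f'. field. auto.
Qed.

(** The linear differential equation of [is_derive_gauss_transform] is solved
    by a Gaussian. For integral [y] this gives the Fourier coefficients of the
    periodized Gaussian. *)
Lemma gauss_transform_eq sg (y : R) : 0 < Im sg -> gauss_transform sg y = (gauss_transform sg 0
  * Cexp (- (PI * Ci * y * y / sg)))%C.
Proof.
intro H. assert (N := Cnz_of_Im _ H).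
set (u := fun y : R => (gauss_transform sg y * Cexp (PI * Ci * y * y / sg))%C).
assert (Du : forall y, is_derC u y 0).
{ intro z. unfold u, Cdiv. assert (K := is_derive_gauss_transform sg z H). eapply is_derive_Ceq.
    cder. field. auto. }
assert (E : u y = u 0).
{ destruct (Rle_dec 0 y). symmetry. apply is_derC_zero_eq; auto. apply is_derC_zero_eq; auto.
    lra. }
unfold u in E. replace (PI * Ci * 0 * 0 / sg)%C with (RtoC 0) in E by (field; auto).
  rewrite Cexp_0, Cmult_1_r in E.
rewrite <- E, <- Cmult_assoc, <- Cexp_plus.
replace (PI * Ci * y * y / sg + - (PI * Ci * y * y / sg))%C with (RtoC 0) by ring.
  rewrite Cexp_0. ring.
Qed.

(** Poisson summation: the periodized Gaussian of modulus [sg] and the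
    multiple by [gauss_transform sg 0] of the Gaussian sum of modulus [tau = -
    1 / sg] have the same Fourier coefficients. The points [x = 0] and [x = 1
    / 2] give the two formulas. *)
Lemma theta_inversion_fourier sg tau : 0 < Im sg -> 0 < Im tau -> (sg * tau = - (1))%C ->
  theta3 sg = (gauss_transform sg 0 * theta3 tau)%C /\ theta2 sg = (gauss_transform sg 0 *
    theta4 tau)%C.
Proof.
intros Hs Ht E. assert (N := Cnz_of_Im _ Hs).
assert (Et : tau = (- / sg)%C). { replace tau with (sg * tau * / sg)%C by (field; auto).
  rewrite E. ring. }
set (h := fun x : R => (periodized_gauss sg x 0 - gauss_transform sg 0 * theta_sum 0 (PI * Ci *
  tau) (2 * PI * Ci * x))%C).
assert (HR := Re_PiI_neg tau Ht).
assert (Z : forall x0, 0 <= x0 <= 1 -> h x0 = 0).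
{ apply fourier_unique.
  - intro x. unfold h, periodized_gauss, gauss_factor, gauss_theta. ccont; now apply Re_PiI_neg.
  - intro x. unfold h. rewrite periodized_gauss_period by auto.
    replace (2 * PI * Ci * RtoC (x + 1))%C with (2 * PI * Ci * x + 2 * PI * Ci * RtoC (IZR 1))%C
      by (rewrite RtoC_plus; ring).
    rewrite theta_sum_period. reflexivity.
  - intro m.
    assert (I1 : is_RIntC (fun x => periodized_gauss sg x 0 * fourier_char m x)%C 0 1
      (gauss_transform sg (IZR (- m)))).
    { generalize (is_RInt_periodized_gauss sg (IZR (- m)) Hs). apply is_RIntC_ext. intro x.
        unfold periodized_gauss, gauss_factor, gauss_theta, fourier_char.
      replace (2 * PI * Ci * (sg * x - IZR (- m)))%C with (2 * PI * Ci * (sg * x - 0) + 2 * PI *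
        Ci * RtoC (IZR m))%C by (rewrite opp_IZR, RtoC_opp; ring).
      rewrite theta_sum_period. rewrite (Cmult_comm (_ * _) (Cexp (2 * PI * Ci * IZR m * x))),
        Cmult_assoc, <- Cexp_plus. f_equal. f_equal.
      rewrite opp_IZR, RtoC_opp. ring. }
    assert (I2 := is_RIntC_minus _ _ _ _ _ _ I1 (is_RIntC_scal (gauss_transform sg 0) _ _ _ _
      (fourier_theta_sum _ m HR))).
    rewrite (gauss_transform_eq sg (IZR (- m))) in I2 by auto.
    replace (- (PI * Ci * IZR (- m) * IZR (- m) / sg))%C with (PI * Ci * tau * (IZR m ^ 2)%R)%C
      in I2.
    2:{ rewrite Et, opp_IZR, RtoC_opp, RtoC_pow. field. auto. }
    replace (gauss_transform sg 0 * Cexp (PI * Ci * tau * (IZR m ^ 2)%R) - gauss_transform sg 0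
      * Cexp (PI * Ci * tau * (IZR m ^ 2)%R))%C with (RtoC 0) in I2 by ring.
    revert I2. apply is_RIntC_ext. intro x. unfold h. ring. }
split.
- assert (Z0 := Z 0 ltac:(lra)). unfold h, periodized_gauss, gauss_factor, gauss_theta in Z0.
    rewrite !theta3_theta_sum.
  replace (PI * Ci * sg * 0 * 0 - 2 * PI * Ci * 0 * 0)%C with (RtoC 0) in Z0 by ring.
    rewrite Cexp_0 in Z0.
  replace (2 * PI * Ci * (sg * 0 - 0))%C with (RtoC 0) in Z0 by ring.
    replace (2 * PI * Ci * 0)%C with (RtoC 0) in Z0 by ring.
  set (a := theta_sum 0 (PI * Ci * sg) 0) in *. replace a with (1 * a - gauss_transform sg 0 *
    theta_sum 0 (PI * Ci * tau) 0 + gauss_transform sg 0 * theta_sum 0 (PI * Ci * tau) 0)%C by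
    ring. rewrite Z0. ring.
- assert (Z0 := Z (/2) ltac:(lra)). unfold h, periodized_gauss, gauss_factor, gauss_theta in Z0.
    rewrite theta2_theta_sum, theta4_theta_sum by auto.
  rewrite RtoC_inv in Z0 by lra.
  replace (PI * Ci * sg * / 2 * / 2 - 2 * PI * Ci * 0 * / 2)%C with (PI * Ci * sg / 4)%C in Z0
    by field.
  replace (2 * PI * Ci * (sg * / 2 - 0))%C with (PI * Ci * sg)%C in Z0 by field.
  replace (2 * PI * Ci * / 2)%C with (PI * Ci)%C in Z0 by field.
  set (a := (Cexp _ * _)%C) in *. replace a with (a - gauss_transform sg 0 * theta_sum 0 (PI *
    Ci * tau) (PI * Ci) + gauss_transform sg 0 * theta_sum 0 (PI * Ci * tau) (PI * Ci))%C by
    ring. rewrite Z0. ring.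
Qed.

Definition segm (a b : C) (s : R) : C := (a + s * (b - a))%C.

Lemma Im_segm a b s : Im (segm a b s) = (1 - s) * Im a + s * Im b.
Proof. unfold segm, Im; simpl. ring. Qed.

Lemma segm_H a b s : 0 < Im a -> 0 < Im b -> 0 <= s <= 1 -> 0 < Im (segm a b s).
Proof. intros Ha Hb Hs. rewrite Im_segm. destruct (Rle_dec s (1/2)); nra. Qed.

Lemma is_derC_segm a b s : is_derC (segm a b) s (b - a)%C.
Proof. unfold segm. eapply is_derive_Ceq. cder. ring. Qed.

Lemma continuous_segm a b s : continuous (segm a b) s.
Proof. eapply is_derC_continuous. apply is_derC_segm. Qed.

Lemma Im_pos_locally {U : UniformSpace} (f : U -> C) x : continuous f x -> 0 < Im (f x) ->
  locally x (fun y => 0 < Im (f y)).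
Proof.
intros Hc H. apply continuous_Im in Hc.
apply (Hc (fun r => 0 < r)). exact (open_gt 0 _ H).
Qed.

(** The sum over [n] of [(n + x) exp (pi i sg (n + x)^2)] is periodic, so its
    derivative in [x] integrates to 0; this expresses the second moment that
    comes from differentiating in [sg] by the integral itself. *)
Lemma is_derive_gauss_transform_modulus a b s : 0 < Im a -> 0 < Im b -> 0 <= s <= 1 ->
  is_derC (fun s => gauss_transform (segm a b s) 0) s (- ((b - a) / (2 * segm a b s))
    * gauss_transform (segm a b s) 0)%C.
Proof.
intros Ha Hb Hs. assert (H := segm_H a b s Ha Hb Hs).
set (sg := segm a b s) in *. assert (N := Cnz_of_Im _ H).
set (dH := fun s x : R => ((b - a) * (PI * Ci * (Cexp (PI * Ci * segm a b s * x * x - 2 * PI *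
  Ci * 0 * x) *
   (x * x * gauss_theta 0 (segm a b s) x 0 + 2 * x * gauss_theta 1 (segm a b s) x 0 +
     gauss_theta 2 (segm a b s) x 0))))%C).
assert (DD : forall s x, 0 < Im (segm a b s) -> is_derC (fun s => periodized_gauss (segm a b s)
  x 0) s (dH s x)).
{ intros s' x Hs'. unfold periodized_gauss, gauss_factor, gauss_theta.
    assert (K := is_derC_segm a b s'). eapply is_derive_Ceq. cder. now apply Re_PiI_neg.
  simpl (0 + _)%nat. unfold dH, gauss_theta. ring. }
assert (L := Im_pos_locally (segm a b) s (continuous_segm a b s) H).
assert (CS : forall t : R, continuous (fun p : R * R => segm a b (fst p)) (s, t)).
{ intro t. apply (continuous_comp (fun p : R * R => fst p) (segm a b)). apply continuous_fst.
    apply continuous_segm. }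
eapply is_derive_Ceq.
- apply (is_derive_RInt_param_C (fun s x => periodized_gauss (segm a b s) x 0) dH 0 1 s Rle_0_1).
  + apply filter_imp with (2 := L). intros s' Hs' t _. now apply DD.
  + intros t _. assert (L' := Im_pos_locally (fun p : R * R => segm a b (fst p)) (s, t) (CS t) H).
    apply filter_imp with (2 := L'). intros p Hp. now apply DD.
  + intros t _. unfold dH, gauss_theta. ccont; try apply CS; now apply Re_PiI_neg.
  + apply filter_imp with (2 := L). intros s' Hs' t _. now apply continuous_periodized_gauss.
- apply RIntC_unique.
  set (K := fun x : R => (Cexp (PI * Ci * sg * x * x) * (x * theta_sum 0 (PI * Ci * sg) (2 * PI
    * Ci * sg * x) + theta_sum 1 (PI * Ci * sg) (2 * PI * Ci * sg * x)))%C).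
  set (dK := fun x : R => (periodized_gauss sg x 0 + 2 * PI * Ci * sg * (Cexp (PI * Ci * sg * x
    * x - 2 * PI * Ci * 0 * x) *
   (x * x * gauss_theta 0 sg x 0 + 2 * x * gauss_theta 1 sg x 0 + gauss_theta 2 sg x 0)))%C).
  assert (R := Re_PiI_neg sg H).
  assert (I1 : is_RIntC dK 0 1 0%C).
  { replace (RtoC 0) with (K 1 - K 0)%C.
    2:{ unfold K. replace (PI * Ci * sg * 1 * 1)%C with (PI * Ci * sg)%C by ring.
        replace (2 * PI * Ci * sg * 1)%C with (0 + 2 * (PI * Ci * sg))%C by ring.
          rewrite theta_sum_shift0, theta_sum_shift1 by auto.
        replace (PI * Ci * sg * 0 * 0)%C with (RtoC 0) by ring.
          replace (2 * PI * Ci * sg * 0)%C with (RtoC 0) by ring.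
        replace (- (PI * Ci * sg + 0))%C with (- (PI * Ci * sg))%C by ring. rewrite Cexp_opp,
          Cexp_0. field. apply Cexp_neq_0. }
    apply (is_RIntC_derive K dK 0 1 Rle_0_1); intros x _.
    - unfold K. eapply is_derive_Ceq. cder; auto. simpl (0 + _)%nat; simpl (1 + _)%nat.
        unfold dK, periodized_gauss, gauss_factor, gauss_theta.
      replace (PI * Ci * sg * x * x - 2 * PI * Ci * 0 * x)%C with (PI * Ci * sg * x * x)%C by
        ring.
      replace (2 * PI * Ci * (sg * x - 0))%C with (2 * PI * Ci * sg * x)%C by ring. ring.
    - unfold dK, periodized_gauss, gauss_factor, gauss_theta. ccont; auto. }
  assert (I2 := is_RIntC_scal ((b - a) / (2 * sg)) _ _ _ _ (is_RIntC_minus _ _ _ _ _ _ I1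
    (is_RInt_periodized_gauss sg 0 H))).
  replace ((b - a) / (2 * sg) * (0 - gauss_transform sg 0))%C with (- ((b - a) / (2 * sg))
    * gauss_transform sg 0)%C in I2 by ring.
  revert I2. apply is_RIntC_ext. intro x. unfold dK, dH. fold sg. field. auto.
Qed.

Lemma theta3_Ci_neq_0 : theta3 Ci <> 0%C.
Proof.
intro E. apply (f_equal Re) in E. unfold theta3, CSeriesZ, CSeries in E. simpl in E.
assert (T : forall n : Z, nome_pow Ci (IZR n ^ 2) = RtoC (exp (- PI * IZR n ^ 2))).
{ intro n. unfold nome_pow. replace (PI * Ci * Ci * (IZR n ^ 2)%R)%C with (RtoC (- PI * IZR n ^
    2)).
  unfold Cexp; simpl. rewrite cos_0, sin_0. unfold RtoC; f_equal; ring.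
  unfold RtoC, Ci, Cmult; simpl. f_equal; ring. }
assert (SZ : summableZ (fun n => exp (- PI * IZR n ^ 2))).
{ assert (K := gauss_maj_summable 0 PI 0 PI_RGT_0 ltac:(lra)). destruct K as [K1 K2].
  split; [revert K1|revert K2]; apply ex_series_ext; intro n; unfold gauss_maj; simpl (_ ^ 0);
    rewrite Rmult_1_l; f_equal; ring. }
destruct SZ as [E1 E2].
assert (P1 : 1 <= Series (fun n => Re (nome_pow Ci (IZR (Z.of_nat n) ^ 2)))).
{ rewrite (Series_ext _ (fun n => exp (- PI * IZR (Z.of_nat n) ^ 2))) by (intro n; rewrite T;
    reflexivity).
  rewrite Series_incr_1 by auto.
  replace (exp (- PI * IZR (Z.of_nat 0) ^ 2)) with 1 by (rewrite <- exp_0; f_equal; simpl; ring).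
  assert (0 <= Series (fun k => exp (- PI * IZR (Z.of_nat (S k)) ^ 2))).
  { rewrite <- (Rmult_0_l (Series (fun k => exp (- PI * IZR (Z.of_nat (S k)) ^ 2)))),
      <- Series_scal_l.
    apply Series_le. intro n; rewrite Rmult_0_l; split; [lra|left; apply exp_pos].
      now apply ex_series_incr_1 in E1. }
  lra. }
assert (P2 : 0 <= Series (fun n => Re (nome_pow Ci (IZR (- Z.of_nat (S n)) ^ 2)))).
{ rewrite (Series_ext _ (fun n => exp (- PI * IZR (- Z.of_nat (S n)) ^ 2))) by (intro n;
    rewrite T; reflexivity).
  rewrite <- (Rmult_0_l (Series (fun k => exp (- PI * IZR (- Z.of_nat (S k)) ^ 2)))),
    <- Series_scal_l.
    apply Series_le; auto. intro n; rewrite Rmult_0_l; split; [lra|left; apply exp_pos]. }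
simpl in P1, P2. lra.
Qed.

(** The left-hand side has zero derivative along the segment from [Ci] to
    [sg]. At [Ci], a fixed point of the inversion, the transform is 1 because
    [theta3 Ci] is not 0. *)
Lemma gauss_transform_sqr sg : 0 < Im sg -> (gauss_transform sg 0 * gauss_transform sg 0 * sg =
  Ci)%C.
Proof.
intro H. assert (Hi : 0 < Im Ci) by (simpl; lra).
set (u := fun s => (gauss_transform (segm Ci sg s) 0 * gauss_transform (segm Ci sg s) 0 * segm
  Ci sg s)%C).
assert (E : u 0 = u 1).
{ apply is_derC_zero_eq. lra. intros s Hs. unfold u. assert (K :=
    is_derive_gauss_transform_modulus Ci sg s Hi H Hs). assert (K' := is_derC_segm Ci sg s).
  assert (N := Cnz_of_Im _ (segm_H Ci sg s Hi H Hs)).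
  eapply is_derive_Ceq. cder. field. auto. }
unfold u in E. replace (segm Ci sg 0) with Ci in E by (unfold segm; ring).
  replace (segm Ci sg 1) with sg in E by (unfold segm; ring).
rewrite <- E.
assert (D1 : gauss_transform Ci 0 = 1%C).
{ destruct (theta_inversion_fourier Ci Ci Hi Hi) as [T _]. apply injective_projections; simpl;
    ring.
  assert (N := theta3_Ci_neq_0). replace (gauss_transform Ci 0) with (gauss_transform Ci 0 *
    theta3 Ci / theta3 Ci)%C by (field; auto). rewrite <- T. field. auto. }
rewrite D1. ring.
Qed.

(** * Primitives in the upper half-plane *)

(** Holomorphy is used only through the chain rule along real paths in the
    upper half-plane, together with the continuity that differentiation under
    the integral sign requires. *)
Definition derivable_H (F F' : C -> C) : Prop :=
  (forall (g : R -> C) s v, is_derC g s v -> 0 < Im (g s) -> is_derC (fun t => F (g t))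
    s (F' (g s) * v)%C) /\
  (forall z : C, 0 < Im z -> continuous F z) /\ (forall z : C, 0 < Im z -> continuous F' z).

Lemma derivable_H_ext F F1 F' : (forall z, 0 < Im z -> F z = F1 z) -> derivable_H F1 F' ->
  derivable_H F F'.
Proof.
intros E [H1 [H2 H3]]. split; [|split]; auto.
- intros g s v Hg Hs. apply (is_derive_ext_loc (V := C_R_NormedModule) (fun t => F1 (g t))).
  + assert (L := Im_pos_locally g s (is_derC_continuous _ _ _ Hg) Hs).
      apply filter_imp with (2 := L). intros t Ht. symmetry; auto.
  + now apply H1.
- intros z Hz. apply (continuous_ext_loc (T := C_UniformSpace) (U := C_UniformSpace) F F1 z);
    auto.
  assert (L := Im_pos_locally (fun t : C => t) z (continuous_id z) Hz).
    apply filter_imp with (2 := L). intros t Ht. symmetry; auto.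
Qed.

Lemma derivable_H_mult F F' K K' : derivable_H F F' -> derivable_H K K' ->
  derivable_H (fun z => F z * K z)%C (fun z => F' z * K z + F z * K' z)%C.
Proof.
intros [H1 [H2 H3]] [L1 [L2 L3]]. split; [|split].
- intros g s v Hg Hs. eapply is_derive_Ceq. apply is_derive_Cmult; [apply H1|apply L1];
    eassumption. cbv beta; ring.
- intros z Hz. apply continuous_Cmult; auto.
- intros z Hz. apply continuous_Cplus; apply continuous_Cmult; auto.
Qed.

Definition holomorphic_H F := exists F', derivable_H F F'.

Lemma holomorphic_mult F K : holomorphic_H F -> holomorphic_H K ->
  holomorphic_H (fun z => F z * K z)%C.
Proof. intros [F' HF] [K' HK]. exact (ex_intro _ _ (derivable_H_mult _ _ _ _ HF HK)). Qed.

Lemma holomorphic_id : holomorphic_H (fun z => z).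
Proof.
exists (fun _ => 1%C). split; [|split].
- intros g s v Hg _. eapply is_derive_Ceq. exact Hg. cbv beta; ring.
- intros z _. apply continuous_id.
- intros z _. apply continuous_const.
Qed.

Lemma holomorphic_const c : holomorphic_H (fun z => c).
Proof.
exists (fun _ => 0%C). split; [|split].
- intros g s v Hg _. eapply is_derive_Ceq. apply is_derive_Cconst. cbv beta; ring.
- intros z _. apply continuous_const.
- intros z _. apply continuous_const.
Qed.

Lemma holomorphic_pow F n : holomorphic_H F -> holomorphic_H (fun z => F z ^ n)%C.
Proof.
intro H. induction n as [|n IH]. apply (holomorphic_const 1). simpl. now apply holomorphic_mult.
Qed.

Lemma holomorphic_theta3 : holomorphic_H theta3.
Proof.
exists (fun z => PI * Ci * theta_sum 2 (PI * Ci * z) 0)%C.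
apply derivable_H_ext with (fun z => theta_sum 0 (PI * Ci * z) 0). intros z _;
  apply theta3_theta_sum.
split; [|split].
- intros g s v Hg Hs. eapply is_derive_Ceq. cder. now apply Re_PiI_neg. simpl (0 + _)%nat.
    cbv beta; ring.
- intros z Hz. ccont. now apply Re_PiI_neg.
- intros z Hz. ccont. now apply Re_PiI_neg.
Qed.

Lemma holomorphic_theta4 : holomorphic_H theta4.
Proof.
exists (fun z => PI * Ci * theta_sum 2 (PI * Ci * z) (PI * Ci))%C.
apply derivable_H_ext with (fun z => theta_sum 0 (PI * Ci * z) (PI * Ci)). intros z _;
  apply theta4_theta_sum.
split; [|split].
- intros g s v Hg Hs. eapply is_derive_Ceq. cder. now apply Re_PiI_neg. simpl (0 + _)%nat.
    cbv beta; ring.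
- intros z Hz. ccont. now apply Re_PiI_neg.
- intros z Hz. ccont. now apply Re_PiI_neg.
Qed.

Lemma holomorphic_theta2 : holomorphic_H theta2.
Proof.
exists (fun z => PI * Ci * Cexp (PI * Ci * z * / 4) * (/ 4 * theta_sum 0 (PI * Ci * z) (PI * Ci
  * z) + theta_sum 2 (PI * Ci * z) (PI * Ci * z) + theta_sum 1 (PI * Ci * z) (PI * Ci * z)))%C.
apply derivable_H_ext with (fun z => Cexp (PI * Ci * z * / 4) * theta_sum 0 (PI * Ci * z) (PI *
  Ci * z))%C. apply theta2_theta_sum.
split; [|split].
- intros g s v Hg Hs. eapply is_derive_Ceq. cder. now apply Re_PiI_neg. simpl (0 + _)%nat.
    cbv beta; ring.
- intros z Hz. ccont; now apply Re_PiI_neg.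
- intros z Hz. ccont; now apply Re_PiI_neg.
Qed.

(** A primitive in the sense of the chain rule along continuously
    differentiable paths in the upper half-plane. *)
Definition primitive_H (F P : C -> C) : Prop := forall (g g' : R -> C) s,
  locally s (fun t => is_derC g t (g' t)) -> continuous g' s -> 0 < Im (g s) ->
  is_derC (fun t => P (g t)) s (F (g s) * g' s)%C.

(** The integral of [F] along the segment from [Ci] to [z]; the upper
    half-plane is convex. *)
Definition segment_primitive (F : C -> C) (z : C) : C := ((z - Ci) * RIntC (fun t => F (segm Ci
  z t)) 0 1)%C.

(** With [f t = F (segm Ci z t)], the derivative in [z] of [(z - Ci) * f t] is
    the derivative of [t * f t] in [t], and so it integrates to [F z]. *)
Lemma segment_primitive_correct F : holomorphic_H F -> primitive_H F (segment_primitive F).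
Proof.
intros [F' [H1 [H2 H3]]] g g' s Hg Cg' Hs. unfold segment_primitive.
assert (Hi : 0 < Im Ci) by (simpl; lra).
assert (Dg : is_derC g s (g' s)) by (apply (locally_singleton _ _ Hg)).
assert (Cg := is_derC_continuous _ _ _ Dg).
set (f' := fun u t : R => (F' (segm Ci (g u) t) * (t * g' u))%C).
assert (DF : forall u t, is_derC g u (g' u) -> 0 < Im (segm Ci (g u) t) ->
  is_derC (fun u => F (segm Ci (g u) t)) u (f' u t)).
{ intros u t Hu Hp. eapply is_derive_Ceq.
  apply (H1 (fun u => segm Ci (g u) t)); auto. unfold segm. cder. unfold f'. cbv beta; ring. }
assert (CSg : forall t, continuous (fun p : R * R => segm Ci (g (fst p)) (snd p)) (s, t)).
{ intro t. unfold segm. ccont. apply (continuous_comp (fun p : R * R => fst p) g).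
    apply continuous_fst. exact Cg. }
assert (CF : forall u t, 0 < Im (g u) -> 0 <= t <= 1 ->
  continuous (fun t => F (segm Ci (g u) t)) t).
{ intros u t Hu Ht. apply (continuous_comp (segm Ci (g u)) F). apply continuous_segm. apply H2.
    now apply segm_H. }
assert (LH := Im_pos_locally g s Cg Hs).
assert (K : is_derC (fun u => RIntC (fun t => F (segm Ci (g u) t)) 0 1) s (RIntC (f' s) 0 1)).
{ apply (is_derive_RInt_param_C (fun u t => F (segm Ci (g u) t)) f' 0 1 s Rle_0_1).
  - assert (L := filter_and _ _ Hg LH). apply filter_imp with (2 := L). intros u [Hu1 Hu2] t Ht.
      apply DF; auto. now apply segm_H.
  - intros t Ht. assert (L1 := Im_pos_locally _ _ (CSg t) (segm_H Ci (g s) t Hi Hs Ht)).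
    assert (L2 : locally ((s, t) : R * R) (fun p : R * R => is_derC g (fst p) (g' (fst p)))) by
      exact (continuous_fst (U := R_UniformSpace) (V := R_UniformSpace) s t _ Hg).
    assert (L := filter_and _ _ L1 L2). apply filter_imp with (2 := L). intros p [Hp1 Hp2].
      now apply DF.
  - intros t Ht. unfold f'. apply continuous_Cmult.
    + apply (continuous_comp (fun p : R * R => segm Ci (g (fst p)) (snd p)) F'). apply CSg.
        apply H3. now apply segm_H.
    + ccont. apply (continuous_comp (fun p : R * R => fst p) g'). apply continuous_fst. exact Cg'.
  - apply filter_imp with (2 := LH). intros u Hu t Ht. now apply CF. }
eapply is_derive_Ceq. apply is_derive_Cmult. cder. exact K. cbv beta.
set (z := g s) in *.
assert (RC : forall h : R -> C, (forall t, 0 <= t <= 1 -> continuous h t) ->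
  is_RIntC h 0 1 (RIntC h 0 1)).
{ intros h Hh. apply (RInt_correct (V := C_R_CompleteNormedModule)),
    (ex_RInt_continuous (V := C_R_CompleteNormedModule)).
  rewrite Rmin_left, Rmax_right by lra. auto. }
assert (I1 := RC (fun t => F (segm Ci z t)) (fun t Ht => CF s t Hs Ht)).
assert (CF' : forall t, 0 <= t <= 1 -> continuous (fun t => F' (segm Ci z t)) t).
{ intros t Ht. apply (continuous_comp (segm Ci z) F'). apply continuous_segm. apply H3.
    now apply segm_H. }
assert (I2 : is_RIntC (f' s) 0 1 (RIntC (f' s) 0 1)).
{ apply RC. intros t Ht. unfold f'. apply continuous_Cmult. now apply CF'. ccont. }
assert (I3 : is_RIntC (fun t : R => F (segm Ci z t) + t * (F' (segm Ci z t) * (z - Ci)))%C 0 1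
  (1 * F (segm Ci z 1) - 0 * F (segm Ci z 0))%C).
{ apply (is_RIntC_derive (fun t : R => t * F (segm Ci z t))%C). lra.
  - intros t Ht. eapply is_derive_Ceq. apply is_derive_Cmult. apply is_derC_id. apply H1.
      apply is_derC_segm. now apply segm_H. cbv beta; ring.
  - intros t Ht. ccont. apply (CF s t Hs Ht). now apply CF'. }
assert (I4 : is_RIntC (fun t : R => g' s * (F (segm Ci z t) + t * (F' (segm Ci z t) * (z -
  Ci))))%C 0 1 (g' s * RIntC (fun t => F (segm Ci z t)) 0 1 + (z - Ci) * RIntC (f' s) 0 1)%C).
{ generalize (is_RIntC_plus _ _ _ _ _ _ (is_RIntC_scal (g' s) _ _ _ _ I1) (is_RIntC_scal (z -
    Ci) _ _ _ _ I2)). apply is_RIntC_ext.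
  intro t. unfold f'. fold z. cbv beta; ring. }
assert (I5 := is_RIntC_scal (g' s) _ _ _ _ I3).
apply RIntC_unique in I4. apply RIntC_unique in I5. rewrite I5 in I4.
replace (segm Ci z 1) with z in I4 by (unfold segm; ring).
transitivity (g' s * RIntC (fun t : R => F (segm Ci z t)) 0 1 + (z - Ci) * RIntC (f' s) 0 1)%C.
ring. rewrite <- I4. cbv beta; ring.
Qed.

Definition vert (x y : R) : C := (x + Ci * y)%C.

Lemma Im_vert x y : Im (vert x y) = y. Proof. unfold vert, Im; simpl; ring. Qed.

Lemma Re_vert x y : Re (vert x y) = x. Proof. unfold vert, Re; simpl; ring. Qed.

Lemma primitive_vert F P x y : primitive_H F P -> 0 < y -> is_derC (fun y => P (vert x y))
  y (F (vert x y) * Ci)%C.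
Proof.
intros HP Hy. apply (HP (vert x) (fun _ => Ci)).
apply filter_forall. intro t. unfold vert. eapply is_derive_Ceq. cder. ring.
  apply continuous_const. now rewrite Im_vert.
Qed.

Lemma primitive_segm F P a b s : primitive_H F P -> 0 < Im a -> 0 < Im b -> 0 <= s <= 1 ->
  is_derC (fun s => P (segm a b s)) s (F (segm a b s) * (b - a))%C.
Proof.
intros HP Ha Hb Hs. apply (HP (segm a b) (fun _ => b - a)%C).
apply filter_forall. intro t. apply is_derC_segm. apply continuous_const. now apply segm_H.
Qed.

(** Any integrable rate would serve. The strip contains the vertical lines
    through all points where primitives are compared. *)
Definition quad_decay (F : C -> C) := exists B, 0 <= B /\ forall z, -1 <= Re z <= 1 ->
  1 <= Im z -> Cmod (F z) <= B / (Im z) ^ 2.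

Definition limit_at_top (P : C -> C) (x : R) (l : C) : Prop := filterlim (fun y => P (vert x y))
  (Rbar_locally p_infty) (locally l).

Lemma limit_at_top_eps P x l : limit_at_top P x l <-> (forall eps, 0 < eps -> exists Y,
  forall y, Y < y -> Cmod (P (vert x y) - l) < eps).
Proof.
split.
- intros H eps He.
  assert (K := proj1 (filterlim_locally_ball_norm (K := R_AbsRing) (U := C_R_NormedModule) _ l)
    H (mkposreal eps He)).
  destruct K as [Y HY]. exists Y. intros y Hy. specialize (HY y Hy). unfold ball_norm in HY.
    rewrite Cmod_norm_R in HY. exact HY.
- intro H. apply (proj2 (filterlim_locally_ball_norm (K := R_AbsRing) (U := C_R_NormedModule) _
    l)). intros [eps He].
  destruct (H eps He) as [Y HY]. exists Y. intros y Hy. unfold ball_norm. rewrite Cmod_norm_R.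
    now apply HY.
Qed.

Lemma quad_decay_increment F P : holomorphic_H F -> primitive_H F P -> forall B, (forall z,
  -1 <= Re z <= 1 -> 1 <= Im z -> Cmod (F z) <= B / (Im z) ^ 2) ->
  forall y1 y2, 1 <= y1 -> y1 <= y2 -> Cmod (P (vert 0 y2) - P (vert 0 y1)) <= B / y1 - B / y2.
Proof.
intros [F' [_ [CF _]]] HP B HB y1 y2 H1 H2.
assert (Cv : forall y, continuous (vert 0) y). { intro y. unfold vert. ccont. }
assert (I : is_RIntC (fun y => F (vert 0 y) * Ci)%C y1 y2 (P (vert 0 y2) - P (vert 0 y1))%C).
{ apply (is_RIntC_derive (fun y => P (vert 0 y))); auto.
  - intros y Hy. apply primitive_vert; auto. lra.
  - intros y Hy. ccont. apply (continuous_comp (vert 0) F); auto. apply CF. rewrite Im_vert;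
      lra. }
assert (J : is_RInt (fun y => B / y ^ 2) y1 y2 (- B / y2 - - B / y1)).
{ apply (is_RInt_derive (V := R_CompleteNormedModule) (fun y => - B / y)); rewrite Rmin_left,
    Rmax_right by auto; intros y Hy.
  - auto_derive. lra. field. lra.
  - apply (ex_derive_continuous (V := R_NormedModule)). auto_derive. change (y ^ 2 <> 0).
      apply pow_nonzero; lra. }
replace (B / y1 - B / y2) with (- B / y2 - - B / y1) by (field; lra).
apply (is_RIntC_bound _ _ _ _ _ _ H2) with (2 := I) (3 := J).
intros y Hy. rewrite Cmod_mult, Cmod_Ci, Rmult_1_r.
assert (K := HB (vert 0 y)). rewrite Im_vert, Re_vert in K. apply K; lra.
Qed.

(** Along the imaginary axis [segment_primitive F] is Cauchy at infinity;
    subtracting its limit gives decay there, and decay on the other vertical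
    lines of the strip follows by integrating along horizontal segments. *)
Lemma decaying_primitive_exists F : holomorphic_H F -> quad_decay F -> exists P,
  primitive_H F P /\ forall x, -1 <= x <= 1 -> limit_at_top P x 0.
Proof.
intros HF [B [PB HB]]. assert (H0 := segment_primitive_correct F HF).
  assert (QV := quad_decay_increment F (segment_primitive F) HF H0 B HB).
assert (QD : forall y1 y2, 1 <= y1 -> 1 <= y2 -> Cmod (segment_primitive F (vert 0 y2) -
  segment_primitive F (vert 0 y1)) <= B / Rmin y1 y2).
{ assert (Pos : forall y, 1 <= y -> 0 <= B / y). { intros y Hy. apply Rmult_le_pos; auto. left;
    apply Rinv_0_lt_compat; lra. }
  intros y1 y2 L1 L2. unfold Rmin; destruct Rle_dec.
  - assert (K := QV y1 y2 L1 r). specialize (Pos y2 L2). lra.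
  - assert (K := QV y2 y1 L2 ltac:(lra)). specialize (Pos y1 L1).
    rewrite <- Cmod_opp. replace (- (segment_primitive F (vert 0 y2) - segment_primitive F (vert
      0 y1)))%C with (segment_primitive F (vert 0 y1) - segment_primitive F (vert 0 y2))%C by
      ring. lra. }
assert (E : exists l : C, limit_at_top (segment_primitive F) 0 l).
{ unfold limit_at_top.
  apply (proj1 (filterlim_locally_cauchy (U := C_R_CompleteNormedModule) (F := Rbar_locally
    p_infty) (fun y => segment_primitive F (vert 0 y)))).
  intros [eps He]. exists (fun y => Rmax 1 (B / eps) < y). split. now exists (Rmax 1 (B / eps)).
  intros u v Hu Hv. apply (norm_compat1 (V := C_R_NormedModule)). rewrite Cmod_norm_R. simpl.
  assert (A1 := Rmax_l 1 (B/eps)). assert (A2 := Rmax_r 1 (B/eps)).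
  eapply Rle_lt_trans. apply (QD u v); lra.
  assert (Rmax 1 (B / eps) < Rmin u v) by now apply Rmin_glb_lt.
  apply Rmult_lt_reg_r with (Rmin u v). lra. replace (B / Rmin u v * Rmin u v) with B by (field;
    lra).
  replace B with (B / eps * eps) by (field; lra). rewrite Rmult_comm. apply Rmult_lt_compat_l;
    lra. }
destruct E as [l Hl].
exists (fun z => segment_primitive F z - l)%C. split.
- intros g g' s A1 A2 A3. assert (K := H0 g g' s A1 A2 A3). eapply is_derive_Ceq.
    apply is_derive_Cminus. exact K. apply is_derive_Cconst. cbv beta; ring.
- intros x Hx. apply limit_at_top_eps. intros eps He.
  destruct (proj1 (limit_at_top_eps _ _ _) Hl (eps / 2) ltac:(lra)) as [Y HY].
  exists (Rmax Y (Rmax 1 (2 * B / eps))). intros y Hy.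
  assert (A1 := Rmax_l Y (Rmax 1 (2 * B / eps))). assert (A2 := Rmax_r Y (Rmax 1 (2 * B / eps))).
  assert (A3 := Rmax_l 1 (2 * B / eps)). assert (A4 := Rmax_r 1 (2 * B / eps)).
  assert (Hh : Cmod (segment_primitive F (vert x y) - segment_primitive F (vert 0 y))
    <= B / y ^ 2).
  { assert (Sg : forall s, segm (vert 0 y) (vert x y) s = vert (s * x) y).
    { intro s. unfold segm, vert. rewrite RtoC_mult. cbv beta; ring. }
    assert (Y0 : 0 < Im (vert 0 y)) by (rewrite Im_vert; lra). assert (Yx : 0 < Im (vert x y))
      by (rewrite Im_vert; lra).
    destruct HF as [F' [_ [CF _]]].
    assert (I : is_RIntC (fun s => F (segm (vert 0 y) (vert x y) s) * (vert x y - vert 0 y))%C 0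
      1 (segment_primitive F (segm (vert 0 y) (vert x y) 1) - segment_primitive F (segm (vert 0
      y) (vert x y) 0))%C).
    { apply (is_RIntC_derive (fun s => segment_primitive F (segm (vert 0 y) (vert x y) s))). lra.
      intros s Hs. now apply primitive_segm.
      intros s Hs. ccont. apply (continuous_comp (segm (vert 0 y) (vert x y)) F).
        apply continuous_segm. apply CF. now apply segm_H. }
    rewrite !Sg, Rmult_1_l, Rmult_0_l in I.
    assert (J := is_RInt_const (V := R_NormedModule) 0 1 (B / y ^ 2)). unfold scal in J;
      simpl in J; unfold mult in J; simpl in J.
    rewrite Rminus_0_r, Rmult_1_l in J.
    apply (is_RIntC_bound _ _ _ _ _ _ Rle_0_1) with (2 := I) (3 := J). intros s Hs. rewrite Sg,
      Cmod_mult.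
    assert (K := HB (vert (s * x) y)). rewrite Re_vert, Im_vert in K.
      specialize (K ltac:(nra) ltac:(lra)).
    replace (vert x y - vert 0 y)%C with (RtoC x) by (unfold vert; ring). rewrite Cmod_R.
    assert (Rabs x <= 1) by (apply Rabs_le; lra). assert (Q := Rabs_pos x).
      assert (Q' := Cmod_ge_0 (F (vert (s * x) y))).
    simpl in K. nra. }
  replace (segment_primitive F (vert x y) - l - 0)%C with ((segment_primitive F (vert x y) -
    segment_primitive F (vert 0 y)) + (segment_primitive F (vert 0 y) - l))%C by ring.
  eapply Rle_lt_trans. apply Cmod_triangle. assert (K := HY y ltac:(lra)).
  assert (B / y ^ 2 <= eps / 2).
  { apply Rmult_le_reg_r with (y ^ 2). apply pow_lt; lra. replace (B / y ^ 2 * y ^ 2) with B by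
      (field; lra).
    replace B with (2 * B / eps * (eps / 2)) by (field; lra).
    rewrite Rmult_comm. apply Rmult_le_compat_l. lra. simpl. nra. }
  lra.
Qed.

(** The difference of two primitives is constant on a vertical line, and the
    constant is its limit. *)
Lemma decaying_primitive_unique F P Q x : primitive_H F P -> primitive_H F Q ->
  limit_at_top P x 0 -> limit_at_top Q x 0 -> forall y, 0 < y -> P (vert x y) = Q (vert x y).
Proof.
intros HP HQ LP LQ y Hy.
set (h := fun y => (P (vert x y) - Q (vert x y))%C).
assert (Hh : forall y', y <= y' -> h y' = h y).
{ intros y' Hy'. symmetry. apply is_derC_zero_eq; auto. intros t Ht. unfold h.
  eapply is_derive_Ceq. apply is_derive_Cminus; apply (primitive_vert F); auto; lra. cbv beta;
    ring. }
assert (Z : h y = 0).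
{ apply Cmod_eq_0. apply Rle_antisym; [|apply Cmod_ge_0]. apply le_epsilon. intros eps He.
    rewrite Rplus_0_l.
  destruct (proj1 (limit_at_top_eps _ _ _) LP (eps / 2) ltac:(lra)) as [Y1 HY1].
  destruct (proj1 (limit_at_top_eps _ _ _) LQ (eps / 2) ltac:(lra)) as [Y2 HY2].
  set (y' := Rmax y (Rmax Y1 Y2) + 1). assert (A1 := Rmax_l y (Rmax Y1 Y2)).
    assert (A2 := Rmax_r y (Rmax Y1 Y2)).
  assert (A3 := Rmax_l Y1 Y2). assert (A4 := Rmax_r Y1 Y2).
  rewrite <- (Hh y') by (unfold y'; lra). unfold h.
  specialize (HY1 y' ltac:(unfold y'; lra)). specialize (HY2 y' ltac:(unfold y'; lra)).
  replace (P (vert x y') - Q (vert x y'))%C with ((P (vert x y') - 0) - (Q (vert x y') - 0))%C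
    by ring.
  eapply Rle_trans. apply Cmod_triangle. rewrite Cmod_opp. lra. }
unfold h in Z. replace (P (vert x y)) with ((P (vert x y) - Q (vert x y)) + Q (vert x y))%C by
  ring. rewrite Z. cbv beta; ring.
Qed.

(** * Modular behaviour of the three products *)
Local Open Scope C_scope.

(** The formula for [theta4] is the one for [theta2] read at [sg] and [tau]
    exchanged, with its own factor [s']. The product [s * s'] is 1 or [-1],
    and it is 1 unless [theta3] vanishes at both points. In that case all
    three products [F1], [F2], [F3] vanish there too. *)
Lemma theta_inversion sg tau : (0 < Im sg)%R -> (0 < Im tau)%R -> sg * tau = - (1) ->
  exists s, s * s = - Ci * tau /\ theta3 sg = s * theta3 tau /\ theta2 sg = s * theta4 tau /\
   (theta4 sg = s * theta2 tau \/ (theta3 sg = 0 /\ theta3 tau = 0)).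
Proof.
intros Hs Ht E. assert (E' : tau * sg = - (1)) by (rewrite <- E; ring).
destruct (theta_inversion_fourier sg tau Hs Ht E) as [A3 A2].
destruct (theta_inversion_fourier tau sg Ht Hs E') as [B3 B2].
assert (S1 := gauss_transform_sqr sg Hs). assert (S2 := gauss_transform_sqr tau Ht).
set (s := gauss_transform sg 0) in *. set (s' := gauss_transform tau 0) in *.
exists s. split; [|split; [exact A3|split; [exact A2|]]].
- replace (s * s) with (- (s * s * (sg * tau))) by (rewrite E; ring).
  replace (s * s * (sg * tau)) with (s * s * sg * tau) by ring. rewrite S1. ring.
- assert (Q : (s * s' - 1) * (s * s' + 1) = 0).
  { replace ((s * s' - 1) * (s * s' + 1)) with (- ((s * s * (sg * tau)) * (s' * s')) - 1).
    2:{ rewrite E. ring. }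
    replace (s * s * (sg * tau) * (s' * s')) with ((s * s * sg) * (s' * s' * tau)) by ring.
      rewrite S1, S2.
    apply injective_projections; simpl; ring. }
  destruct (Ceq_dec (s * s' - 1) 0) as [Z|Z].
  + left. assert (Z' : s * s' = 1). { replace (s * s') with (s * s' - 1 + 1) by ring. rewrite Z;
      ring. }
    rewrite B2. rewrite Cmult_assoc, Z'. ring.
  + right. assert (Y : theta3 sg = 0).
    { assert (X : (s * s' - 1) * theta3 sg = 0).
      { replace ((s * s' - 1) * theta3 sg) with (s * (s' * theta3 sg) - theta3 sg) by ring.
          rewrite <- B3, <- A3. ring. }
      replace (theta3 sg) with (/ (s * s' - 1) * ((s * s' - 1) * theta3 sg)) by (field; auto).
        rewrite X. ring. }
    split; auto. rewrite B3, Y. ring.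
Qed.

Lemma Ci_sqr : Ci * Ci = - (1).
Proof. apply injective_projections; simpl; ring. Qed.

Lemma pow10_of_square (s t : C) : s * s = - Ci * t -> s ^ 10 = - Ci * t ^ 5.
Proof.
intro H. replace (s ^ 10) with ((s * s) ^ 5) by ring. rewrite H.
replace ((- Ci * t) ^ 5) with (- Ci * (Ci * Ci) * (Ci * Ci) * t ^ 5) by ring. rewrite Ci_sqr.
  ring.
Qed.

(** Each product has ten theta factors, which contribute [s ^ 10 = (- i tau) ^
    5]. *)
Lemma F_inversion sg tau : (0 < Im sg)%R -> (0 < Im tau)%R -> sg * tau = - (1) ->
  F1 sg = - Ci * tau ^ 5 * F1 tau /\ F2 sg = - Ci * tau ^ 5 * F3 tau /\ F3 sg = - Ci * tau ^ 5 *
    F2 tau.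
Proof.
intros Hs Ht E. destruct (theta_inversion sg tau Hs Ht E) as [s [S [A3 [A2 [A4|[Z1 Z2]]]]]].
- rewrite <- (pow10_of_square s tau S). unfold F1, F2, F3. rewrite A3, A2, A4. repeat split; ring.
- unfold F1, F2, F3. rewrite Z1, Z2. repeat split; ring.
Qed.

Definition zeta : C := Cexp (PI * Ci / 4).

Lemma theta_T tau : (0 < Im tau)%R -> theta2 (tau + 1) = zeta * theta2 tau /\ theta3 (tau + 1) =
  theta4 tau /\ theta4 (tau + 1) = theta3 tau.
Proof.
intro H. assert (H' : (0 < Im (tau + 1))%R) by (change (0 < Im tau + 0)%R; lra).
rewrite !theta2_theta_sum, !theta3_theta_sum, !theta4_theta_sum by auto.
replace (PI * Ci * (tau + 1)) with (PI * Ci * tau + PI * Ci) by ring.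
assert (P : forall be, theta_sum 0 (PI * Ci * tau) (be + PI * Ci + PI * Ci) = theta_sum 0 (PI *
  Ci * tau) be).
{ intro be. rewrite <- (theta_sum_period 0 (PI * Ci * tau) be 1). f_equal. ring. }
split; [|split].
- rewrite theta_sum_half_shift, P. unfold zeta. rewrite Cmult_assoc, <- Cexp_plus. f_equal.
    f_equal. field.
- rewrite theta_sum_half_shift. f_equal. ring.
- rewrite theta_sum_half_shift. replace (PI * Ci + PI * Ci) with (0 + PI * Ci + PI * Ci) by
    ring. apply P.
Qed.

Lemma zeta_sqr : zeta * zeta = Ci.
Proof.
unfold zeta. rewrite <- Cexp_plus. replace (PI * Ci / 4 + PI * Ci / 4) with ((0, (PI / 2)%R) : C).
unfold Cexp; simpl. rewrite exp_0, cos_PI2, sin_PI2. apply injective_projections; simpl; ring.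
apply injective_projections; simpl; field.
Qed.

Lemma zeta_sqrt2 : RtoC (sqrt 2) = zeta * (1 - Ci).
Proof.
unfold zeta. replace (PI * Ci / 4) with ((0, (PI / 4)%R) : C) by (apply injective_projections;
  simpl; field).
unfold Cexp; simpl. rewrite exp_0, cos_PI4, sin_PI4.
assert (Q : (sqrt 2 * sqrt 2 = 2)%R) by (apply sqrt_sqrt; lra). assert (N : sqrt 2 <> 0%R) by
  (intro Z; rewrite Z in Q; lra).
apply injective_projections; simpl; field_simplify; auto. rewrite <- Q at 2. field. auto. field.
  auto.
Qed.

(** The eighth powers of [theta2], [theta3] and [theta4] are permuted up to
    [zeta ^ 8 = 1]. *)
Lemma F_T tau : (0 < Im tau)%R -> F1 (tau + 1) = zeta * F2 tau /\ F2 (tau + 1) = zeta * F1 tau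
  /\ F3 (tau + 1) = F3 tau.
Proof.
intro H. destruct (theta_T tau H) as [A2 [A3 A4]]. unfold F1, F2, F3. rewrite A2, A3, A4.
split; [ring|split; [ring|]].
replace ((zeta * theta2 tau) ^ 8) with ((zeta * zeta) ^ 4 * theta2 tau ^ 8) by ring.
  rewrite zeta_sqr.
replace (Ci ^ 4) with (RtoC 1). ring. replace (Ci ^ 4) with ((Ci * Ci) * (Ci * Ci)) by ring.
  rewrite Ci_sqr. ring.
Qed.

Lemma holomorphic_F1 : holomorphic_H F1.
Proof. unfold F1. apply (holomorphic_mult (fun t => theta2 t * theta3 t ^ 8) theta4).
  apply (holomorphic_mult theta2 (fun t => theta3 t ^ 8)). apply holomorphic_theta2.
  apply holomorphic_pow, holomorphic_theta3. apply holomorphic_theta4. Qed.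

Lemma holomorphic_F2 : holomorphic_H F2.
Proof. unfold F2. apply (holomorphic_mult (fun t => theta2 t * theta3 t) (fun t => theta4 t ^
  8)). apply (holomorphic_mult theta2 theta3). apply holomorphic_theta2.
  apply holomorphic_theta3. apply holomorphic_pow, holomorphic_theta4. Qed.

Lemma holomorphic_F3 : holomorphic_H F3.
Proof. unfold F3. apply (holomorphic_mult (fun t => theta2 t ^ 8 * theta3 t) theta4).
  apply (holomorphic_mult (fun t => theta2 t ^ 8) theta3). apply holomorphic_pow,
  holomorphic_theta2. apply holomorphic_theta3. apply holomorphic_theta4. Qed.

Local Open Scope R_scope.

(** * Regularity and decay of the three products *)

(** For [Im z >= 1] each term is largest at [Im z = 1]. In [theta2] the power
    [q ^ (1 / 4)] of the nome is split off, and the other exponents [n ^ 2 +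
    n] are nonnegative. *)
Lemma theta_bounds : exists A, 1 <= A /\ forall z, 1 <= Im z ->
  Cmod (theta2 z) <= A * exp (- (PI / 4) * Im z) /\ Cmod (theta3 z) <= A /\ Cmod (theta4 z) <= A.
Proof.
assert (P := PI_RGT_0).
set (M := gauss_maj 0 PI PI).
assert (SM : summableZ M) by (apply gauss_maj_summable; lra).
assert (PM : 0 <= SeriesZ M). { apply SeriesZ_pos; auto. intro n. apply Rmult_le_pos. simpl;
  lra. left; apply exp_pos. }
exists (1 + 2 * SeriesZ M). split. lra.
assert (B : forall al be, (forall n, Re (al * RtoC (IZR n ^ 2) + be * RtoC (IZR n))%C <= - PI *
  IZR n ^ 2 + PI * Rabs (IZR n)) -> Cmod (theta_sum 0 al be) <= 1 + 2 * SeriesZ M).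
{ intros al be H. apply Rle_trans with (2 * SeriesZ M); [|lra]. apply CSeriesZ_bound; auto.
  intro n. unfold theta_term, M, gauss_maj. simpl (_ ^ 0). rewrite Cmult_1_l, Rmult_1_l,
    Cmod_Cexp. now apply exp_le. }
intros z Hz. assert (Hz' : 0 < Im z) by lra.
rewrite theta2_theta_sum, theta3_theta_sum, theta4_theta_sum by auto.
assert (N2 : forall n, IZR n * IZR n <= IZR n * IZR n * Im z). { intro n.
  assert (Q := Rle_0_sqr (IZR n)). unfold Rsqr in Q. nra. }
assert (N1 : forall n, 0 <= PI * Rabs (IZR n)). { intro n. apply Rmult_le_pos. lra.
  apply Rabs_pos. }
split; [|split].
- rewrite Cmod_mult, Cmod_Cexp, Rmult_comm. apply Rmult_le_compat; try apply Cmod_ge_0. left;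
    apply exp_pos.
  + apply B. intro n. replace (Re (PI * Ci * z * (IZR n ^ 2)%R + PI * Ci * z * IZR n)%C) with (-
      PI * ((IZR n ^ 2 + IZR n) * Im z)).
    2:{ unfold Re, Im; simpl. ring. }
    assert (K : 0 <= IZR n ^ 2 + IZR n). { replace (IZR n ^ 2 + IZR n) with (IZR (n * n + n)).
      apply IZR_le. nia. rewrite plus_IZR, mult_IZR. simpl. ring. }
    assert (K2 : - Rabs (IZR n) <= IZR n). { assert (X := Rle_abs (- IZR n)).
      rewrite Rabs_Ropp in X. lra. }
    assert (K3 : IZR n ^ 2 + IZR n <= (IZR n ^ 2 + IZR n) * Im z) by nra.
    assert (PI * (IZR n ^ 2 - Rabs (IZR n)) <= PI * ((IZR n ^ 2 + IZR n) * Im z)) by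
      (apply Rmult_le_compat_l; lra). lra.
  + apply exp_le. right. unfold Re, Im; simpl. field.
- apply B. intro n. replace (Re (PI * Ci * z * (IZR n ^ 2)%R + 0 * IZR n)%C) with (- PI * (IZR n
    * IZR n * Im z)).
  2:{ unfold Re, Im; simpl. ring. }
  assert (Q := N2 n). assert (Q' := N1 n). simpl. nra.
- apply B. intro n. replace (Re (PI * Ci * z * (IZR n ^ 2)%R + PI * Ci * IZR n)%C) with (- PI *
    (IZR n * IZR n * Im z)).
  2:{ unfold Re, Im; simpl. ring. }
  assert (Q := N2 n). assert (Q' := N1 n). simpl. nra.
Qed.

Definition exp_decay (F : C -> C) := exists K, 0 <= K /\ forall z, 1 <= Im z ->
  Cmod (F z) <= K * exp (- (PI / 4) * Im z).

Lemma exp_decay_F : exp_decay F1 /\ exp_decay F2 /\ exp_decay F3.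
Proof.
destruct theta_bounds as [A [HA HB]]. assert (P := PI_RGT_0).
assert (X : forall a b c : R, forall n m, 0 <= a <= A -> 0 <= b <= A -> 0 <= c ->
  c * a ^ n * b ^ m <= c * A ^ n * A ^ m).
{ intros a b c n m Ha Hb Hc. apply Rmult_le_compat. apply Rmult_le_pos; auto. apply pow_le; lra.
    apply pow_le; lra.
  apply Rmult_le_compat_l; auto. apply pow_incr; lra. apply pow_incr; lra. }
assert (PA : forall n, 0 <= A ^ n) by (intro; apply pow_le; lra).
unfold exp_decay, F1, F2, F3; split; [|split].
- exists (A * A ^ 8 * A ^ 1). split. assert (Q := PA 8%nat). assert (Q' := PA 1%nat).
    apply Rmult_le_pos; auto; nra.
  intros z Hz. destruct (HB z Hz) as [B2 [B3 B4]]. rewrite !Cmod_mult, Cmod_pow.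
  replace (A * A ^ 8 * A ^ 1 * exp (- (PI / 4) * Im z)) with ((A * exp (- (PI / 4) * Im z))
    * A ^ 8 * A ^ 1) by ring.
  rewrite <- (pow_1 (Cmod (theta4 z))).
  apply Rle_trans with (Cmod (theta2 z) * A ^ 8 * A ^ 1). apply X; auto using Cmod_ge_0.
  apply Rmult_le_compat_r; auto. apply Rmult_le_compat_r; auto.
- exists (A * A ^ 1 * A ^ 8). split. assert (Q := PA 8%nat). assert (Q' := PA 1%nat).
    apply Rmult_le_pos; auto; nra.
  intros z Hz. destruct (HB z Hz) as [B2 [B3 B4]]. rewrite !Cmod_mult, Cmod_pow.
  replace (A * A ^ 1 * A ^ 8 * exp (- (PI / 4) * Im z)) with ((A * exp (- (PI / 4) * Im z))
    * A ^ 1 * A ^ 8) by ring.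
  rewrite <- (pow_1 (Cmod (theta3 z))).
  apply Rle_trans with (Cmod (theta2 z) * A ^ 1 * A ^ 8). apply X; auto using Cmod_ge_0.
  apply Rmult_le_compat_r; auto. apply Rmult_le_compat_r; auto.
- exists (A ^ 8 * A ^ 1 * A ^ 1). split. assert (Q := PA 8%nat). assert (Q' := PA 1%nat).
    apply Rmult_le_pos; auto; nra.
  intros z Hz. destruct (HB z Hz) as [B2 [B3 B4]]. rewrite !Cmod_mult, Cmod_pow.
  set (e := exp (- (PI / 4) * Im z)) in *.
  assert (He : 0 < e <= 1). { split. apply exp_pos. unfold e. rewrite <- exp_0. apply exp_le.
    nra. }
  rewrite <- (pow_1 (Cmod (theta3 z))), <- (pow_1 (Cmod (theta4 z))).
  apply Rle_trans with (Cmod (theta2 z) ^ 8 * A ^ 1 * A ^ 1). apply X; auto using Cmod_ge_0.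
    apply pow_le, Cmod_ge_0.
  replace (A ^ 8 * A ^ 1 * A ^ 1 * e) with ((A ^ 8 * e) * A ^ 1 * A ^ 1) by ring.
  apply Rmult_le_compat_r; auto. apply Rmult_le_compat_r; auto.
  apply Rle_trans with ((A * e) ^ 8). apply pow_incr. split; auto. apply Cmod_ge_0.
  rewrite Rpow_mult_distr. apply Rmult_le_compat_l; auto. simpl (e ^ 8).
  assert (Y : forall x, 0 <= x <= 1 -> e * x <= e) by (intros; nra). apply Y.
  assert (Y' : forall x, 0 <= x <= 1 -> 0 <= e * x <= 1) by (intros; nra). do 7 (try apply Y').
    lra.
Qed.

Lemma exp_decay_quad F k : exp_decay F -> (k <= 3)%nat -> quad_decay (fun z => F z * z ^ k)%C.
Proof.
intros [K [PK HK]] Hk. assert (P := PI_RGT_0).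
destruct (pow_le_exp 5) as [L [PL HL]].
exists (K * 8 * (L * (4 / PI) ^ 5)). split.
{ apply Rmult_le_pos. lra. apply Rmult_le_pos. lra. apply pow_le. left; apply Rdiv_lt_0_compat;
    lra. }
intros z Hr Hi. rewrite Cmod_mult, Cmod_pow. set (y := Im z) in *.
assert (Bz : 1 <= Cmod z <= 2 * y).
{ split. apply Rle_trans with (2 := im_le_Cmod z). fold y. rewrite Rabs_pos_eq; lra.
  eapply Rle_trans. apply Cmod_le_Re_Im. fold y. rewrite (Rabs_pos_eq y) by lra.
    assert (Rabs (Re z) <= 1) by (apply Rabs_le; lra). lra. }
assert (Bk : Cmod z ^ k <= 8 * y ^ 3).
{ apply Rle_trans with (Cmod z ^ 3). apply Rle_pow; auto; lra.
    replace (8 * y ^ 3) with ((2 * y) ^ 3) by ring. apply pow_incr. lra. }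
assert (E := HK z Hi). fold y in E.
assert (Ey := HL (PI / 4 * y) ltac:(apply Rmult_le_pos; lra)).
apply Rle_trans with (K * exp (- (PI / 4) * y) * (8 * y ^ 3)).
apply Rmult_le_compat; auto. apply Cmod_ge_0. apply pow_le, Cmod_ge_0.
apply Rmult_le_reg_r with (y ^ 2). apply pow_lt; lra.
replace (K * 8 * (L * (4 / PI) ^ 5) / y ^ 2 * y ^ 2) with (K * 8 * (L * (4 / PI) ^ 5)) by
  (field; lra).
replace (K * exp (- (PI / 4) * y) * (8 * y ^ 3) * y ^ 2) with (K * 8 * (exp (- (PI / 4) * y) * y
  ^ 5)) by ring.
apply Rmult_le_compat_l. lra.
rewrite Rpow_mult_distr in Ey.
apply Rmult_le_reg_l with ((PI / 4) ^ 5 * exp (PI / 4 * y)). apply Rmult_lt_0_compat.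
  apply pow_lt; lra. apply exp_pos.
replace ((PI / 4) ^ 5 * exp (PI / 4 * y) * (L * (4 / PI) ^ 5)) with (L * exp (PI / 4 * y)) by
  (field; lra).
replace ((PI / 4) ^ 5 * exp (PI / 4 * y) * (exp (- (PI / 4) * y) * y ^ 5))
  with ((PI / 4) ^ 5 * y ^ 5 * (exp (PI / 4 * y + - (PI / 4) * y))) by (rewrite exp_plus; ring).
replace (PI / 4 * y + - (PI / 4) * y) with 0 by ring. rewrite exp_0. lra.
Qed.

(** * Period coefficients *)

(** The degree 3 of [(tau - X) ^ 3] is why only the exponents up to 3 matter. *)
Definition moment_primitives (F : C -> C) (P : nat -> C -> C) : Prop := forall k, (k <= 3)%nat ->
  primitive_H (fun z => F z * z ^ k)%C (P k) /\ forall x, -1 <= x <= 1 -> limit_at_top (P k) x 0.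

Lemma moment_primitives_exist F : holomorphic_H F -> exp_decay F -> exists P,
  moment_primitives F P.
Proof.
intros HF ED.
assert (X : forall k, (k <= 3)%nat -> exists Q, primitive_H (fun z => F z * z ^ k)%C Q /\ forall
  x, -1 <= x <= 1 -> limit_at_top Q x 0).
{ intros k Hk. apply decaying_primitive_exists. apply holomorphic_mult; auto.
    apply holomorphic_pow, holomorphic_id. now apply exp_decay_quad. }
destruct (X 0%nat ltac:(lia)) as [Q0 H0]. destruct (X 1%nat ltac:(lia)) as [Q1 H1].
destruct (X 2%nat ltac:(lia)) as [Q2 H2]. destruct (X 3%nat ltac:(lia)) as [Q3 H3].
exists (fun k => match k with 0 => Q0 | 1 => Q1 | 2 => Q2 | _ => Q3 end)%nat.
intros k Hk. destruct k as [|[|[|[|k]]]]; auto. lia.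
Qed.

Local Open Scope C_scope.

Lemma Im_inv_pos sg tau : sg * tau = - (1) -> (0 < Im tau)%R -> (0 < Im sg)%R.
Proof.
intros E H. assert (N := Cnz_of_Im _ H).
assert (Es : sg = - / tau). { replace sg with (sg * tau * / tau) by (field; auto). rewrite E.
  ring. }
rewrite Es. destruct tau as [a b]; simpl in *. unfold Im in *; simpl in *.
assert (0 < a * (a * 1) + b * (b * 1))%R by nra.
replace (- (- b / (a * (a * 1) + b * (b * 1))))%R with (b / (a * (a * 1) + b * (b * 1)))%R by
  (field; lra).
now apply Rdiv_lt_0_compat.
Qed.

(** If [P] and [Q] consist of decaying primitives of the moments of [F] and of
    its image [Fs] under inversion, then the first summand is minus the
    integral of [F z ^ k] from [tau] to infinity. The second summand is minus
    the integral from 0 to [tau], moved to infinity by [z = - 1 / u]. *)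
Definition period_coeff (P Q : nat -> C -> C) k (tau sg : C) := P k tau + Ci * (- (1))
  ^ k * Q (3 - k)%nat sg.

(** Along a segment the derivatives of the two summands cancel, by the
    transformation law of weight 5 and the jacobian [u ^ 2] of the inversion:
    [5 = 3 + 2]. *)
Lemma period_coeff_const F Fs P Q k : (k <= 3)%nat ->
  (forall sg tau, (0 < Im sg)%R -> (0 < Im tau)%R -> sg * tau = - (1) ->
    Fs sg = - Ci * tau ^ 5 * F tau) ->
  moment_primitives F P -> moment_primitives Fs Q -> forall a b, (0 < Im a)%R -> (0 < Im b)%R ->
    period_coeff P Q k a (- / a) = period_coeff P Q k b (- / b).
Proof.
intros Hk HI HP HQ a b Ha Hb.
set (u := fun s => period_coeff P Q k (segm a b s) (- / segm a b s)).
assert (E : u 0%R = u 1%R).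
{ apply is_derC_zero_eq. lra. intros s Hs.
  assert (H := segm_H a b s Ha Hb Hs). assert (N := Cnz_of_Im _ H).
  assert (HN : (- / segm a b s) * segm a b s = - (1)) by (field; auto).
  assert (HS := Im_inv_pos _ _ HN H).
  assert (D1 := primitive_segm _ _ a b s (proj1 (HP k Hk)) Ha Hb Hs).
  assert (D2 : is_derC (fun s => Q (3 - k)%nat (- / segm a b s))
    s (Fs (- / segm a b s) * (- / segm a b s) ^ (3 - k) * ((b - a) / (segm a b s * segm a b s)))).
  { assert (L := Im_pos_locally (segm a b) s (continuous_segm a b s) H).
    apply (proj1 (HQ (3 - k)%nat ltac:(lia)) (fun s => - / segm a b s) (fun s => (b - a) / (segm
      a b s * segm a b s))); auto.
    - apply filter_imp with (2 := L). intros t Ht. eapply is_derive_Ceq. apply is_derive_Copp.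
        apply is_derive_Cinv. apply is_derC_segm.
      now apply Cnz_of_Im. field. now apply Cnz_of_Im.
    - unfold Cdiv. apply continuous_Cmult. apply continuous_const. apply continuous_Cinv.
        apply continuous_Cmult; apply continuous_segm.
      now apply Cmult_neq_0. }
  rewrite (HI _ _ HS H HN) in D2.
  unfold u, period_coeff. eapply is_derive_Ceq. apply is_derive_Cplus. exact D1.
    apply is_derive_Cmult. apply is_derive_Cconst. exact D2.
  cbv beta. set (z := segm a b s) in *.
  destruct k as [|[|[|[|k]]]]; [| | | |lia]; simpl;
  (match goal with |- ?X + ?Y = _ => replace Y with (- (1) * (Ci * Ci) * (- X));
    [rewrite Ci_sqr; ring|field; auto] end). }
unfold u in E. replace (segm a b 0) with a in E by (unfold segm; ring).
  replace (segm a b 1) with b in E by (unfold segm; ring). exact E.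
Qed.

Lemma flim_plus {T} (Fl : (T -> Prop) -> Prop) {FF : Filter Fl} (f g : T -> C) (a b : C) :
  filterlim f Fl (locally a) -> filterlim g Fl (locally b) ->
    filterlim (fun t => f t + g t) Fl (locally (a + b)).
Proof.
intros H1 H2. apply (filterlim_comp_2 (H := locally (b : C_R_NormedModule))
  f g (fun x y : C => x + y) H1 H2).
exact (filterlim_plus (V := C_R_NormedModule) a b).
Qed.

Lemma flim_scal {T} (Fl : (T -> Prop) -> Prop) {FF : Filter Fl} (c : C) (f : T -> C) (a : C) :
  filterlim f Fl (locally a) -> filterlim (fun t => c * f t) Fl (locally (c * a)).
Proof.
intros H1. apply (filterlim_comp _ _ _ f (fun x => c * x) _ _ _ H1).
exact (continuous_Cmult (fun _ => c) (fun x : C => x) a (continuous_const _ _) (continuous_id _)).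
Qed.

Lemma flim_comb4 {T} (Fl : (T -> Prop) -> Prop) {FF : Filter Fl} (f0 f1 f2 f3 : T -> C)
  (c0 c1 c2 c3 l0 l1 l2 l3 : C) :
  filterlim f0 Fl (locally l0) -> filterlim f1 Fl (locally l1) ->
  filterlim f2 Fl (locally l2) -> filterlim f3 Fl (locally l3) ->
  filterlim (fun t => c0 * f0 t + c1 * f1 t + c2 * f2 t + c3 * f3 t) Fl
    (locally (c0 * l0 + c1 * l1 + c2 * l2 + c3 * l3)).
Proof.
intros H0 H1 H2 H3.
exact (flim_plus _ _ _ _ _ (flim_plus _ _ _ _ _ (flim_plus _ _ _ _ _
  (flim_scal _ c0 _ _ H0) (flim_scal _ c1 _ _ H1)) (flim_scal _ c2 _ _ H2))
    (flim_scal _ c3 _ _ H3)).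
Qed.

Lemma moment_primitives_comb F P (c0 c1 c2 c3 : C) : moment_primitives F P ->
  primitive_H (fun z => F z * (c0 + c1 * z + c2 * z ^ 2 + c3 * z ^ 3))
    (fun z => c0 * P 0%nat z + c1 * P 1%nat z + c2 * P 2%nat z + c3 * P 3%nat z) /\
  forall x, (-1 <= x <= 1)%R -> limit_at_top (fun z => c0 * P 0%nat z + c1 * P 1%nat z + c2 * P
    2%nat z + c3 * P 3%nat z) x 0.
Proof.
intro H. split.
- intros g g' s A1 A2 A3. assert (D : forall k, (k <= 3)%nat -> is_derC (fun t => P k (g t))
    s (F (g s) * g s ^ k * g' s)).
  { intros k Hk. apply (proj1 (H k Hk)); auto. }
  assert (D0 := D 0%nat ltac:(lia)). assert (D1 := D 1%nat ltac:(lia)).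
    assert (D2 := D 2%nat ltac:(lia)). assert (D3 := D 3%nat ltac:(lia)).
  eapply is_derive_Ceq. cder. cbv beta. ring.
- intros x Hx. unfold limit_at_top. replace (RtoC 0) with (c0 * 0 + c1 * 0 + c2 * 0 + c3 * 0) by
    ring.
  apply flim_comb4; [exact _| | | |]; apply H; lia || lra.
Qed.

(** The fundamental theorem of calculus on [[a, b]], followed by the limits [a
    -> 0] and [b -> oo]. *)
Lemma int_0_ioo_primitive (f : C -> C) (R0 : C -> C) (l : C) :
  (forall t, (0 < t)%R -> is_derC (fun t => R0 (vert 0 t)) t (f (vert 0 t) * Ci)) ->
  (forall z, (0 < Im z)%R -> continuous f z) -> limit_at_top R0 0 0 ->
  filterlim (fun t => R0 (vert 0 t)) (at_right 0) (locally l) -> int_0_ioo f = - l.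
Proof.
intros HD HC H1 H2. unfold int_0_ioo. apply (is_RInt_gen_unique (V := C_R_CompleteNormedModule)).
unfold is_RInt_gen.
assert (Hv : forall t, Ci * RtoC t = vert 0 t) by (intro t; unfold vert; ring).
apply (filterlimi_lim_ext_loc (fun ab : R * R => R0 (vert 0 (snd ab)) + (- (1))
  * R0 (vert 0 (fst ab)))).
- apply Filter_prod with (fun a => 0 < a < 1)%R (fun b => 1 < b)%R.
  + exists (mkposreal 1 Rlt_0_1). intros y Hy Hp. change (Rabs (y - 0) < 1)%R in Hy.
      rewrite Rminus_0_r, Rabs_pos_eq in Hy; lra.
  + now exists 1%R.
  + intros a b Ha Hb. simpl.
    assert (I : is_RIntC (fun t => f (vert 0 t) * Ci) a b (R0 (vert 0 b) - R0 (vert 0 a))).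
    { apply (is_RIntC_derive (fun t => R0 (vert 0 t))). lra. intros t Ht. apply HD; lra.
      intros t Ht. apply continuous_Cmult. apply (continuous_comp (vert 0) f). unfold vert;
        ccont. apply HC. rewrite Im_vert; lra. apply continuous_const. }
    replace (R0 (vert 0 b) + - (1) * R0 (vert 0 a)) with (R0 (vert 0 b) - R0 (vert 0 a)) by ring.
    revert I. apply is_RIntC_ext. intro t. now rewrite Hv.
- replace (- l) with (0 + (- (1)) * l) by ring.
  apply flim_plus. exact _.
  + apply (filterlim_comp _ _ _ (fun ab : R * R => snd ab) (fun t => R0 (vert 0 t))
      _ (Rbar_locally p_infty)). apply filterlim_snd. exact H1.
  + apply flim_scal. exact _. apply (filterlim_comp _ _ _ (fun ab : R * R => fst ab) (fun t =>
      R0 (vert 0 t)) _ (at_right 0)). apply filterlim_fst. exact H2.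
Qed.

(** The limit at 0 is read off from [period_coeff_const], since the second
    summand of [period_coeff] tends to 0 there. *)
Lemma moment_primitives_lim0 F Fs P Q k : (k <= 3)%nat ->
  (forall sg tau, (0 < Im sg)%R -> (0 < Im tau)%R -> sg * tau = - (1) ->
    Fs sg = - Ci * tau ^ 5 * F tau) ->
  moment_primitives F P -> moment_primitives Fs Q -> forall a, (0 < Im a)%R ->
    filterlim (fun t => P k (vert 0 t)) (at_right 0) (locally (period_coeff P Q k a (- / a))).
Proof.
intros Hk HI HP HQ a Ha.
apply (filterlim_ext_loc (fun t => period_coeff P Q k a (- / a) + (- Ci * (- (1))
  ^ k) * Q (3 - k)%nat (vert 0 (/ t)))).
- exists (mkposreal 1 Rlt_0_1). intros t _ Ht.
  assert (H : (0 < Im (vert 0 t))%R) by (rewrite Im_vert; auto).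
  rewrite (period_coeff_const F Fs P Q k Hk HI HP HQ a (vert 0 t) Ha H). unfold period_coeff.
  replace (- / vert 0 t) with (vert 0 (/ t)). ring.
  unfold vert. rewrite RtoC_inv by lra.
  assert (Nt : RtoC t <> 0). { intro E. apply RtoC_inj in E. lra. }
  assert (Ni : Ci <> 0). { intro E. apply (f_equal Im) in E. simpl in E. lra. }
  replace (0 + Ci * t) with (Ci * t) by ring.
  transitivity ((Ci * Ci) / (Ci * t)); [field | rewrite Ci_sqr; field]; split; auto.
- generalize (period_coeff P Q k a (- / a)); intro w.
  assert (E : w + (- Ci * (- (1)) ^ k) * 0 = w) by ring.
  enough (L : filterlim (fun t => w + (- Ci * (- (1)) ^ k) * Q (3 - k)%nat (vert 0 (/ t)))
    (at_right 0) (locally (w + (- Ci * (- (1)) ^ k) * 0))) by now rewrite E in L.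
  apply flim_plus. exact _. apply filterlim_const. apply flim_scal. exact _.
  apply (filterlim_comp _ _ _ Rinv (fun y => Q (3 - k)%nat (vert 0 y)) _ (Rbar_locally p_infty)).
  apply filterlim_Rinv_0_right. apply (HQ (3 - k)%nat ltac:(lia)). lra.
Qed.

Lemma period_poly_coeff F Fs P Q a X : holomorphic_H F ->
  (forall sg tau, (0 < Im sg)%R -> (0 < Im tau)%R -> sg * tau = - (1) ->
    Fs sg = - Ci * tau ^ 5 * F tau) ->
  moment_primitives F P -> moment_primitives Fs Q -> (0 < Im a)%R ->
  let W := fun k => period_coeff P Q k a (- / a) in
  period_poly F X = - ((- X ^ 3) * W 0%nat + (3 * X ^ 2) * W 1%nat + (- (3) * X) * W 2%nat + 1 *
    W 3%nat).
Proof.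
intros HF HI HP HQ Ha W. unfold period_poly.
destruct (moment_primitives_comb F P (- X ^ 3) (3 * X ^ 2) (- (3) * X) 1 HP) as [L1 L2].
apply (int_0_ioo_primitive _ (fun z => (- X ^ 3) * P 0%nat z + (3 * X ^ 2) * P 1%nat z + (- (3)
  * X) * P 2%nat z + 1 * P 3%nat z)).
- intros t Ht. eapply is_derive_Ceq. apply (primitive_vert _ _ 0 t L1 Ht). cbv beta. ring.
- intros z Hz. destruct HF as [F' [_ [CF _]]]. apply continuous_Cmult. now apply CF.
  apply (continuous_Cpow (fun z : C => z - X) 3). ccont.
- apply L2. lra.
- apply flim_comb4; [exact _| | | |]; apply (moment_primitives_lim0 F Fs); auto; lia.
Qed.

(** Both sides are decaying primitives, on the line [Re z = - 1 / 2], of the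
    same function; [F (z + 1) * (z + 1) ^ k] is expanded with the binomial
    formula. *)
Lemma moment_primitives_shift F Fs P Q (c : C) k (c0 c1 c2 c3 : C) y : (k <= 3)%nat ->
  moment_primitives F P -> moment_primitives Fs Q ->
  (forall z, (0 < Im z)%R -> F (z + 1) = c * Fs z) -> (0 < y)%R ->
  (forall z, (z + 1) ^ k = c0 + c1 * z + c2 * z ^ 2 + c3 * z ^ 3) ->
  let z := vert (-1/2) y in
  P k (z + 1) = c * (c0 * Q 0%nat z + c1 * Q 1%nat z + c2 * Q 2%nat z + c3 * Q 3%nat z).
Proof.
intros Hk HP HQ HT Hy Hc z.
destruct (moment_primitives_comb Fs Q (c * c0) (c * c1) (c * c2) (c * c3) HQ) as [L1 L2].
replace (c * (c0 * Q 0%nat z + c1 * Q 1%nat z + c2 * Q 2%nat z + c3 * Q 3%nat z))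
  with (c * c0 * Q 0%nat z + c * c1 * Q 1%nat z + c * c2 * Q 2%nat z + c * c3 * Q 3%nat z) by
  ring.
unfold z. apply (decaying_primitive_unique _ (fun z => P k (z + 1))
  (fun z => c * c0 * Q 0%nat z + c * c1 * Q 1%nat z + c * c2 * Q 2%nat z + c * c3 * Q 3%nat z)
  (-1/2)) with (2 := L1).
- intros g g' s A1 A2 A3. eapply is_derive_Ceq.
  apply (proj1 (HP k Hk) (fun t => g t + 1) g'); auto.
  + apply filter_imp with (2 := A1). intros t Ht. eapply is_derive_Ceq. apply is_derive_Cplus.
      exact Ht. apply is_derive_Cconst. ring.
  + change (0 < Im (g s) + 0)%R. lra.
  + cbv beta. rewrite HT by auto. rewrite Hc. ring.
- unfold limit_at_top. apply (filterlim_ext (fun y => P k (vert (1/2) y))).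
  + intro t. f_equal. unfold vert. apply injective_projections; simpl; field.
  + apply (HP k Hk). lra.
- apply L2. lra.
- exact Hy.
Qed.

(** * Linear relations between the periods *)

Lemma linear_combination6 (l0 r0 l1 r1 l2 r2 l3 r3 l4 r4 l5 r5 c0 c1 c2 c3 c4 c5 X Y : C) :
  l0 = r0 -> l1 = r1 -> l2 = r2 -> l3 = r3 -> l4 = r4 -> l5 = r5 ->
  X = Y + (c0 * (l0 - r0) + c1 * (l1 - r1) + c2 * (l2 - r2) +
           c3 * (l3 - r3) + c4 * (l4 - r4) + c5 * (l5 - r5)) -> X = Y.
Proof. intros -> -> -> -> -> -> ->. ring. Qed.

(** The letters [u], [v], [w] stand for the values at [rho - 1] of the
    primitives attached to [F1], [F2], [F3], and [z] for [zeta]. The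
    hypotheses say that the period coefficients are the same at [rho] and at
    [rho - 1], where the values at [rho] are expressed by those at [rho - 1]
    through the translation; by [period_coeff_dual] the cases [k = 2], [k = 3]
    for [F1] and all the cases for [F3] are multiples of these six. Each claim
    is a linear combination of the hypotheses. *)
Lemma moment_relations (z u0 u1 u2 u3 v0 v1 v2 v3 w0 w1 w2 w3 : C) :
  z * z = Ci ->
  let A3 := u3 - Ci * (z * v0) in
  let B0 := v0 + Ci * (w0 + 3 * w1 + 3 * w2 + w3) in
  let B1 := v1 - Ci * (w0 + 2 * w1 + w2) in
  let B2 := v2 + Ci * (w0 + w1) in
  let B3 := v3 - Ci * w0 in
  z * v0 + Ci * u3 = u0 + Ci * (z * (v0 + 3 * v1 + 3 * v2 + v3)) ->
  z * (v0 + v1) - Ci * u2 = u1 - Ci * (z * (v0 + 2 * v1 + v2)) ->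
  z * u0 + Ci * w3 = B0 ->
  z * (u0 + u1) - Ci * w2 = B1 ->
  z * (u0 + 2 * u1 + u2) + Ci * w1 = B2 ->
  z * (u0 + 3 * u1 + 3 * u2 + u3) - Ci * w0 = B3 ->
  B1 = - (/ 12) * B3 /\ B2 = - (Ci / 4) * B3 /\ B3 = 2 * (z * (1 - Ci)) / 3 * A3.
Proof.
intros Hz A3 B0 B1 B2 B3 e0 e1 f0 f1 f2 f3.
assert (H4 : z * z * z * z = - (1)).
{ rewrite <- Ci_sqr, <- Hz. ring. }
(* The coefficients come from Gaussian elimination over the field Q(zeta). *)
split; [|split].
- apply (linear_combination6 _ _ _ _ _ _ _ _ _ _ _ _
    ((z - z * z * z) / 24) ((- z * z * z - z) / 8) (/ 3) (- / 2) (/ 4) (- / 24 - Ci / 24)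
    _ _ e0 e1 f0 f1 f2 f3).
  unfold A3, B0, B1, B2, B3. rewrite <- Hz. field [H4].
- apply (linear_combination6 _ _ _ _ _ _ _ _ _ _ _ _
    ((z + z * z * z) / 8) ((z * z * z - z) / 8) 0 (/ 2) (- / 2 + Ci / 4) (/ 8 - Ci / 8)
    _ _ e0 e1 f0 f1 f2 f3).
  unfold A3, B0, B1, B2, B3. rewrite <- Hz. field [H4].
- apply (linear_combination6 _ _ _ _ _ _ _ _ _ _ _ _
    (z / 2 + z * z * z / 6) (z / 2 + z * z * z / 2) 0 0 1 (- / 2 + Ci / 6)
    _ _ e0 e1 f0 f1 f2 f3).
  unfold A3, B0, B1, B2, B3. rewrite <- Hz. field [H4].
Qed.

(** Inversion exchanges the two ends of the path of integration. *)
Lemma period_coeff_dual P Q k tau sg : (k <= 3)%nat -> period_coeff Q P k sg tau = Ci * (- (1))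
  ^ k * period_coeff P Q (3 - k) tau sg.
Proof.
intro Hk. unfold period_coeff.
destruct k as [|[|[|[|k]]]]; [| | | |lia]; simpl;
match goal with |- ?x + _ = _ => replace x with (- (Ci * Ci) * x) at 1 by (rewrite Ci_sqr;
  ring); ring end.
Qed.

Theorem theorem3p2 :
  let R_1 := period_poly F1 in
  let R_2 := period_poly F2 in
  let R_3 := period_poly F3 in
  R_2 0 = 2 * sqrt 2 / 3 * R_1 0 /\
  (forall X : C,
     R_2 X = R_2 0 * (1 + 3 * Ci / 4 * X - 1 / 4 * X ^ 2)
             - Ci * R_3 0 * X ^ 3) /\
  (forall X : C,
     R_3 X = R_3 0 + R_2 0 * (Ci / 4 * X - 3 / 4 * X ^ 2 - Ci * X ^ 3)).
Proof.
destruct exp_decay_F as [E1 [E2 E3]].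
destruct (moment_primitives_exist F1 holomorphic_F1 E1) as [P1 H1].
  destruct (moment_primitives_exist F2 holomorphic_F2 E2) as [P2 H2].
  destruct (moment_primitives_exist F3 holomorphic_F3 E3) as [P3 H3].
assert (S1 : forall sg tau, (0 < Im sg)%R -> (0 < Im tau)%R -> sg * tau = - (1) ->
  F1 sg = - Ci * tau ^ 5 * F1 tau) by (intros; now apply F_inversion).
assert (S2 : forall sg tau, (0 < Im sg)%R -> (0 < Im tau)%R -> sg * tau = - (1) ->
  F3 sg = - Ci * tau ^ 5 * F2 tau) by (intros; now apply F_inversion).
assert (S3 : forall sg tau, (0 < Im sg)%R -> (0 < Im tau)%R -> sg * tau = - (1) ->
  F2 sg = - Ci * tau ^ 5 * F3 tau) by (intros; now apply F_inversion).
(* The point [rho] is [exp (i pi / 3)]: translation by [-1] and inversion both send it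
   to [sg], so there the two transformation laws can be compared. *)
set (h := (sqrt 3 / 2)%R).
assert (Hh : (h * h = 3 / 4)%R). { unfold h. replace (sqrt 3 / 2 * (sqrt 3 / 2))%R with (sqrt 3
  * sqrt 3 / 4)%R by field. rewrite sqrt_sqrt; lra. }
assert (Ph : (0 < h)%R) by (unfold h; apply Rdiv_lt_0_compat; [apply sqrt_lt_R0|]; lra).
set (sg := vert (-1/2) h). set (rho := sg + 1).
assert (Hs : (0 < Im sg)%R) by (unfold sg; now rewrite Im_vert).
assert (Hr : (0 < Im rho)%R) by (change (0 < Im sg + 0)%R; lra).
assert (Er : rho * sg = - (1)).
{ unfold rho, sg, vert. apply injective_projections; simpl; [|field].
  transitivity (- (1/4) - h * h)%R. field. rewrite Hh. field. }
assert (N1 := Cnz_of_Im _ Hs). assert (N2 := Cnz_of_Im _ Hr).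
assert (I1 : - / rho = sg). { replace sg with (rho * sg * / rho) by (field; auto). rewrite Er.
  ring. }
assert (I2 : - / sg = rho). { replace rho with (rho * sg * / sg) by (field; auto). rewrite Er.
  ring. }
assert (T1 := fun z Hz => proj1 (F_T z Hz)). assert (T2 := fun z Hz => proj1 (proj2 (F_T z Hz))).
assert (T3 : forall z, (0 < Im z)%R -> F3 (z + 1) = 1 * F3 z). { intros z Hz.
  rewrite (proj2 (proj2 (F_T z Hz))). ring. }
assert (Sh : forall F Fs P Q c, moment_primitives F P -> moment_primitives Fs Q -> (forall z,
  (0 < Im z)%R -> F (z + 1) = c * Fs z) ->
  P 0%nat rho = c * Q 0%nat sg /\ P 1%nat rho = c * (Q 0%nat sg + Q 1%nat sg) /\ P 2%nat rho = c
    * (Q 0%nat sg + 2 * Q 1%nat sg + Q 2%nat sg)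
  /\ P 3%nat rho = c * (Q 0%nat sg + 3 * Q 1%nat sg + 3 * Q 2%nat sg + Q 3%nat sg)).
{ intros F Fs P Q c HP HQ HT. unfold rho, sg. split; [|split; [|split]].
  - rewrite (moment_primitives_shift F Fs P Q c 0 1 0 0 0 h ltac:(lia) HP HQ HT Ph ltac:(intro;
      ring)). ring.
  - rewrite (moment_primitives_shift F Fs P Q c 1 1 1 0 0 h ltac:(lia) HP HQ HT Ph ltac:(intro;
      ring)). ring.
  - rewrite (moment_primitives_shift F Fs P Q c 2 1 2 1 0 h ltac:(lia) HP HQ HT Ph ltac:(intro;
      ring)). ring.
  - rewrite (moment_primitives_shift F Fs P Q c 3 1 3 3 1 h ltac:(lia) HP HQ HT Ph ltac:(intro;
      ring)). ring. }
destruct (Sh F1 F2 P1 P2 zeta H1 H2 T1) as [a0 [a1 [a2 a3]]].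
destruct (Sh F2 F1 P2 P1 zeta H2 H1 T2) as [b0 [b1 [b2 b3]]].
destruct (Sh F3 F3 P3 P3 1 H3 H3 T3) as [c0 [c1 [c2 c3]]].
assert (C1 := fun k Hk => period_coeff_const F1 F1 P1 P1 k Hk S1 H1 H1 rho sg Hr Hs).
assert (C2 := fun k Hk => period_coeff_const F2 F3 P2 P3 k Hk S2 H2 H3 rho sg Hr Hs).
rewrite I1, I2 in *.
assert (R1 := period_poly_coeff F1 F1 P1 P1 sg 0 holomorphic_F1 S1 H1 H1 Hs).
assert (R2 := fun X => period_poly_coeff F2 F3 P2 P3 sg X holomorphic_F2 S2 H2 H3 Hs).
assert (R3 := fun X => period_poly_coeff F3 F2 P3 P2 sg X holomorphic_F3 S3 H3 H2 Hs).
cbv zeta in R1, R2, R3. rewrite I2 in *.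
assert (R3' : forall X, period_poly F3 X =
  Ci * (period_coeff P2 P3 0 sg rho + 3 * X * period_coeff P2 P3 1 sg rho + 3 * X ^ 2 *
    period_coeff P2 P3 2 sg rho + X ^ 3 * period_coeff P2 P3 3 sg rho)).
{ intro X. rewrite R3, (period_coeff_dual P2 P3 0 rho sg), (period_coeff_dual P2 P3 1 rho sg),
    (period_coeff_dual P2 P3 2 rho sg), (period_coeff_dual P2 P3 3 rho sg) by lia.
  simpl (3 - _)%nat. rewrite (C2 0%nat), (C2 1%nat), (C2 2%nat), (C2 3%nat) by lia. ring. }
assert (e0 := C1 0%nat ltac:(lia)). assert (e1 := C1 1%nat ltac:(lia)).
assert (f0 := C2 0%nat ltac:(lia)). assert (f1 := C2 1%nat ltac:(lia)).
  assert (f2 := C2 2%nat ltac:(lia)). assert (f3 := C2 3%nat ltac:(lia)).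
(* The values at [rho] are eliminated in favour of the twelve values at [sg]. *)
destruct (moment_relations zeta (P1 0%nat sg) (P1 1%nat sg) (P1 2%nat sg) (P1 3%nat sg) (P2
  0%nat sg) (P2 1%nat sg) (P2 2%nat sg) (P2 3%nat sg)
  (P3 0%nat sg) (P3 1%nat sg) (P3 2%nat sg) (P3 3%nat sg) zeta_sqr) as [r1 [r2 r3]].
1-6: clear - e0 e1 f0 f1 f2 f3 a0 a1 a2 a3 b0 b1 b2 b3 c0 c1 c2 c3; unfold period_coeff in *;
  simpl (3 - _)%nat in *;
  rewrite ?a0, ?a1, ?a2, ?a3, ?b0, ?b1, ?b2, ?b3, ?c0, ?c1, ?c2, ?c3 in *.
1: (transitivity (zeta * P2 0%nat sg + Ci * (- (1)) ^ 0 * P1 3%nat sg); [ring | rewrite e0;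
  ring]).
1: (etransitivity; [|etransitivity; [exact e1|]]; ring).
1: (etransitivity; [|etransitivity; [exact f0|]]; ring).
1: (etransitivity; [|etransitivity; [exact f1|]]; ring).
1: (etransitivity; [|etransitivity; [exact f2|]]; ring).
1: (etransitivity; [|etransitivity; [exact f3|]]; ring).
assert (w1 : period_coeff P2 P3 1 sg rho = - (/ 12) * period_coeff P2 P3 3 sg rho).
{ unfold period_coeff; simpl (3 - _)%nat; rewrite c2, c0. etransitivity; [|etransitivity;
    [exact r1|]]; ring. }
assert (w2 : period_coeff P2 P3 2 sg rho = - (Ci / 4) * period_coeff P2 P3 3 sg rho).
{ unfold period_coeff; simpl (3 - _)%nat; rewrite c1, c0. etransitivity; [|etransitivity;
    [exact r2|]]; field. }
assert (w3 : period_coeff P2 P3 3 sg rho = 2 * sqrt 2 / 3 * period_coeff P1 P1 3 sg rho).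
{ unfold period_coeff; simpl (3 - _)%nat; rewrite c0, a0, zeta_sqrt2. etransitivity;
    [|etransitivity; [exact r3|]]; field. }
clear - R1 R2 R3' w1 w2 w3. intros R_1 R_2 R_3. unfold R_1, R_2, R_3. clear R_1 R_2 R_3.
split; [|split].
- rewrite R1, R2, w3. field.
- intro X. rewrite !R2, R3', w1, w2. assert (H := Ci_sqr). field [H].
- intro X. rewrite R2, !R3', w1, w2. assert (H := Ci_sqr). field [H].
Qed.
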